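(* Let $\sigma>0$, let $k\ge1$ be an integer, and let $X=\{x_i:i\in\mathbb{Z}\}$, $\cdots<x_{i-1}<x_i<x_{i+1}<\cdots$, be a separated set of real numbers, with $\gamma>0$ such that $\inf_{i\ne j}|x_i-x_j|\ge\gamma$, and suppose $\delta:=\sup_i(x_{i+1}-x_i)<\frac{\nu_k}{\sigma}$. Then for every $f\in\mathcal{B}_\sigma$, $$A\,\|\mathcal{D}^{k-1}f\|_2^2\ \le\ \sum_{i\in\mathbb{Z}}\sum_{l=0}^{k-1}|f^{(l)}(x_i)|^2\,(c_{i,l}+c_{i-1,l})\ \le\ B\,\|f\|_2^2,$$ where $$A=\Big(1-\frac{\delta\sigma}{\nu_k}\Big)^{2}\frac{1}{2k\,C(k)}\,\frac{\gamma^{2(k-1)}}{\mu_{2k-1}^{k-1}},\qquad B=2\Big(\sum_{l=0}^{k-1}\frac{(\delta\sigma)^{2l}}{l!^2}\Big)e^{\delta^2+\sigma^2},\qquad C(k)=\Big[\sum_{s=0}^{k-1}\binom{k+s-1}{s}\Big]^2,$$ i.e., $X$ is a stable set of sampling of order $(k-1,k-1)$ for $\mathcal{B}_\sigma$ with respect to the weight $\{c_{i,l}+c_{i-1,l}:l=0,\dots,k-1,\ i\in\mathbb{Z}\}$.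
   Context: The Fourier transform is $\widehat f(w)=\int_{\mathbb{R}} f(x)e^{-2\pi i w x}\,\mathrm{d}x$, extended to $L^2(\mathbb{R})$. For $\sigma>0$, $\mathcal{B}_\sigma=\{f\in L^2(\mathbb{R}):\operatorname{supp}\widehat f\subseteq[-\frac{\sigma}{2\pi},\frac{\sigma}{2\pi}]\}$; its elements are identified with entire functions of exponential type $\le\sigma$ that are square integrable on the real axis. $\mathcal{D}$ is the differentiation operator on $\mathcal{B}_\sigma$, so $\mathcal{D}^{k-1}f=f^{(k-1)}$. The constant $\nu_k>0$ (Wirtinger-Cimmino constant): $\nu_k^2$ is the first (smallest) eigenvalue $\lambda>0$ of the boundary value problem $$u^{(2k)}(x)+\lambda u^{(2k-2)}(x)=0,\ x\in[0,1],\qquad u^{(l)}(0)=u^{(l)}(1)=0,\ 0\le l\le k-1,\qquad u\in C^{2k}[0,1],$$ i.e. the smallest $\lambda>0$ for which a non-zero solution $u$ exists. (For instance $\nu_1=\pi$ and $\nu_2=2\pi$.) Further constants: $$c_{i,l}=\frac{(x_{i+1}-x_i)^{2l+1}}{(2l+1)\,l!^2},\qquad \mu_n=\frac{n(n+1)(n+2)(n+3)}{2}.$$ A set $X=\{x_i:i\in\mathbb{Z}\}$ is a stable set of sampling of order $(m,k-1)$ for $\mathcal{B}_\sigma$ with respect to non-zero real weights $\{w_{il}:l=0,\dots,k-1,\ i\in\mathbb{Z}\}$ if there are constants $A,B>0$ with $A\|f^{(m)}\|_2^2\le\sum_{i\in\mathbb{Z}}\sum_{l=0}^{k-1}w_{il}|f^{(l)}(x_i)|^2\le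 B\|f\|_2^2$ for all $f\in\mathcal{B}_\sigma$. *)

(* Defs.v *)
From HB Require Import structures.
From mathcomp Require Import all_boot all_order all_algebra.
From mathcomp Require Import complex.
From mathcomp Require Import all_classical all_reals all_analysis.

Set Implicit Arguments.
Unset Strict Implicit.
Unset Printing Implicit Defensive.

Import Order.TTheory GRing.Theory Num.Theory.
Import numFieldNormedType.Exports.
Import ComplexField.Normc.

Local Open Scope classical_set_scope.
Local Open Scope ring_scope.

Section FourierTransform.
Context {R : realType}.
Implicit Types (f g : R -> R[i]).

Definition re f : R -> R := fun x => complex.Re (f x).
Definition im f : R -> R := fun x => complex.Im (f x).

Definition cmeasurable f : Prop :=
  measurable_fun [set: R] (re f) /\ measurable_fun [set: R] (im f).

(* [L2normsq f] is the square of the L^2(R)-norm, with values in [0, +oo]. *)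
Definition L2normsq f : \bar R :=
  (\int[lebesgue_measure]_(x in [set: R]) ((normc (f x)) ^+ 2)%:E)%E.

Definition inL1 f : Prop :=
  cmeasurable f /\
  (\int[lebesgue_measure]_(x in [set: R]) (normc (f x))%:E < +oo)%E.

Definition inL2 f : Prop := cmeasurable f /\ (L2normsq f < +oo)%E.

Definition cintegral f : R[i] :=
  Complex (Rintegral lebesgue_measure [set: R] (re f))
          (Rintegral lebesgue_measure [set: R] (im f)).

Definition expi (t : R) : R[i] := Complex (cos t) (sin t).

Definition fourier f : R -> R[i] :=
  fun w => cintegral (fun x => f x * expi (- (2 * pi * w * x))).

(* The Fourier transform on L^2(R) is the continuous extension of its
   restriction to L^1 /\ L^2; [is_fourierL2 f g] is the graph of this extension
   (g is determined by f up to a null set). *)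
Definition is_fourierL2 f g : Prop :=
  [/\ inL2 f, inL2 g &
    exists f_ : nat -> R -> R[i],
      [/\ forall n, inL1 (f_ n) /\ inL2 (f_ n),
          L2normsq (fun x => f_ n x - f x) @[n --> \oo] --> 0%E &
          L2normsq (fun w => fourier (f_ n) w - g w) @[n --> \oo] --> 0%E]].

(* Support of a class of functions modulo null sets: the complement of the
   largest open set on which the function vanishes almost everywhere. *)
Definition ess_supp g : set R :=
  [set w | forall U : set R, open U -> U w ->
     ~ {ae lebesgue_measure, forall y : R, U y -> g y = 0}].

(* An element of the Bernstein space B_sigma is a class of functions modulo
   null sets that contains exactly one continuous function, namely the
   restriction to the real axis of an entire function of exponential type at
   most sigma; continuity selects this representative. *)
Definition bernstein (sigma : R) f : Prop :=
  [/\ continuous (re f), continuous (im f) &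
    exists2 g : R -> R[i], is_fourierL2 f g &
      ess_supp g `<=` `[- (sigma / (2 * pi)), sigma / (2 * pi)]%classic].

Definition cderiv (l : nat) f : R -> R[i] :=
  fun x => Complex (derive1n l (re f) x) (derive1n l (im f) x).

End FourierTransform.

Section WirtingerCimmino.
Context {R : realType}.
Implicit Types u : R -> R.

Definition slope u (x y : R) : R := (u y - u x) / (y - x).

(* Derivative on [0, 1], one-sided at the end points: y tends to x within
   [0, 1], with y != x. *)
Definition derive01 u : R -> R :=
  fun x => lim (slope u x y @[y --> within `[0, 1]%classic x^']).

Definition derivable01 u : Prop :=
  forall x : R, 0 <= x <= 1 ->
    cvg (slope u x y @[y --> within `[0, 1]%classic x^']).

Definition derive01n (n : nat) u : R -> R := iter n derive01 u.

Definition C01 (n : nat) u : Prop :=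
  (forall j, (j < n)%N -> derivable01 (derive01n j u)) /\
  {within `[0, 1]%classic, continuous (derive01n n u)}.

Definition is_eigenvalue (k : nat) (lambda : R) : Prop :=
  exists u : R -> R,
    [/\ C01 (2 * k) u,
        exists2 x : R, 0 <= x <= 1 & u x != 0,
        forall x : R, 0 <= x <= 1 ->
          derive01n (2 * k) u x + lambda * derive01n (2 * k - 2) u x = 0 &
        forall l : nat, (l <= k - 1)%N ->
          derive01n l u 0 = 0 /\ derive01n l u 1 = 0].

Definition is_wirtinger_cimmino (k : nat) (nu : R) : Prop :=
  [/\ 0 < nu, is_eigenvalue k (nu ^+ 2) &
    forall lambda : R, 0 < lambda -> is_eigenvalue k lambda ->
      nu ^+ 2 <= lambda].

End WirtingerCimmino.

Section Sampling.
Context {R : realType}.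
Implicit Types (x : int -> R) (f : R -> R[i]).

Definition weight x (i : int) (l : nat) : R :=
  (x (i + 1) - x i) ^+ (2 * l + 1) / ((2 * l + 1)%:R * (l`!)%:R ^+ 2).

Definition mu (n : nat) : R := (n * (n + 1) * (n + 2) * (n + 3))%:R / 2.

Definition Cbin (k : nat) : R :=
  (\sum_(s < k) ('C(k + s - 1, s))%:R) ^+ 2.

Definition lower_const (k : nat) (sigma gamma delta nu : R) : R :=
  (1 - delta * sigma / nu) ^+ 2 * (1 / (2 * k%:R * Cbin k))
  * (gamma ^+ (2 * (k - 1)) / mu (2 * k - 1) ^+ (k - 1)).

Definition upper_const (k : nat) (sigma delta : R) : R :=
  2 * (\sum_(l < k) (delta * sigma) ^+ (2 * l) / (l`!)%:R ^+ 2)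
  * expR (delta ^+ 2 + sigma ^+ 2).

(* Unconditional sum of a family of real numbers of arbitrary sign ([esum]
   alone only makes sense for nonnegative families). *)
Definition zsum (a : int -> R) : \bar R :=
  (\esum_(i in [set: int]) (Num.max (a i) 0)%:E
   - \esum_(i in [set: int]) (Num.max (- a i) 0)%:E)%E.

Definition sample_term (k : nat) x (w : int -> nat -> R) f (i : int) : R :=
  \sum_(l < k) w i l * normc (cderiv l f (x i)) ^+ 2.

(* Stable set of sampling of order (m, k - 1): for each sample point, the
   derivatives of order l < k are used. *)
Definition stable_sampling (sigma : R) (m k : nat) x (w : int -> nat -> R) :
    Prop :=
  (forall i l, (l < k)%N -> w i l != 0) /\
  exists A B : R, [/\ 0 < A, 0 < B & forall f, bernstein sigma f ->
    (A%:E * L2normsq (cderiv m f) <= zsum (sample_term k x w f))%E /\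
    (zsum (sample_term k x w f) <= B%:E * L2normsq f)%E].

End Sampling.

(* Main.v *)
(* On one interval [a, a + h] subtract from a function its two-point Hermite
   interpolant of order k: the difference vanishes with k derivatives at both
   ends, so the Wirtinger-Cimmino inequality bounds its (k-1)-st derivative by
   the k-th one, while the k-th derivatives of the difference and of the
   interpolant are orthogonal.  Summing over the intervals and applying
   Bernstein's inequality ||f^(k)|| <= sigma ||f^(k-1)|| absorbs the derivative
   term because delta sigma < nu.  The upper bound compares h |f^(l)|^2 at an end
   point with the integrals of |f^(l)|^2 and |f^(l+1)|^2 over the interval.

   The Wirtinger-Cimmino inequality itself follows from the definition of nu as
   first eigenvalue: if the best constant were smaller than nu^2, it would not
   be an eigenvalue, the boundary value problem would have a bounded resolvent
   there, and the constant could be improved.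

   A continuous f with band-limited Plancherel transform is recovered pointwise
   as the inverse transform of that transform by testing against Fejer kernels.
   Bessel's inequality then bounds ||f^(j)||^2 by C sigma^(2j), and log-convexity
   of these norms upgrades the bound to Bernstein's inequality. *)
Require Import Defs.
From HB Require Import structures.
From mathcomp Require Import all_boot all_order all_algebra.
From mathcomp Require Import complex.
From mathcomp Require Import all_classical all_reals all_analysis.
From mathcomp Require Import measurable_realfun.
From mathcomp Require Import zify ring lra.

Set Implicit Arguments.
Unset Strict Implicit.
Unset Printing Implicit Defensive.

Import Order.TTheory GRing.Theory Num.Theory.
Import numFieldNormedType.Exports.
Import ComplexField.Normc.

Local Open Scope classical_set_scope.
Local Open Scope ring_scope.

(** * Calculus of smooth functions *)

(** Functions are real and come with all their derivatives ([tower]), and integrals over intervals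
    are increments of antiderivatives ([cint]), so that integration by parts, scaling and
    telescoping over the sample intervals are algebra. Complex f is split into real and imaginary
    parts, over which both sides of the inequalities are additive. Differentiability of f is an
    outcome of the pointwise reconstruction.

    The first eigenvalue is handled without compactness: no minimizer of the Rayleigh quotient is
    built, only inequalities over smooth clamped functions are compared.

    Origin of the constants: with th = delta sigma / nu, the splitting u^2 <= (u - H)^2 / th + H^2 /
    (1 - th) leads to N <= th N + K S / (1 - th) for N = ||f^(k-1)||^2 and S the sampling sum, hence
    the factor (1 - th)^2. The factor 2k counts the Hermite basis polynomials, C(k) is the squared
    value at 1 of the truncated series of (1 - X)^(-k) inside them, and mu absorbs the cost of
    differentiating them k - 1 times. In the upper bound, 2 counts the two ends of an interval and
    the exponential dominates 1 + 2 delta sigma. *)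

Section Antiderivatives.
Context {R : realType}.
Implicit Types (f g q F G : R -> R) (a b c x : R).

Definition has_derive F f : Prop := forall x : R, is_derive x 1 F (f x).

Lemma has_derive_eq F f G g :
  F =1 G -> f =1 g -> has_derive F f -> has_derive G g.
Proof. by move=> /funext -> /funext ->. Qed.

Lemma has_derive_cst c : has_derive (fun=> c) (fun=> 0).
Proof. by move=> x; exact: is_derive_cst. Qed.

Lemma has_derive_id : has_derive (fun x => x) (fun=> 1).
Proof. by move=> x; exact: is_derive_id. Qed.

Lemma has_deriveD F f G g : has_derive F f -> has_derive G g ->
  has_derive (fun x => F x + G x) (fun x => f x + g x).
Proof. by move=> dF dG x; exact: (@is_deriveD _ _ _ F G x 1 (f x) (g x)). Qed.

Lemma has_deriveN F f : has_derive F f ->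
  has_derive (fun x => - F x) (fun x => - f x).
Proof. by move=> dF x; exact: (@is_deriveN _ _ _ F x 1 (f x)). Qed.

Lemma has_deriveB F f G g : has_derive F f -> has_derive G g ->
  has_derive (fun x => F x - G x) (fun x => f x - g x).
Proof. by move=> dF dG; apply: has_deriveD => //; exact: has_deriveN. Qed.

Lemma has_deriveM F f G g : has_derive F f -> has_derive G g ->
  has_derive (fun x => F x * G x) (fun x => f x * G x + F x * g x).
Proof.
move=> dF dG x; rewrite addrC [f x * _]mulrC.
exact: (@is_deriveM _ _ F G x 1 (f x) (g x)).
Qed.

Lemma has_deriveZ c F f : has_derive F f ->
  has_derive (fun x => c * F x) (fun x => c * f x).
Proof. by move=> dF x; exact: (@is_deriveZ _ _ _ F c x 1 (f x)). Qed.

Lemma has_derive_comp F f G g : has_derive F f -> has_derive G g ->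
  has_derive (fun x => F (G x)) (fun x => f (G x) * g x).
Proof. by move=> dF dG x; exact: is_derive1_comp. Qed.

Lemma has_derive_sin : has_derive sin cos.
Proof. by move=> x; exact: is_derive_sin. Qed.

Lemma has_derive_cos : has_derive cos (fun x => - sin x).
Proof. by move=> x; exact: is_derive_cos. Qed.

Lemma has_derive_sum n (F f : 'I_n -> R -> R) :
  (forall i, has_derive (F i) (f i)) ->
  has_derive (fun x => \sum_i F i x) (fun x => \sum_i f i x).
Proof.
move=> dF x; have := @is_derive_sum _ _ _ n F x 1 (f ^~ x) (fun i => dF i x).
by rewrite (_ : (\sum_i F i) = (fun x => \sum_i F i x))//; apply/funext=> y; rewrite fct_sumE.
Qed.

Lemma has_derive_affine c a F f : has_derive F f ->
  has_derive (fun x => F (a + c * x)) (fun x => c * f (a + c * x)).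
Proof.
move=> dF; have := has_derive_comp dF
  (has_deriveD (has_derive_cst a) (has_deriveZ c has_derive_id)).
by apply: has_derive_eq => // x; rewrite mulr1 add0r mulrC.
Qed.

Lemma has_derive_sqr F f : has_derive F f ->
  has_derive (fun x => F x ^+ 2) (fun x => 2 * (F x * f x)).
Proof.
move=> dF; have := has_deriveM dF dF.
by apply: has_derive_eq => x; rewrite ?expr2//; ring.
Qed.

Lemma has_derive_derive1 F f : has_derive F f -> derive1 F = f.
Proof. by move=> dF; apply/funext => x; rewrite derive1E; exact: derive_val. Qed.

Lemma has_derive_derivable F f x : has_derive F f -> derivable F x 1.
Proof. by move=> dF; exact: ex_derive. Qed.

Lemma has_derive_continuous F f : has_derive F f -> continuous F.
Proof.
move=> dF x.
exact/differentiable_continuous/derivable1_diffP/has_derive_derivable/dF.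
Qed.

Lemma has_derive_ger0 F f a b : has_derive F f -> a <= b ->
  (forall x, a <= x <= b -> 0 <= f x) -> F a <= F b.
Proof.
move=> dF ab f0.
have [c] := MVT_segment ab (fun x _ => dF x)
  (continuous_subspaceT (has_derive_continuous dF)).
rewrite in_itv /= => cab /eqP; rewrite subr_eq => /eqP ->.
by rewrite lerDr mulr_ge0 ?f0 ?subr_ge0.
Qed.

Lemma has_derive_uniq F G f a b : has_derive F f -> has_derive G f ->
  F b - F a = G b - G a.
Proof.
move=> dF dG; suff : F b - G b = F a - G a by lra.
apply: (is_derive_0_is_cst (f := fun x => F x - G x)) => x.
by have := has_deriveB dF dG x; rewrite subrr.
Qed.

Let P a q x : R := (\int[lebesgue_measure]_(t in `[a, x]) q t)%R.

Let P_derive a q : continuous q ->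
  forall x, a < x -> is_derive x 1 (P a q) (q x).
Proof.
move=> cq x ax.
have xx1 : x < x + 1 by rewrite ltrDl.
have iq : lebesgue_measure.-integrable `[a, x + 1] (EFin \o q).
  apply: continuous_compact_integrable; first exact: segment_compact.
  exact: continuous_subspaceT.
have [dP PE] := continuous_FTC1_closed xx1 iq ax (cq x).
by rewrite -PE derive1E; exact: derivableP.
Qed.

(** The integral from a fixed base point is differentiated only to the right of that point, so the
    base point -(1 + |x|) moves with x. Subtracting the value at 0 makes [G a x] independent of a
    ([Gind]), hence near each x the function coincides with one of fixed base. *)
Lemma continuous_has_antiderivative q : continuous q ->
  exists F, has_derive F q.
Proof.
move=> cq.
have gt0 : forall x, (- (1 + `|x|) < x) /\ (- (1 + `|x|) < 0).
  move=> x; have x0 := normr_ge0 x.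
  by split; last lra; have := ler_norm (- x); rewrite normrN; lra.
pose G (a x : R) : R := P a q x - P a q 0.
have Gind (a b x : R) : a < x -> b < x -> a < 0 -> b < 0 -> G a x = G b x.
  move=> ax bx a0 b0; pose m := Num.max a b.
  wlog : a b ax bx a0 b0 m / a <= b.
    move=> H; have [|/ltW] := leP a b; first exact: H.
    by move=> ba; apply/esym; exact: H.
  move=> ab; rewrite /G.
  have H y z : b < y -> y <= z -> P a q z - P b q z = P a q y - P b q y.
    move=> bly yz.
    have d (w : R) : w \in `]y, z[%R ->
        is_derive w 1 (fun x => P a q x - P b q x) (0 : R).
      rewrite in_itv/= => /andP[yw _].
      have bw : b < w by exact: lt_trans yw.
      have H1 := P_derive cq (le_lt_trans ab bw).
      have H2 := P_derive cq bw.
      by rewrite -(subrr (q w)); exact: is_deriveB.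
    have c : {within `[y, z], continuous (fun x => P a q x - P b q x)}.
      apply: derivable_within_continuous => w; rewrite in_itv/= => /andP[yw _].
      have bw : b < w by exact: lt_le_trans yw.
      have H1 := P_derive cq (le_lt_trans ab bw).
      have H2 := P_derive cq bw.
      exact: ex_derive.
    have [w _ /eqP] := MVT_segment yz d c.
    by rewrite mul0r subr_eq0 => /eqP.
  have [x0|x0] := leP x 0.
    by have := H x 0 bx x0; lra.
  by have := H 0 x b0 (ltW x0); lra.
exists (fun x => G (- (1 + `|x|)) x) => x.
have [x1 x2] := gt0 x.
pose a := - (2 + `|x|) : R.
have ax : a < x by apply: le_lt_trans x1; rewrite /a; lra.
apply: (@near_eq_is_derive _ _ _ (G a)) => //.
  near=> y.
  have [y1 y2] := gt0 y.
  apply: Gind => //; last by rewrite /a; have := normr_ge0 x; lra.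
  by near: y; exact: lt_nbhsr.
rewrite /G -[X in is_derive _ _ _ X]subr0; have := P_derive cq ax => H1.
exact: is_deriveB.
Unshelve. all: by end_near. Qed.

End Antiderivatives.

Section ContinuousArithmetic.
Context {R : realType}.
Implicit Types f g : R -> R.

Lemma contD f g : continuous f -> continuous g ->
  continuous (fun x => f x + g x).
Proof. by move=> cf cg x; apply: continuousD; [exact: cf|exact: cg]. Qed.

Lemma contB f g : continuous f -> continuous g ->
  continuous (fun x => f x - g x).
Proof. by move=> cf cg x; apply: continuousB; [exact: cf|exact: cg]. Qed.

Lemma contM f g : continuous f -> continuous g ->
  continuous (fun x => f x * g x).
Proof. by move=> cf cg x; apply: continuousM; [exact: cf|exact: cg]. Qed.

Lemma cont_cst (c : R) : continuous (fun _ : R => c).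
Proof. by move=> x; exact: (@cst_continuous R R). Qed.

Lemma contZ c f : continuous f -> continuous (fun x => c * f x).
Proof. by move=> cf; exact: contM (@cont_cst c) cf. Qed.

Lemma cont_sqr f : continuous f -> continuous (fun x => f x ^+ 2).
Proof.
move=> cf; rewrite (_ : (fun _ => _) = (fun x => f x * f x)); first exact: contM.
by apply/funext => x; rewrite expr2.
Qed.

Lemma cont_affine (c a : R) f : continuous f -> continuous (fun x => f (a + c * x)).
Proof.
move=> cf; have cG := has_derive_continuous (has_derive_affine c a (@has_derive_id R)).
by move=> x; apply: (continuous_comp (cG x)); exact: cf.
Qed.

End ContinuousArithmetic.
Arguments contZ {R} c {f}.
Arguments has_deriveZ {R} c {F f}.

(** * Integrals of continuous functions through antiderivatives *)

Section IntegralOfContinuous.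
Context {R : realType}.
Implicit Types (f g q F G : R -> R) (a b c x : R).

(* The integral of a continuous function over [a, b] (of either orientation)
   as the increment of an antiderivative; [cint_lebesgue] identifies it with the
   Lebesgue integral. *)
Definition cint q a b : R :=
  let F := xget (fun=> 0) [set F | has_derive F q] in F b - F a.

Lemma cintE F q a b : has_derive F q -> cint q a b = F b - F a.
Proof.
move=> dF; rewrite /cint.
apply: (has_derive_uniq _ _ _ dF); exact: (@xgetPex _ (fun=> 0) [set F | has_derive F q] (ex_intro _ F dF)).
Qed.

Lemma cint_derive a q : continuous q -> has_derive (cint q a) q.
Proof.
move=> /continuous_has_antiderivative[F dF].
have := has_deriveB dF (has_derive_cst (F a)).
by apply: has_derive_eq => x; rewrite ?subr0// (cintE _ _ dF).
Qed.

Lemma cintxx q a : cint q a a = 0.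
Proof. by rewrite /cint subrr. Qed.

Lemma cint_cat q a b c : cint q a b + cint q b c = cint q a c.
Proof. by rewrite /cint /=; ring. Qed.

Lemma cintD f g a b : continuous f -> continuous g ->
  cint (fun x => f x + g x) a b = cint f a b + cint g a b.
Proof.
move=> /continuous_has_antiderivative[F dF] /continuous_has_antiderivative[G dG].
by rewrite (cintE _ _ (has_deriveD dF dG)) (cintE _ _ dF) (cintE _ _ dG); ring.
Qed.

Lemma cintB f g a b : continuous f -> continuous g ->
  cint (fun x => f x - g x) a b = cint f a b - cint g a b.
Proof.
move=> /continuous_has_antiderivative[F dF] /continuous_has_antiderivative[G dG].
by rewrite (cintE _ _ (has_deriveB dF dG)) (cintE _ _ dF) (cintE _ _ dG); ring.
Qed.

Lemma cintZ c f a b : continuous f ->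
  cint (fun x => c * f x) a b = c * cint f a b.
Proof.
move=> /continuous_has_antiderivative[F dF].
by rewrite (cintE _ _ (has_deriveZ c dF)) (cintE _ _ dF); ring.
Qed.

Lemma cint_cst c a b : cint (fun=> c) a b = c * (b - a).
Proof.
have := has_deriveZ c (@has_derive_id R).
by rewrite mulr1 => /(cintE a b) ->; rewrite mulrBr.
Qed.

Lemma cint_ge0 q a b : continuous q -> a <= b ->
  (forall x, a <= x <= b -> 0 <= q x) -> 0 <= cint q a b.
Proof.
move=> /continuous_has_antiderivative[F dF] ab q0.
by rewrite (cintE _ _ dF) subr_ge0; exact: has_derive_ger0 q0.
Qed.

Lemma le_cint f g a b : continuous f -> continuous g -> a <= b ->
  (forall x, a <= x <= b -> f x <= g x) -> cint f a b <= cint g a b.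
Proof.
move=> cf cg ab fg; rewrite -subr_ge0 -cintB//.
by apply: cint_ge0 => //; [exact: contB|move=> x /fg; rewrite subr_ge0].
Qed.

Lemma cint_parts F f G g a b : has_derive F f -> has_derive G g ->
  continuous f -> continuous g ->
  cint (fun x => f x * G x) a b =
  F b * G b - F a * G a - cint (fun x => F x * g x) a b.
Proof.
move=> dF dG cf cg; rewrite -(cintE a b (has_deriveM dF dG)) cintD.
- by rewrite addrK.
- by apply: contM => //; exact: has_derive_continuous dG.
- by apply: contM => //; exact: has_derive_continuous dF.
Qed.

Lemma cint_affine q a h : continuous q ->
  h * cint (fun x => q (a + h * x)) 0 1 = cint q a (a + h).
Proof.
move=> cq; have [F dF] := continuous_has_antiderivative cq.
have d := has_derive_affine h a dF.
rewrite -cintZ; last exact: cont_affine.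
by rewrite (cintE _ _ d) (cintE _ _ dF) mulr0 mulr1 addr0.
Qed.

Lemma cint_lebesgue q a b : continuous q -> a <= b ->
  (\int[lebesgue_measure]_(x in `[a, b]) (q x)%:E = (cint q a b)%:E)%E.
Proof.
move=> cq; rewrite le_eqVlt => /predU1P[<-|ab].
  by rewrite set_itv1 integral_set1 cintxx.
have [F dF] := continuous_has_antiderivative cq.
have cF := has_derive_continuous dF.
rewrite (cintE _ _ dF) EFinB; apply: continuous_FTC2 => //.
- exact: continuous_subspaceT.
- split; first by move=> x _; exact: has_derive_derivable dF.
  + by apply: cvg_at_right_filter; exact: cF.
  + by apply: cvg_at_left_filter; exact: cF.
- by move=> x _; rewrite (has_derive_derive1 dF).
Qed.

End IntegralOfContinuous.

(** * Smooth functions with all their derivatives *)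

Section Towers.
Context {R : realType}.
Implicit Types (U V : nat -> R -> R) (p : {poly R}).

(* A smooth function [U 0] bundled with all its derivatives [U j]. *)
Definition tower U : Prop := forall j, has_derive (U j) (U j.+1).

Lemma tower_continuous U j : tower U -> continuous (U j).
Proof. by move=> tU; exact: has_derive_continuous (tU j). Qed.

Lemma tower_shift U i : tower U -> tower (fun j => U (i + j)%N).
Proof. by move=> tU j; rewrite addnS; exact: tU. Qed.

Lemma towerD U V : tower U -> tower V -> tower (fun j x => U j x + V j x).
Proof. by move=> tU tV j; exact: has_deriveD. Qed.

Lemma towerB U V : tower U -> tower V -> tower (fun j x => U j x - V j x).
Proof. by move=> tU tV j; exact: has_deriveB. Qed.

Lemma towerZ c U : tower U -> tower (fun j x => c * U j x).
Proof. by move=> tU j; exact: has_deriveZ. Qed.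

Lemma tower_sum n (U : 'I_n -> nat -> R -> R) :
  (forall i, tower (U i)) -> tower (fun j x => \sum_i U i j x).
Proof. by move=> tU j; apply: has_derive_sum => i; exact: tU. Qed.

Lemma tower_affine c a U : tower U ->
  tower (fun j x => c ^+ j * U j (a + c * x)).
Proof.
move=> tU j; have := has_deriveZ (c ^+ j) (has_derive_affine c a (tU j)).
by apply: has_derive_eq => // x; rewrite exprSr mulrA.
Qed.

Lemma tower_poly p : tower (fun j x => (p^`(j)).[x]).
Proof. by move=> j x; rewrite derivnS; exact: is_derive_poly. Qed.

Lemma tower_derive1n U j : tower U -> derive1n j (U 0%N) = U j.
Proof.
move=> tU; elim: j => [|j IH]; first by rewrite derive1n0.
by rewrite derive1nS IH; exact: has_derive_derive1.
Qed.

(* Integrating by parts m times moves all derivatives onto P, where they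
   vanish. *)
Lemma tower_orthogonal m P W a b : tower P -> tower W ->
  (forall x, P m x = 0) ->
  (forall l, (l < m)%N -> W l a = 0 /\ W l b = 0) ->
  cint (fun x => P 0%N x * W m x) a b = 0.
Proof.
move=> tP tW Pm Wab.
suff H j : (j <= m)%N ->
    cint (fun x => P (m - j)%N x * W j x) a b = 0.
  by have := H m (leqnn m); rewrite subnn.
elim: j => [_|j IH jm].
  rewrite subn0 (_ : (fun _ => _) = (fun=> 0)).
    by rewrite cint_cst mul0r.
  by apply/funext => x; rewrite Pm mul0r.
have [Wa Wb] := Wab j jm.
have cP i := @tower_continuous _ i tP; have cW i := @tower_continuous _ i tW.
rewrite (_ : (fun _ => _) = (fun x => W j.+1 x * P (m - j.+1)%N x)); last first.
  by apply/funext => x; rewrite mulrC.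
rewrite (cint_parts _ _ (tW j) (tP _))// Wa Wb !mul0r subr0 sub0r -subSn//.
rewrite subSS (_ : (fun _ => _) = (fun x => P (m - j)%N x * W j x)).
  by rewrite (IH (ltnW jm)) oppr0.
by apply/funext => x; rewrite mulrC.
Qed.

End Towers.
Arguments tower_continuous {R U} j.
(* Unification must not unfold the chosen antiderivative. *)
#[global] Opaque cint.

(** * The Wirtinger-Cimmino inequality *)

Section Derive01.
Context {R : realType}.
Implicit Types (u F f : R -> R) (x : R).

(** Uniqueness of the limits defining [derive01] rests on this: punctured balls around x meet [0, 1]
    to the right of x if x <= 1/2, to the left otherwise. *)
Lemma within01_proper x : 0 <= x <= 1 ->
  ProperFilter (within `[0, 1]%classic x^').
Proof.
move=> /andP[x0 x1]; apply: Build_ProperFilter.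
rewrite /within /= => -[e /= e0 He].
have [x12|x12] := leP x (1 / 2).
  pose y := x + Num.min (e / 2) (1 / 2).
  have m0 : 0 < Num.min (e / 2) (1 / 2) by rewrite lt_min; apply/andP; split; lra.
  have m1 : Num.min (e / 2) (1 / 2) <= 1 / 2 by rewrite ge_min lexx orbT.
  have m2 : Num.min (e / 2) (1 / 2) <= e / 2 by rewrite ge_min lexx.
  have := He y; apply.
  - by rewrite /ball_ /= /y opprD addrA subrr add0r normrN gtr0_norm//; lra.
  - by rewrite gt_eqF// /y ltrDl.
  - by rewrite /= in_itv/= /y; lra.
pose y := x - Num.min (e / 2) (1 / 2).
have m0 : 0 < Num.min (e / 2) (1 / 2) by rewrite lt_min; apply/andP; split; lra.
have m1 : Num.min (e / 2) (1 / 2) <= 1 / 2 by rewrite ge_min lexx orbT.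
have m2 : Num.min (e / 2) (1 / 2) <= e / 2 by rewrite ge_min lexx.
have := He y; apply.
- by rewrite /ball_ /= /y opprB addrCA subrr addr0 gtr0_norm//; lra.
- by rewrite lt_eqF// /y ltrBlDr ltrDl.
- by rewrite /= in_itv/= /y; lra.
Qed.

Lemma slope_cvg u F f x : has_derive F f -> 0 <= x <= 1 ->
  (forall y, 0 <= y <= 1 -> u y = F y) ->
  slope u x y @[y --> within `[0, 1]%classic x^'] --> f x.
Proof.
move=> dF x01 uF; have [g [Fg cg gx]] := (is_derive1_caratheodory _ _ _).1 (dF x).
have gc : g y @[y --> within `[0, 1]%classic x^'] --> f x.
  rewrite -gx; apply: cvg_trans cg; apply: cvg_app; apply: cvg_trans.
    exact: cvg_within.
  exact: nbhs_dnbhs.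
apply: cvg_trans gc; apply: near_eq_cvg.
have : within `[0, 1]%classic x^' [set y | y != x /\ 0 <= y <= 1].
  rewrite /within /=; near=> y => /=.
  rewrite in_itv/= => ->; split=> //.
  by near: y; exact: nbhs_dnbhs_neq.
apply: filterS => y [yx y01].
by rewrite /slope !uF// Fg mulfK// subr_eq0.
Unshelve. all: by end_near. Qed.

(** Agreement on [0, 1] is the right hypothesis for the induction, since each step yields equality
    there only. *)
Lemma derive01n_tower (U : nat -> R -> R) u j : tower U ->
  (forall y, 0 <= y <= 1 -> u y = U 0%N y) ->
  forall x, 0 <= x <= 1 -> derive01n j u x = U j x.
Proof.
move=> tU uU; elim: j => [//|j IH] x x01.
have xp := within01_proper x01.
rewrite /derive01n iterS -/(derive01n j u) /derive01.
by apply/cvg_lim => //; exact: slope_cvg (tU j) x01 IH.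
Qed.

Lemma tower_C01 (U : nat -> R -> R) n : tower U -> C01 n (U 0%N).
Proof.
move=> tU; split=> [j _ x x01|].
  apply/cvg_ex; exists (U j.+1 x); apply: slope_cvg (tU j) x01 _.
  by move=> y; exact: derive01n_tower.
have cU : {within `[0, 1], continuous (U n)}.
  exact/continuous_subspaceT/tower_continuous.
apply: (subspace_eq_continuous _ cU) => x; rewrite inE/= in_itv/= => x01.
by apply/esym; exact: derive01n_tower.
Qed.

(** A nonzero derivative of any order at 0 certifies that the solution is nontrivial, because a
    function vanishing on [0, 1] has all its one-sided derivatives zero there. *)
Lemma tower_eigenvalue (k : nat) (lam : R) (U : nat -> R -> R) j :
  tower U -> (forall x, U (2 * k)%N x + lam * U (2 * k - 2)%N x = 0) ->
  (forall l, (l < k)%N -> U l 0 = 0 /\ U l 1 = 0) ->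
  (0 < k)%N -> U j 0 != 0 -> is_eigenvalue k lam.
Proof.
move=> tU eqU bU k0 Uj; have dU := fun n => @derive01n_tower U (U 0%N) n tU (fun _ _ => erefl).
have h0 : 0 <= (0 : R) <= 1 by lra.
have h1 : 0 <= (1 : R) <= 1 by lra.
exists (U 0%N); split.
- exact: tower_C01.
- apply: contrapT => H.
  have U0 y : 0 <= y <= 1 -> U 0%N y = (fun n : nat => fun=> 0 : R) 0%N y.
    by move=> y01; apply: contrapT => /eqP Uy; apply: H; exists y.
  have t0 : tower (fun n : nat => fun=> 0 : R) by move=> i; exact: has_derive_cst.
  by move: Uj; rewrite -(dU j)// (derive01n_tower j t0 U0)// eqxx.
- by move=> x x01; rewrite !dU.
- by move=> l lk; rewrite !dU//; apply: bU; rewrite -(prednK k0) ltnS -subn1.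
Qed.

End Derive01.

(** * The equation z'' + m^2 z + u = 0 and its derivatives *)

Section Oscillator.
Context {R : realType}.
Implicit Types (U Z W : nat -> R -> R) (m c : R).

(** Only z0 and z1 are explicit; the later derivatives are read off the equation, so that two
    differentiations suffice for a whole tower. *)
Fixpoint osc_seq m U (z0 z1 : R -> R) (j : nat) : R -> R :=
  match j with
  | 0%N => z0
  | 1%N => z1
  | (j'.+1 as i).+1 => fun x => - (m ^+ 2 * osc_seq m U z0 z1 j' x) - U j' x
  end.

(* Variation of constants. *)
Lemma oscillator_tower m c U : 0 < m -> tower U -> exists Z,
  [/\ tower Z, Z 0%N 0 = 0, Z 1%N 0 = c &
      forall j x, Z j.+2 x + m ^+ 2 * Z j x + U j x = 0].
Proof.
move=> m0 tU; have mn0 : m != 0 by rewrite gt_eqF.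
have U0 := tower_continuous 0 tU.
have dsin : has_derive (fun x => sin (m * x)) (fun x => m * cos (m * x)).
  have := has_derive_affine m 0 (@has_derive_sin R).
  by apply: has_derive_eq => x; rewrite add0r.
have dcos : has_derive (fun x => cos (m * x)) (fun x => - m * sin (m * x)).
  have := has_derive_affine m 0 (@has_derive_cos R).
  by apply: has_derive_eq => x; rewrite add0r ?mulrN ?mulNr.
have [cs cc] := (has_derive_continuous dsin, has_derive_continuous dcos).
pose C := cint (fun x => cos (m * x) * U 0%N x) 0.
pose S := cint (fun x => sin (m * x) * U 0%N x) 0.
have dC : has_derive C (fun x => cos (m * x) * U 0%N x).
  by apply: cint_derive; exact: contM.
have dS : has_derive S (fun x => sin (m * x) * U 0%N x).
  by apply: cint_derive; exact: contM.
(* This is (c sin(m x) - int_0^x sin(m (x - t)) u(t) dt) / m with the sine of the difference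
   expanded and u = [U 0]; [z1] is its derivative. *)
pose z0 x := m^-1 * (c * sin (m * x) - (sin (m * x) * C x - cos (m * x) * S x)).
pose z1 x := c * cos (m * x) - (cos (m * x) * C x + sin (m * x) * S x).
have d0 : has_derive z0 z1.
  have := has_deriveZ m^-1 (has_deriveB (has_deriveZ c dsin)
    (has_deriveB (has_deriveM dsin dC) (has_deriveM dcos dS))).
  by apply: has_derive_eq => // x; rewrite /z1; field.
have d1 : has_derive z1 (osc_seq m U z0 z1 2).
  have := has_deriveB (has_deriveZ c dcos)
    (has_deriveD (has_deriveM dcos dC) (has_deriveM dsin dS)).
  apply: has_derive_eq => // x; rewrite /= /z0.
  have := cos2Dsin2 (m * x); set cx := cos _; set sx := sin _ => E.
  by rewrite -[X in _ = _ - X]mul1r -E; field.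
have C0 : C 0 = 0 by exact: cintxx.
have S0 : S 0 = 0 by exact: cintxx.
exists (osc_seq m U z0 z1); split.
- move=> j; suff [] : has_derive (osc_seq m U z0 z1 j) (osc_seq m U z0 z1 j.+1) /\
    has_derive (osc_seq m U z0 z1 j.+1) (osc_seq m U z0 z1 j.+2) by [].
  elim: j => [|j [IH1 IH2]]; first by split; [exact: d0|exact: d1].
  split; first exact: IH2.
  exact: has_deriveB (has_deriveN (has_deriveZ _ IH1)) (tU j).
- by rewrite /= /z0 mulr0 sin0 C0 S0; ring.
- by rewrite /= /z1 mulr0 cos0 sin0 C0 S0; ring.
- by move=> j x /=; ring.
Qed.

(** The fundamental solution of D^n (D^2 + m^2). For n > 0 it solves E'' + m^2 E = x^(n-1) / (n-1)!
    with zero data, and the monomial, whose only nonzero derivative at 0 has order n - 1, produces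
    E^(n+1)(0) = 1. For n = 2k - 2 this is the operator of the eigenvalue problem. *)
Lemma fundamental_tower m n : 0 < m -> exists E,
  [/\ tower E, forall j, (j <= n)%N -> E j 0 = 0, E n.+1 0 = 1 &
      forall j x, (n <= j)%N -> E j.+2 x + m ^+ 2 * E j x = 0].
Proof.
move=> m0.
have [n0|n1 ] := posnP n.
  have t0 : tower (fun n : nat => fun=> 0 : R) by move=> i; exact: has_derive_cst.
  have [Z [tZ Z0 Z1 ZE]] := oscillator_tower 1 m0 t0.
  exists Z; rewrite n0; split=> //; first by case.
  by move=> j x _; rewrite -[RHS](ZE j x) addr0.
pose p : {poly R} := - (n.-1`!%:R^-1 *: 'X^(n.-1)).
have pj j : (p^`(j)).[0] = - (j == n.-1)%:R.
  rewrite /p derivnN hornerN derivnZ hornerZ derivnXn; congr (- _).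
  have [->|jn] := eqVneq j n.-1.
    by rewrite ffactnn subnn expr0 hornerMn hornerC mulVf// pnatr_eq0 -lt0n fact_gt0.
  rewrite hornerMn hornerXn; have [jlt|nlt] := ltnP j n.-1.
    by rewrite expr0n subn_eq0 leqNgt jlt mul0rn mulr0.
  rewrite ffact_small ?mulr0n ?mulr0//.
  by rewrite ltn_neqAle eq_sym jn.
have pn j x : (n <= j)%N -> (p^`(j)).[x] = 0.
  move=> nj; rewrite /p derivnN hornerN derivnZ hornerZ derivnXn.
  by rewrite ffact_small ?mulr0n ?horner0 ?mulr0 ?oppr0// (leq_trans _ nj)// ltn_predL.
have [Z [tZ Z0 Z1 ZE]] := oscillator_tower 0 m0 (tower_poly p).
have Zj j : Z j.+2 0 = (j == n.-1)%:R - m ^+ 2 * Z j 0.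
  by have := ZE j 0; rewrite /= pj; set a := _%:R; lra.
have Zl j : (j <= n)%N -> Z j 0 = 0.
  suff : ((j <= n)%N -> Z j 0 = 0) /\ ((j < n)%N -> Z j.+1 0 = 0) by case.
  elim: j => [//|j [IH1 IH2]]; split=> // jn.
  rewrite Zj IH1 ?mulr0; last by rewrite ltnW// ltnW.
  by rewrite subr0 ltn_eqF// -ltnS prednK.
exists Z; split=> //.
- by case: n n1 Zl Zj {p pj pn ZE} => // n _ Zl Zj; rewrite Zj Zl ?mulr0 ?eqxx ?subr0// ltnW.
- by move=> j x nj; have := ZE j x; rewrite /= pn// addr0.
Qed.

End Oscillator.

Lemma sqr_sum_le (R : realType) n (a : 'I_n -> R) :
  (\sum_i a i) ^+ 2 <= n%:R * \sum_i a i ^+ 2.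
Proof.
elim: n a => [|n IH] a; first by rewrite !big_ord0 expr0n mul0r.
rewrite !big_ord_recr /=; have := IH (fun i => a (widen_ord (leqnSn n) i)).
set S := \sum_(i < n) _; set Q := \sum_(i < n) _; set b := a _ => SQ.
have [n0|n0] := posnP n.
  have S0 : S = 0 by rewrite /S; move: (n0) => n0'; rewrite big1// => -[i Hi] _; exfalso; rewrite n0' in Hi.
  have Q0 : 0 <= Q by apply: sumr_ge0 => i _; exact: sqr_ge0.
  by rewrite S0 add0r n0 mul1r lerDr.
have np : 0 < n%:R :> R by rewrite ltr0n.
have : 0 <= n%:R^-1 * (S - n%:R * b) ^+ 2.
  by rewrite mulr_ge0 ?invr_ge0 ?sqr_ge0// ltW.
have -> : n%:R^-1 * (S - n%:R * b) ^+ 2 =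
    n%:R^-1 * S ^+ 2 - 2 * S * b + n%:R * b ^+ 2 by field; rewrite gt_eqF.
have : n%:R^-1 * S ^+ 2 <= Q by rewrite ler_pdivrMl.
rewrite mulrDr -[n.+1%:R]natr1 !mulrDl; lra.
Qed.

(** * Solving the clamped problem away from eigenvalues *)

Section Resolvent.
Context {R : realType}.
Implicit Types (U Z Y P : nat -> R -> R) (m lam : R).

Definition clamped k U : Prop :=
  tower U /\ forall l, (l < k)%N -> U l 0 = 0 /\ U l 1 = 0.

Lemma clampedB k c U V : clamped k U -> clamped k V ->
  clamped k (fun j x => U j x - c * V j x).
Proof.
move=> [tU bU] [tV bV]; split; first by apply: towerB => //; exact: towerZ.
by move=> l lk; have [-> ->] := bU l lk; have [-> ->] := bV l lk; rewrite mulr0 subrr.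
Qed.

Lemma cint01_sqr_ge0 (f : R -> R) : continuous f ->
  0 <= cint (fun x => f x ^+ 2) 0 1.
Proof.
by move=> cf; apply: cint_ge0 => // [|x _]; [exact: cont_sqr|exact: sqr_ge0].
Qed.

(** Mean value theorem on [0, x] with x <= 1: a bound on a derivative passes unchanged to the
    function, which vanishes at 0. *)
Lemma tower_bound_down Z n K : tower Z -> (forall l, (l <= n)%N -> Z l 0 = 0) ->
  (forall x, 0 <= x <= 1 -> Z n x ^+ 2 <= K) ->
  forall l x, (l <= n)%N -> 0 <= x <= 1 -> Z l x ^+ 2 <= K.
Proof.
move=> tZ Z0 ZK l x ln; rewrite -(subKn ln).
elim: (n - l)%N (leq_subr l n) x => [|i IH] iln x x01; first by rewrite subn0; exact: ZK.
have /andP[x0 x1] := x01.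
have [c] := MVT_segment x0 (fun y _ => tZ (n - i.+1)%N y)
  (continuous_subspaceT (tower_continuous (n - i.+1) tZ)).
rewrite in_itv/= => /andP[c0 cx]; rewrite Z0 ?leq_subr// !subr0 => ->.
rewrite subnSK//; have := IH (ltnW iln) c; rewrite c0 (le_trans cx x1) => /(_ isT).
apply: le_trans; rewrite exprMn ler_piMr ?sqr_ge0// expr_le1//.
Qed.

(** Gronwall's argument for the energy En = Z_(n+1)^2 + m^2 Z_n^2, whose derivative is - 2 Z_(n+1)
    U_n: on x >= 0 the derivative of int_0^x U_n^2 - e^(-x) En(x) is a sum of squares with
    nonnegative coefficients. *)
Lemma oscillator_energy m n U Z : 0 < m -> tower U -> tower Z ->
  (forall l, (l <= n.+1)%N -> Z l 0 = 0) ->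
  (forall j x, Z j.+2 x + m ^+ 2 * Z j x + U j x = 0) ->
  forall l x, (l <= n)%N -> 0 <= x <= 1 ->
  Z l x ^+ 2 <= expR 1 / m ^+ 2 * cint (fun x => U n x ^+ 2) 0 1.
Proof.
move=> m0 tU tZ Z0 ZE; apply: tower_bound_down => //.
  by move=> l ln; apply: Z0; exact: leqW.
move=> x /andP[x0 x1].
have cU2 := cont_sqr (tower_continuous n tU).
have dE : has_derive (fun x : R => expR (- x)) (fun x => - expR (- x)).
  have := has_derive_affine (-1) 0 (fun x : R => is_derive_expR x).
  by apply: has_derive_eq => y; rewrite !(mulN1r, add0r).
pose En x := Z n.+1 x ^+ 2 + m ^+ 2 * Z n x ^+ 2.
have dEn : has_derive En (fun x => - 2 * Z n.+1 x * U n x).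
  have := has_deriveD (has_derive_sqr (tZ n.+1)) (has_deriveZ (m ^+ 2) (has_derive_sqr (tZ n))).
  apply: has_derive_eq => // y.
  have -> : Z n.+2 y = - m ^+ 2 * Z n y - U n y by have := ZE n y; lra.
  by ring.
have dG := has_deriveB (cint_derive 0 cU2) (has_deriveM dE dEn).
have := has_derive_ger0 dG x0.
rewrite /= cintxx oppr0 expR0 /En !Z0// ?leqW//; rewrite ?expr0n/= mulr0 addr0 mulr0 subr0 => H.
have {H} : 0 <= cint (fun x => U n x ^+ 2) 0 x - expR (- x) * En x.
  apply: H => y /andP[y0 _].
  have e1 : expR (- y) <= 1 by rewrite -expR0 ler_expR oppr_le0.
  have e0 := expR_ge0 (- y).
  rewrite -/(En y) /En.
  have -> : U n y ^+ 2 - (- expR (- y) * (Z n.+1 y ^+ 2 + m ^+ 2 * Z n y ^+ 2) +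
      expR (- y) * (- 2 * Z n.+1 y * U n y)) =
    (1 - expR (- y)) * U n y ^+ 2 + expR (- y) * ((Z n.+1 y + U n y) ^+ 2 + m ^+ 2 * Z n y ^+ 2).
    by ring.
  have m2 : 0 <= m ^+ 2 * Z n y ^+ 2 by rewrite mulr_ge0 ?sqr_ge0.
  by rewrite addr_ge0// mulr_ge0 ?sqr_ge0 ?subr_ge0 ?addr_ge0 ?sqr_ge0.
rewrite subr_ge0 => H.
have cx : cint (fun x => U n x ^+ 2) 0 x <= cint (fun x => U n x ^+ 2) 0 1.
  rewrite -(cint_cat _ 0 x 1) lerDl; apply: cint_ge0 => // y _; exact: sqr_ge0.
have {}H : En x <= expR 1 * cint (fun x => U n x ^+ 2) 0 1.
  have := le_trans H cx; rewrite expRN ler_pdivrMl ?expR_gt0// => /le_trans; apply.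
  by apply: ler_wpM2r; [exact/cint01_sqr_ge0/tower_continuous|rewrite ler_expR].
rewrite mulrAC ler_pdivlMr ?exprn_gt0// mulrC; apply: le_trans H.
by rewrite /En lerDr sqr_ge0.
Qed.

Lemma cont_sum n (f : 'I_n -> R -> R) : (forall i, continuous (f i)) ->
  continuous (fun x => \sum_i f i x).
Proof.
elim: n f => [|n IH] f cf.
  by rewrite (_ : (fun _ => _) = fun=> 0); [exact: cont_cst|apply/funext => x; rewrite big_ord0].
rewrite (_ : (fun _ => _) = fun x => \sum_i f (widen_ord (leqnSn n) i) x + f ord_max x).
  by apply: contD => //; exact: IH.
by apply/funext => x; rewrite big_ord_recr.
Qed.

(** [P] stands for the polynomial of degree < n left by integrating Y^(2n+2) + lam Y^(2n) + U^(2n) =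
    0 n times. The method is shooting: Z starts from zero data at 0, and a combination of [E] and
    its first n derivatives, which respect the conditions at 0, corrects the n + 1 conditions at 1.
    The correction depends linearly on finitely many values of Z, whence the bound. *)
Lemma resolvent n lam : 0 < lam -> ~ is_eigenvalue n.+1 lam ->
  exists2 C, 0 <= C & forall U, clamped n.+1 U -> exists Y P,
    [/\ clamped n.+1 Y, tower P, forall x, P n x = 0,
        forall x, Y n.+2 x + lam * Y n x + U n x = P 0%N x &
        cint (fun x => Y n x ^+ 2) 0 1 <= C * cint (fun x => U n x ^+ 2) 0 1].
Proof.
move=> lam0 Hlam; pose m := Num.sqrt lam.
have m0 : 0 < m by rewrite sqrtr_gt0.
have m2 : m ^+ 2 = lam by rewrite sqr_sqrtr// ltW.
have [E [tE E0 E1 EE]] := fundamental_tower (2 * n) m0.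
rewrite m2 in EE.
pose phi (c : 'rV[R]_n.+1) (j : nat) x := \sum_(i < n.+1) c 0 i * E (i + j)%N x.
have tphi c : tower (phi c).
  by apply: tower_sum => i; apply: towerZ; exact: tower_shift.
have phi0 c l : (l <= n)%N -> phi c l 0 = 0.
  move=> ln; rewrite /phi big1// => i _; rewrite E0 ?mulr0//.
  by rewrite mul2n -addnn leq_add// -ltnS.
have phiE c j x : (n <= j)%N -> phi c (n + j).+2 x + lam * phi c (n + j) x = 0.
  move=> nj; rewrite /phi mulr_sumr -big_split/= big1// => i _.
  rewrite mulrCA -mulrDr !addnS EE ?mulr0// mul2n -addnn.
  by rewrite (leq_trans _ (leq_addl _ _))// leq_add2l.
pose M : 'M[R]_n.+1 := \matrix_(i, l) E (i + l)%N 1.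
have phi1 c (l : 'I_n.+1) : phi c l 1 = (c *m M) 0 l.
  by rewrite /phi mxE; apply: eq_bigr => i _; rewrite mxE.
have detM : \det M != 0.
  (* A row vector killed by [M] makes [phi c] a clamped solution of the homogeneous equation, that
     is, an eigenfunction once it is known to be nonzero. *)
  apply/negP => /det0P[c c0 cM]; apply: Hlam.
  have /rV0Pn[i1 ci1] := c0.
  (* The derivative of [phi c] of order 2n + 1 - i0 at 0 isolates the last nonzero coefficient:
     E^(2n+1)(0) = 1, while smaller indices meet derivatives of E of order at most 2n, which vanish
     at 0. *)
  pose i0 := [arg max_(i > i1 | c 0 i != 0) (i : nat)].
  have [ci0 i0max] : c 0 i0 != 0 /\ forall i, c 0 i != 0 -> (i <= i0)%N.
    by rewrite /i0; case: arg_maxnP.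
  apply: (@tower_eigenvalue _ n.+1 lam (phi c) (2 * n - i0).+1) => //.
  - move=> x; have -> : (2 * n.+1 - 2 = n + n)%N by rewrite mul2n -addnn addSn addnS subSS subSS subn0.
    have -> : (2 * n.+1 = (n + n).+2)%N by rewrite mul2n -addnn addSn addnS.
    exact: phiE.
  - move=> l ln; rewrite phi0//; split=> //.
    by rewrite (phi1 c (Ordinal ln)) cM mxE.
  - rewrite /phi (bigD1 i0)//= big1 ?addr0 => [|i ii0].
      have le0 : (i0 <= 2 * n)%N by rewrite mul2n -addnn (leq_trans _ (leq_addl _ _))// -ltnS.
      by rewrite addnS subnKC// E1 mulr1.
    have [->|ci] := eqVneq (c 0 i) 0; first by rewrite mul0r.
    have ilt : (i < i0)%N by rewrite ltn_neqAle ii0 i0max.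
    have le0 : (i0 <= 2 * n)%N by rewrite mul2n -addnn (leq_trans _ (leq_addl _ _))// -ltnS.
    rewrite E0 ?mulr0// addnS -addSn -leq_subRL ?leqW//.
      by rewrite leq_sub2l.
    by rewrite (leq_trans ilt).
pose N := invmx M; pose k := n.+1%:R : R; pose D := expR 1 / m ^+ 2.
pose v i := \sum_(l < n.+1) N l i ^+ 2.
(* [h] times the integral of U_n^2 will majorize Y_n^2 pointwise: [D] is the energy bound on the
   Z_l^2, and [k * (D * v i)] is the resulting bound on the squared coefficients of the
   correction. *)
pose h x := 2 * D + 2 * (k * \sum_(i < n.+1) (k * (D * v i)) * E (i + n)%N x ^+ 2).
have D0 : 0 <= D by rewrite divr_ge0 ?expR_ge0// sqr_ge0.
have v0 i : 0 <= v i by apply: sumr_ge0 => l _; exact: sqr_ge0.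
have k0 : 0 <= k by rewrite ler0n.
have ch : continuous h.
  apply: contD; first exact: cont_cst.
  do 2 apply: contZ; apply: cont_sum => i; apply/contZ/cont_sqr.
  exact: tower_continuous.
exists (cint h 0 1).
  apply: cint_ge0 => // x _; apply: addr_ge0; first exact: mulr_ge0.
  do 2 apply: mulr_ge0 => //; apply: sumr_ge0 => i _; apply: mulr_ge0; last exact: sqr_ge0.
  by apply: mulr_ge0 => //; exact: mulr_ge0.
move=> U [tU bU].
have [Z [tZ Z0 Z1 ZE]] := oscillator_tower 0 m0 tU.
have Zl l : (l <= n.+2)%N -> Z l 0 = 0.
  suff : ((l <= n.+2)%N -> Z l 0 = 0) /\ ((l < n.+2)%N -> Z l.+1 0 = 0) by case.
  elim: l => [//|l [IH1 IH2]]; split=> // ln.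
  have := ZE l 0; rewrite IH1 ?mulr0 ?addr0; last by rewrite ltnW// ltnW.
  by have [->] := bU l ln; rewrite addr0.
have ZK := oscillator_energy m0 tU tZ (fun l ln => Zl l (leqW ln)) ZE.
set K := cint _ 0 1 in ZK.
pose b : 'rV[R]_n.+1 := \row_l Z l 1.
pose c := - (b *m N).
have cM : c *m M = - b.
  by rewrite /c mulNmx -mulmxA mulVmx ?mulmx1// unitmxE unitfE.
exists (fun j x => Z j x + phi c j x), (fun j x => phi c (n.+2 + j)%N x + lam * phi c (n + j)%N x).
split.
- split; first exact: towerD.
  move=> l ln; rewrite Zl ?phi0 ?addr0//; last by rewrite ltnW// ltnW.
  by rewrite (phi1 c (Ordinal ln)) cM !mxE /= subrr.
- apply: towerD; first exact: tower_shift.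
  by apply: towerZ; exact: tower_shift.
- by move=> x; rewrite !addSn; exact: phiE.
- by move=> x; have := ZE n x; rewrite !addn0 m2; lra.
have x01 : 0 <= (1 : R) <= 1 by rewrite ler01 lexx.
rewrite mulrC -cintZ//; apply: le_cint => //.
- by apply/cont_sqr/contD; exact: tower_continuous.
- exact: contZ.
move=> x xin.
have c2 i : c 0 i ^+ 2 <= k * (D * v i) * K.
  rewrite /c mxE sqrrN mxE; apply: le_trans (sqr_sum_le _) _.
  rewrite (_ : k * (D * v i) * K = k * \sum_(l < n.+1) (D * K) * N l i ^+ 2); last first.
    by rewrite -mulr_sumr -/(v i); ring.
  apply: ler_wpM2l => //; apply: ler_sum => l _.
  rewrite exprMn; apply: ler_wpM2r; [exact: sqr_ge0|rewrite mxE].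
  by apply: ZK => //; rewrite -ltnS.
have : (Z n x + phi c n x) ^+ 2 <= 2 * Z n x ^+ 2 + 2 * phi c n x ^+ 2.
  by rewrite -subr_ge0 (_ : _ - _ = (Z n x - phi c n x) ^+ 2) ?sqr_ge0//; ring.
move=> /le_trans; apply.
rewrite /h mulrDr lerD//.
  by rewrite [leRHS]mulrCA; apply: ler_wpM2l => //; rewrite mulrC; exact: ZK.
rewrite [leRHS]mulrCA; apply: ler_wpM2l => //; apply: le_trans (sqr_sum_le _) _.
rewrite [leRHS]mulrCA; apply: ler_wpM2l => //; rewrite mulr_sumr; apply: ler_sum => i _.
rewrite exprMn [leRHS]mulrA; apply: ler_wpM2r; first exact: sqr_ge0.
by rewrite mulrC; exact: c2.
Qed.

End Resolvent.

(** * The best constant is the first eigenvalue *)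

Section Wirtinger.
Context {R : realType}.
Implicit Types (U V Y : nat -> R -> R) (lam : R).

(** Integration by parts against 2x - 1, of modulus at most 1 on [0, 1]. The crude constant 1 shows
    that the set of admissible constants contains a positive number. *)
Lemma poincare01 (v v' : R -> R) : has_derive v v' -> continuous v' ->
  v 0 = 0 -> v 1 = 0 ->
  cint (fun x => v x ^+ 2) 0 1 <= cint (fun x => v' x ^+ 2) 0 1.
Proof.
move=> dv cv' v0 v1; have cv := has_derive_continuous dv.
have da : has_derive (fun x : R => 2 * x - 1) (fun=> 2).
  have := has_deriveB (has_deriveZ 2 (@has_derive_id R)) (has_derive_cst (1 : R)).
  by apply: has_derive_eq => x; rewrite ?mulr1 ?subr0.
have ca := has_derive_continuous da.
have cvv : continuous (fun x => 2 * (v x * v' x)) by apply/contZ/contM.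
have := cint_parts 0 1 da (has_derive_sqr dv) (@cont_cst R 2) cvv.
rewrite v0 v1 expr0n/= !mulr0 subrr sub0r cintZ; last exact: cont_sqr.
have : - cint (fun x => (2 * x - 1) * (2 * (v x * v' x))) 0 1 <=
    cint (fun x => v x ^+ 2 + v' x ^+ 2) 0 1.
  rewrite -[X in X <= _]mulN1r -cintZ; last exact: contM.
  apply: le_cint => //; first by apply/contZ/contM.
    by apply: contD; exact: cont_sqr.
  move=> x /andP[x0 x1]; set a := v x; set b := v' x.
  have -> : -1 * ((2 * x - 1) * (2 * (a * b))) =
    a ^+ 2 + b ^+ 2 - ((1 - x) * (a - b) ^+ 2 + x * (a + b) ^+ 2) - 2 * ((2 * x - 1) * (a * b)) + (1 - x) * (-2 * (a*b)) + x * (2 * (a * b)).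
    by ring.
  have h1 : 0 <= (1 - x) * (a - b) ^+ 2 by rewrite mulr_ge0 ?sqr_ge0// subr_ge0.
  have h2 : 0 <= x * (a + b) ^+ 2 by rewrite mulr_ge0 ?sqr_ge0.
  lra.
rewrite cintD; [|exact: cont_sqr|exact: cont_sqr].
lra.
Qed.

(* The infimum of the Rayleigh quotient over clamped functions is attained at
   an eigenvalue: otherwise the solution Y of the inhomogeneous problem with
   right-hand side U, tested against U through the nonnegative quadratic form
   Q(U - t Y), would improve the bound. *)
Lemma wirtinger01 n nu U : is_wirtinger_cimmino n.+1 nu -> clamped n.+1 U ->
  nu ^+ 2 * cint (fun x => U n x ^+ 2) 0 1 <= cint (fun x => U n.+1 x ^+ 2) 0 1.
Proof.
move=> [nu0 _ numin].
pose S : set R := [set lam | forall V, clamped n.+1 V ->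
  lam * cint (fun x => V n x ^+ 2) 0 1 <= cint (fun x => V n.+1 x ^+ 2) 0 1].
suff : S (nu ^+ 2) by apply.
have cl_ge0 V j : clamped n.+1 V -> 0 <= cint (fun x => V j x ^+ 2) 0 1.
  by move=> [tV _]; exact/cint01_sqr_ge0/tower_continuous.
have Sdown a b : S b -> a <= b -> S a.
  move=> Sb ab V cV; apply: le_trans (Sb V cV).
  by rewrite ler_wpM2r// cl_ge0.
apply: contrapT => nS.
have Sub : ubound S (nu ^+ 2).
  move=> a Sa; rewrite leNgt; apply/negP => /ltW nua.
  exact/nS/(Sdown _ _ Sa).
have S1 : S 1.
  move=> V [tV bV]; rewrite mul1r; have [V0 V1] := bV n (leqnn _).
  by apply: (poincare01 (tV n)) => //; exact: tower_continuous.
have hs : has_sup S by split; [exists 1|exists (nu ^+ 2)].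
pose lam := sup S.
have hub : has_ubound S by exists (nu ^+ 2).
have lam1 : 1 <= lam by apply: ub_le_sup.
have lam0 : 0 < lam by apply: lt_le_trans lam1.
have Slam : S lam.
  move=> V cV; set A := cint _ 0 1; set B := cint _ 0 1.
  have A0 : 0 <= A by exact: cl_ge0.
  have [A00|An0] := eqVneq A 0; first by rewrite A00 mulr0; exact: cl_ge0.
  have Ap : 0 < A by rewrite lt_def An0.
  rewrite -ler_pdivlMr//; apply: ge_sup; first by exists 1.
  by move=> a /(_ V cV); rewrite ler_pdivlMr.
have lamnu : lam < nu ^+ 2.
  rewrite lt_neqAle; apply/andP; split; last first.
    by apply: ge_sup => //; exists 1.
  by apply/eqP => E; apply: nS; rewrite -E.
have neig : ~ is_eigenvalue n.+1 lam.
  by move=> /(numin _ lam0); rewrite leNgt lamnu.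
have [C C0 HC] := resolvent lam0 neig.
(* The resolvent bound and 2 V Y <= V^2 + Y^2 give int V_n Y_n <= C' int V_n^2. Then Q(V - t Y) >= 0
   yields Q(V) >= (2t - t^2 C') int V_n^2, and t = 1 / C' maximizes this gain, to the value 1 /
   C'. *)
pose C' := (1 + C) / 2.
have C'0 : 0 < C' by rewrite /C'; lra.
suff /(ub_le_sup hub) : S (lam + C'^-1).
  by rewrite -/lam gerDl leNgt invr_gt0 C'0.
move=> V cV; have [Y [P [cY tP P0 YE YC]]] := HC V cV.
have [[tV bV] [tY bY]] := (cV, cY).
have cont (W : nat -> R -> R) j : clamped n.+1 W -> continuous (W j).
  by move=> [tW _]; exact: tower_continuous.
have clM (W W' : nat -> R -> R) i j : clamped n.+1 W -> clamped n.+1 W' ->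
    continuous (fun x => W i x * W' j x).
  by move=> cW cW'; apply: contM; exact: cont.
(* Weak form of the equation for Y: [P] disappears because its n-th derivative is zero, which makes
   it orthogonal to W_n. *)
have YW W : clamped n.+1 W ->
    cint (fun x => Y n.+1 x * W n.+1 x) 0 1 - lam * cint (fun x => Y n x * W n x) 0 1
    = cint (fun x => V n x * W n x) 0 1.
  move=> cW; have [tW bW] := cW.
  have o := tower_orthogonal tP tW P0 (fun l ln => bW l (ltnW ln)).
  have [Wn0 Wn1] := bW n (leqnn _).
  have := cint_parts 0 1 (tY n.+1) (tW n) (cont Y n.+2 cY) (cont W n.+1 cW).
  rewrite Wn0 Wn1 !mulr0 subrr sub0r => pt.
  have : cint (fun x => (Y n.+2 x * W n x + lam * (Y n x * W n x)) + V n x * W n x) 0 1 = 0.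
    rewrite -[RHS]o; congr cint; apply/funext => x; rewrite -YE; ring.
  rewrite cintD; [|by apply: contD; [|apply: contZ]; exact: clM|exact: clM].
  rewrite cintD; [|exact: clM|by apply: contZ; exact: clM].
  rewrite cintZ; last exact: clM.
  by rewrite pt; lra.
have YV := YW V cV; have YY := YW Y cY.
set t := C'^-1.
have cVY := clampedB t cV cY.
have := Slam _ cVY.
have sqrB j : cint (fun x => (V j x - t * Y j x) ^+ 2) 0 1 =
    cint (fun x => V j x ^+ 2) 0 1 - 2 * t * cint (fun x => Y j x * V j x) 0 1 +
    t ^+ 2 * cint (fun x => Y j x * Y j x) 0 1.
  rewrite -!cintZ; [|exact: clM|exact: clM].
  rewrite -cintB; [|exact/cont_sqr/cont|by apply: contZ; exact: clM].
  rewrite -cintD; [|by apply: contB; [exact/cont_sqr/cont|by apply: contZ; exact: clM]|by apply: contZ; exact: clM].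
  by congr cint; apply/funext => x; ring.
rewrite /= !sqrB.
have VV : cint (fun x => V n x * V n x) 0 1 = cint (fun x => V n x ^+ 2) 0 1.
  by congr cint; apply/funext => x; rewrite expr2.
have VYle : cint (fun x => V n x * Y n x) 0 1 <= C' * cint (fun x => V n x ^+ 2) 0 1.
  have : cint (fun x => V n x * Y n x) 0 1 <= cint (fun x => 1 / 2 * (V n x ^+ 2 + Y n x ^+ 2)) 0 1.
    apply: le_cint => //; first exact: clM.
      by apply/contZ/contD; exact/cont_sqr/cont.
    by move=> x _; have := sqr_ge0 (V n x - Y n x); rewrite sqrrB; lra.
  move=> /le_trans; apply; rewrite cintZ; last by apply: contD; exact/cont_sqr/cont.
  rewrite cintD; [|exact/cont_sqr/cont|exact/cont_sqr/cont].
  by rewrite /C'; lra.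
rewrite VV in YV.
set a := cint (fun x => V n x ^+ 2) 0 1 in YV VYle *.
set b := cint (fun x => V n.+1 x ^+ 2) 0 1.
have : t ^+ 2 * cint (fun x => V n x * Y n x) 0 1 <= t * a.
  have -> : t * a = t ^+ 2 * (C' * a) by rewrite /t; field; rewrite gt_eqF.
  by rewrite ler_wpM2l ?sqr_ge0.
rewrite -YY -YV; move: (cint (fun x => Y n.+1 x * V n.+1 x) 0 1) (cint (fun x => Y n x * V n x) 0 1)
 (cint (fun x => Y n.+1 x * Y n.+1 x) 0 1) (cint (fun x => Y n x * Y n x) 0 1) YV => p q r s pq.
rewrite [in X in _ -> _ -> X]mulrDl.
lra.
Qed.

End Wirtinger.

(** * Two-point Hermite interpolation *)

Section PolynomialMajorants.
Context {R : realType}.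
Implicit Types (p q P Q : {poly R}) (x : R).

Definition majorizes P p : Prop := forall i, `|p`_i| <= P`_i.

Lemma majorizesM P p Q q : majorizes P p -> majorizes Q q ->
  majorizes (P * Q) (p * q).
Proof.
move=> Pp Qq i; rewrite !coefM; apply: le_trans (ler_norm_sum _ _ _) _.
by apply: ler_sum => j _; rewrite normrM ler_pM.
Qed.

Lemma majorizesX P p n : majorizes P p -> majorizes (P ^+ n) (p ^+ n).
Proof.
move=> Pp; elim: n => [|n IH]; last by rewrite !exprS; exact: majorizesM.
by move=> i; rewrite !expr0 coef1; case: eqP => _; rewrite ?normr1 ?normr0.
Qed.

Lemma majorizes_deriv P p : majorizes P p -> majorizes P^`() p^`().
Proof. by move=> Pp i; rewrite !coef_deriv normrMn lerMn2r Pp orbT. Qed.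

Lemma majorizes_derivn j P p : majorizes P p -> majorizes P^`(j) p^`(j).
Proof.
by move=> Pp; elim: j => [//|j IH]; rewrite !derivnS; exact: majorizes_deriv.
Qed.

(** Bounds on [-1, 1] for polynomials with signs thus reduce to values at 1 of polynomials with
    nonnegative coefficients, where a differentiation costs at most a factor equal to the degree. *)
Lemma majorizes_horner P p x : majorizes P p -> `|x| <= 1 -> `|p.[x]| <= P.[1].
Proof.
move=> Pp x1; rewrite (horner_coef_wide x (leq_maxl (size p) (size P))).
rewrite (horner_coef_wide 1 (leq_maxr (size p) (size P))).
apply: le_trans (ler_norm_sum _ _ _) _; apply: ler_sum => i _.
by rewrite normrM expr1n ler_pM// normrX exprn_ile1.
Qed.

Lemma size_deriv_le p N : (size p <= N.+1)%N -> (size p^`() <= N)%N.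
Proof.
move=> sp; apply/leq_sizeP => i Ni.
by rewrite coef_deriv nth_default ?mul0rn// (leq_trans sp).
Qed.

Lemma deriv_horner1_le P N : (forall i, 0 <= P`_i) -> (size P <= N.+1)%N ->
  (P^`()).[1] <= N%:R * P.[1].
Proof.
move=> P0 sP; have sP' := size_deriv_le sP.
rewrite (horner_coef_wide _ sP) (horner_coef_wide _ sP') big_ord_recl mulrDr.
apply: ler_wpDl; first by rewrite mulr_ge0 ?mulr_ge0 ?ler0n// P0.
rewrite mulr_sumr; apply: ler_sum => i _.
rewrite !expr1n !mulr1 lift0 coef_deriv -[leLHS]mulr_natl; apply: ler_wpM2r; first exact: P0.
by rewrite ler_nat.
Qed.

Lemma derivn_horner1_le j P N : (forall i, 0 <= P`_i) -> (size P <= N.+1)%N ->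
  (j <= N)%N -> (P^`(j)).[1] <= (N ^_ j)%:R * P.[1].
Proof.
move=> P0; elim: j N P P0 => [|j IH] N P P0 sP jN; first by rewrite ffactn0 mul1r.
case: N sP jN => [//|N] sP jN; rewrite derivSn; apply: le_trans (IH N _ _ _ _) _ => //.
- by move=> i; rewrite coef_deriv mulrn_wge0.
- exact: size_deriv_le.
rewrite ffactSS natrM [N.+1%:R * _]mulrC -mulrA; apply: ler_wpM2l => //.
exact: deriv_horner1_le.
Qed.

Lemma derivn_mulX_root p q k j x : root p x -> (j < k)%N ->
  ((p ^+ k * q)^`(j)).[x] = 0.
Proof.
move=> /rootP px; elim: j k q => [|j IH] [|k] q jk //.
  by rewrite /= exprS !hornerM px !mul0r.
rewrite derivSn derivM deriv_exp -mulr_natl.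
have -> : k.+1%:R * (p^`() * p ^+ k.+1.-1) * q + p ^+ k.+1 * q^`() =
   p ^+ k * (k.+1%:R * (p^`() * q) + p * q^`()).
  by rewrite exprS /=; ring.
exact: IH.
Qed.

End PolynomialMajorants.

(** * The Hermite basis polynomials and their size *)

Section HermiteBasis.
Context {R : realType}.
Implicit Types (k l m s j n : nat) (x : R).

(* Truncation of the power series of (1 - X)^(-k). *)
Definition geom_trunc k m : {poly R} := \poly_(s < m) ('C(k + s - 1, s))%:R.

Lemma geom_truncS k m :
  geom_trunc k m.+1 = geom_trunc k m + 'C(k + m - 1, m)%:R *: 'X^m.
Proof.
rewrite /geom_trunc !poly_def big_ord_recr//=.
Qed.

Lemma geom_trunc_rec k m :
  (1 - 'X) * geom_trunc k.+1 m.+1 =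
  geom_trunc k m.+1 - 'C(k + m, m)%:R *: 'X^(m.+1).
Proof.
elim: m => [|m IH].
  rewrite !geom_truncS /geom_trunc !poly_def !big_ord0 !addn0 !bin0 !add0r !scale1r.
  by rewrite expr0 mulr1 expr1.
rewrite geom_truncS mulrDr IH [in RHS]geom_truncS.
have -> : (k.+1 + m.+1 - 1 = k + m.+1)%N by rewrite addSn subn1.
have -> : (k + m.+1 - 1 = k + m)%N by rewrite addnS subn1.
rewrite -!mul_polyC [in 'C(k + m.+1, m.+1)]addnS binS natrD polyCD [('X^(m.+2))]exprS.
by ring.
Qed.

(** Each factor 1 - X lowers k by one, by Pascal's rule, at the price of a multiple of X^(m+1). *)
Lemma geom_truncP k m : exists q,
  (1 - 'X) ^+ k * geom_trunc k m.+1 = 1 + 'X^(m.+1) * q.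
Proof.
elim: k => [|k [q IH]].
  exists 0; rewrite expr0 mul1r mulr0 addr0 /geom_trunc; apply/polyP => i.
  rewrite coef_poly coef1 add0n; case: i => [|i]; first by rewrite bin0.
  by rewrite subn1 bin_small//; case: ifP.
exists (q - 'C(k + m, m)%:R *: (1 - 'X) ^+ k).
by rewrite exprSr -mulrA geom_trunc_rec mulrBr IH -!mul_polyC; ring.
Qed.

Definition binsum k m : nat := \sum_(s < m) 'C(k + s - 1, s).

Lemma geom_trunc_horner1 k m : (geom_trunc k m).[1] = (binsum k m)%:R.
Proof.
rewrite /geom_trunc poly_def horner_sum natr_sum; apply: eq_bigr => s _.
by rewrite hornerZ hornerXn expr1n mulr1.
Qed.

(** Consecutive terms of the sum have ratio (k + m) / (m + 1) >= 2 as long as m + 1 < k, so every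
    term dominates the sum of the preceding ones. The powers of 2 gained in this way will pay for
    the factor 2l + 1 of the weights. *)
Lemma binsum_double k m : (m < k)%N -> (2 * binsum k m <= binsum k m.+1)%N.
Proof.
move=> mk; rewrite /binsum big_ord_recr /= mul2n -addnn leq_add2l.
elim: m mk => [|m IH] mk; first by rewrite big_ord0.
rewrite big_ord_recr /=; apply: leq_trans (leq_add (IH (ltnW mk)) (leqnn _)) _.
have -> : (k + m.+1 - 1 = k + m)%N by rewrite addnS subn1.
rewrite addnn -mul2n -(leq_pmul2l (ltn0Sn m)) -mul_bin_diag.
rewrite subn1 mulnA leq_mul2r; apply/orP; right.
by rewrite mulnC mul2n -addnn addSn addnS -addSn -addnS -addSnnS leq_add2r.
Qed.

Lemma binsum_pow2 k l : (l <= k)%N -> (2 ^ l * binsum k (k - l) <= binsum k k)%N.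
Proof.
elim: l => [|l IH] lk; first by rewrite subn0 mul1n.
apply: leq_trans (IH (ltnW lk)); rewrite expnSr -mulnA leq_mul2l -[in X in _ || X](subnSK lk).
by apply/orP; right; apply: binsum_double; rewrite ltn_subrL (leq_ltn_trans _ lk).
Qed.

Lemma Cbin_binsum k : Cbin k = (binsum k k)%:R ^+ 2 :> R.
Proof. by rewrite /Cbin natr_sum. Qed.

(** The power of 1 - X kills k derivatives at 1; the truncated series undoes it at 0 modulo X^(k-l),
    so that the product agrees with X^l / l! up to a multiple of X^k. *)
Definition hermite_basis k l : {poly R} :=
  (l`!)%:R^-1 *: ('X^l * ((1 - 'X) ^+ k * geom_trunc k (k - l))).

Lemma root1_1BX : root (1 - 'X : {poly R}) 1.
Proof. by apply/rootP; rewrite !hornerE subrr. Qed.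

Lemma root0_X : root ('X : {poly R}) 0.
Proof. by apply/rootP; rewrite hornerX. Qed.

Lemma hermite_basis1 k l j : (j < k)%N -> ((hermite_basis k l)^`(j)).[1] = 0.
Proof.
move=> jk; rewrite derivnZ hornerZ mulrCA derivn_mulX_root ?mulr0//.
exact: root1_1BX.
Qed.

Lemma derivn_monomial0 l j :
  (((l`!)%:R^-1 *: 'X^l)^`(j)).[0] = (j == l)%:R :> R.
Proof.
rewrite derivnZ hornerZ derivnXn hornerMn hornerXn.
have [->|jl] := eqVneq j l.
  by rewrite ffactnn subnn expr0 mulVf// pnatr_eq0 -lt0n fact_gt0.
have [jlt|nlt] := ltnP j l.
  by rewrite expr0n subn_eq0 leqNgt jlt mul0rn mulr0.
by rewrite ffact_small ?mulr0n ?mulr0// ltn_neqAle eq_sym jl.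
Qed.

Lemma hermite_basis0 k l j : (l < k)%N -> (j < k)%N ->
  ((hermite_basis k l)^`(j)).[0] = (j == l)%:R.
Proof.
move=> lk jk; rewrite /hermite_basis -subnSK//.
have [q ->] := geom_truncP k (k - l.+1); rewrite subnSK//.
rewrite mulrDr mulr1 scalerDr derivnD hornerD derivn_monomial0.
rewrite ['X^l * _]mulrA -exprD subnKC ?(ltnW lk)// derivnZ hornerZ.
by rewrite derivn_mulX_root ?mulr0 ?addr0//; exact: root0_X.
Qed.

Lemma size_hermite_basis k l : (l < k)%N -> (size (hermite_basis k l) <= (2 * k).-1.+1)%N.
Proof.
move=> lk; apply: leq_trans (size_scale_leq _ _) _.
have s1 : (size ((1 - 'X) ^+ k : {poly R}) <= k.+1)%N.
  have := size_poly_exp_leq (1 - 'X : {poly R}) k; move/leq_trans; apply.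
  rewrite ltnS; apply: leq_trans (leq_mul (n1 := 1%N) _ (leqnn _)) _; last by rewrite mul1n.
  by rewrite -opprB size_polyN size_XsubC.
have s2 : (size (geom_trunc k (k - l)) <= k - l)%N by exact: size_poly.
have s3 : (size ((1 - 'X) ^+ k * geom_trunc k (k - l))%R <= k + (k - l))%N.
  apply: leq_trans (size_polyMleq _ _) _.
  by rewrite -subn1 leq_subLR add1n -addSn leq_add.
rewrite mulrC; apply: leq_trans (size_polyMleq _ _) _; rewrite size_polyXn addnS /=.
rewrite prednK; last by rewrite muln_gt0 (leq_ltn_trans _ lk).
by rewrite mul2n -addnn -[X in (_ <= _ + X)%N](subnK (ltnW lk)) addnA leq_add2r.
Qed.

(** With N = 2n + 1 the falling factorial is at most N^n, 4^(n+1) <= 16^n, and 16 N^2 <= mu(N) for N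
    >= 3. This is the estimate through which [mu] enters; it fails for n = 0. *)
Lemma falling_mu_le n : (0 < n)%N ->
  ((((2 * n.+1).-1 ^_ n) ^ 2 * 4 ^ n.+1)%N%:R <= mu (2 * n.+1 - 1) ^+ n :> R).
Proof.
move=> n0; set N := (2 * n.+1).-1.
have NE : N = (2 * n).+1 by rewrite /N mulnS.
have H1 : (N ^_ n <= N ^ n)%N.
  elim: (n) => [//|i IH]; rewrite ffactnSr expnSr leq_mul//.
  by rewrite leq_subr.
have H2 : (4 ^ n.+1 <= 16 ^ n)%N.
  case: (n) n0 => // i _; rewrite (_ : 16 = 4 * 4)%N// expnMn expnSr leq_mul2l.
  by rewrite (leq_pexp2l (m := 4) isT (_ : (1 <= i.+1)%N)) ?orbT.
apply: (@le_trans _ _ ((16 * N ^ 2) ^ n)%N%:R).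
  rewrite ler_nat expnMn mulnC leq_mul// expnAC leq_exp2r//.
rewrite natrX; apply: lerXn2r; rewrite ?nnegrE ?ler0n//.
  by rewrite /mu divr_ge0 ?ler0n.
rewrite /mu ler_pdivlMr// -natrM ler_nat subn1 -/N NE.
case: n n0 {N NE H1 H2} => // n _; nia.
Qed.

(** Replacing 1 - X by 1 + X gives a majorant [P] of degree at most 2n + 1, to which the bound on
    derivatives at 1 applies. [P.[1]] involves a truncated sum shorter by l terms, hence smaller by
    a factor 2^l, and 2l + 1 <= 4^l is absorbed after squaring. *)
Lemma hermite_basis_bound n l x : (l <= n)%N -> `|x| <= 1 -> `|1 - x| <= 1 ->
  ((hermite_basis n.+1 l)^`(n)).[x] ^+ 2 <=
  Cbin n.+1 * mu (2 * n.+1 - 1) ^+ n / ((2 * l + 1)%:R * (l`!)%:R ^+ 2).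
Proof.
move=> ln x1 x1'; rewrite Cbin_binsum.
have [n0|n0] := posnP n.
  (* For n = 0 the only basis polynomial is 1 - X and the claimed bound is 1. *)
  move: ln; rewrite n0 leqn0 => /eqP ->.
  rewrite /hermite_basis /binsum big_ord_recr big_ord0 /= subn0 fact0 invr1 scale1r.
  rewrite expr0 mul1r expr1 geom_truncS /geom_trunc poly_def big_ord0 !addn0 bin0.
  rewrite add0r scale1r expr0 mulr1 !hornerE [leRHS](_ : _ = 1); last first.
    by rewrite ?(muln0, add0n, expr0, expr1n, mulr1, divr1).
  by rewrite -[_ ^+ 2]real_normK ?num_real// expr_le1.
set N := (2 * n.+1).-1.
pose P : {poly R} := (l`!)%:R^-1 *: ('X^l * ((1 + 'X) ^+ n.+1 * geom_trunc n.+1 (n.+1 - l))).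
have lf0 : 0 < (l`!)%:R :> R by rewrite ltr0n fact_gt0.
have maj : majorizes P (hermite_basis n.+1 l).
  rewrite /P /hermite_basis -!mul_polyC; apply: majorizesM.
    by move=> i; rewrite coefC; case: ifP => _; rewrite ?normr0// ger0_norm// invr_ge0 ltW.
  apply: majorizesM; first by move=> i; rewrite coefXn normr_nat.
  apply: majorizesM.
    apply: majorizesX => i; rewrite coefB coefD coef1 coefX.
    by case: i => [|[|i]] //=; rewrite ?subr0 ?addr0 ?sub0r ?add0r ?normrN ?normr1 ?normr0.
  move=> i; rewrite /geom_trunc coef_poly; case: ifP => _; rewrite ?normr0// ger0_norm//.
have P0 i : 0 <= P`_i by apply: le_trans (maj i).
have sP : (size P <= N.+1)%N.
  apply: leq_trans (size_scale_leq _ _) _.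
  have s1 : (size ((1 + 'X) ^+ n.+1 : {poly R}) <= n.+2)%N.
    have := size_poly_exp_leq (1 + 'X : {poly R}) n.+1; move/leq_trans; apply.
    rewrite ltnS; apply: leq_trans (leq_mul (n1 := 1%N) _ (leqnn _)) _; last by rewrite mul1n.
    by rewrite addrC -polyC1 size_XaddC.
  have s2 : (size (geom_trunc n.+1 (n.+1 - l)) <= n.+1 - l)%N by exact: size_poly.
  have s3 : (size ((1 + 'X) ^+ n.+1 * geom_trunc n.+1 (n.+1 - l))%R <= n.+1 + (n.+1 - l))%N.
    apply: leq_trans (size_polyMleq _ _) _.
    by rewrite -subn1 leq_subLR add1n -addSn leq_add.
  rewrite mulrC; apply: leq_trans (size_polyMleq _ _) _; rewrite size_polyXn addnS /=.
  by apply: leq_trans (leq_add s3 (leqnn l)) _; rewrite /N; lia.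
have H := le_trans (majorizes_horner (majorizes_derivn n maj) x1)
   (derivn_horner1_le P0 sP (_ : (n <= N)%N)).
have {}H : `|((hermite_basis n.+1 l)^`(n)).[x]| <= (N ^_ n)%:R * P.[1].
  by apply: H; rewrite /N mul2n -addnn addSn /= -addSnnS leq_addl.
have P1 : P.[1] = (l`!)%:R^-1 * (2 ^+ n.+1 * (binsum n.+1 (n.+1 - l))%:R).
  by rewrite /P hornerZ !hornerM !horner_exp hornerD hornerC hornerX expr1n mul1r geom_trunc_horner1.
rewrite -real_normK ?num_real//.
have h0 : 0 <= (N ^_ n)%:R * P.[1] by apply: le_trans H.
apply: (@le_trans _ _ (((N ^_ n)%:R * P.[1]) ^+ 2)).
  by rewrite lerXn2r ?nnegrE.
rewrite P1 ler_pdivlMr; last by rewrite mulr_gt0 ?exprn_gt0// ltr0n addn1.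
set F := (N ^_ n)%:R; set B := (binsum _ (_ - _))%:R; set T := (binsum _ _)%:R; set L := (l`!)%:R.
have -> : (F * (L^-1 * (2 ^+ n.+1 * B))) ^+ 2 * ((2 * l + 1)%:R * L ^+ 2) =
   (F ^+ 2 * 4 ^+ n.+1) * ((2 * l + 1)%:R * B ^+ 2).
  have -> : 4 ^+ n.+1 = (2 ^+ n.+1) ^+ 2 :> R by rewrite -exprM mulnC exprM; congr (_ ^+ _); ring.
  by field; rewrite gt_eqF.
rewrite mulrC; apply: ler_pM.
- by rewrite mulr_ge0 ?sqr_ge0.
- by rewrite mulr_ge0 ?sqr_ge0// exprn_ge0.
- rewrite -!natrX -natrM ler_nat.
  apply: (@leq_trans ((2 ^ l * binsum n.+1 (n.+1 - l)) ^ 2)); last first.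
    by rewrite leq_exp2r// binsum_pow2// leqW.
  rewrite expnMn leq_mul2r; apply/orP; right.
  by elim: (l) => [//|i IH]; rewrite (expnS 2 i) expnMn; lia.
- by have := falling_mu_le n0; rewrite natrM !natrX.
Qed.

(** The basis at the node 1 is the reflection of the one at 0 under x -> 1 - x, and (-1)^l undoes
    the sign of the l-th derivative. The factor 2 (n + 1) is Cauchy-Schwarz over two nodes with n +
    1 data each. *)
Lemma hermite_tower n (a b : nat -> R) : exists H : nat -> R -> R,
  [/\ tower H, forall x, H (2 * n.+1)%N x = 0,
      forall j, (j <= n)%N -> H j 0 = a j /\ H j 1 = b j &
      forall x, 0 <= x <= 1 -> H n x ^+ 2 <=
        2 * n.+1%:R * (Cbin n.+1 * mu (2 * n.+1 - 1) ^+ n) *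
        \sum_(l < n.+1) (a l ^+ 2 + b l ^+ 2) / ((2 * l + 1)%:R * (l`!)%:R ^+ 2)].
Proof.
pose A (l : nat) j x := ((hermite_basis n.+1 l)^`(j)).[x].
have tA l : tower (A l) by exact: tower_poly.
pose B l j x := (-1) ^+ j * A l j (1 + -1 * x).
have tB l : tower (B l) by exact: tower_affine.
exists (fun j x => \sum_(l < n.+1) a l * A l j x + \sum_(l < n.+1) ((-1) ^+ l * b l) * B l j x).
have x10 : 1 + -1 * 0 = 1 :> R by rewrite mulr0 addr0.
have x11 : 1 + -1 * 1 = 0 :> R by rewrite mulr1 subrr.
split.
- by apply: towerD; apply: tower_sum => l; exact: towerZ.
- move=> x; rewrite !big1 ?addr0// => l _; rewrite ?/B /A.
    rewrite derivn_poly0 ?horner0 ?mulr0//.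
    by apply: leq_trans (size_hermite_basis _) _ => //; rewrite prednK// muln_gt0.
  rewrite derivn_poly0 ?horner0 ?mulr0//.
  by apply: leq_trans (size_hermite_basis _) _ => //; rewrite prednK// muln_gt0.
- move=> j jn; rewrite /B x10 x11; split.
    rewrite [X in _ + X]big1 ?addr0 => [|l _]; last by rewrite /A hermite_basis1// !mulr0.
    rewrite (bigD1 (Ordinal (jn : (j < n.+1)%N)))//= /A hermite_basis0// eqxx mulr1.
    rewrite big1 ?addr0// => l lj; rewrite hermite_basis0//.
    by rewrite eq_sym (negbTE (lj : (l : nat) != j)) mulr0.
  rewrite [X in X + _]big1 ?add0r => [|l _]; last by rewrite /A hermite_basis1// !mulr0.
  rewrite (bigD1 (Ordinal (jn : (j < n.+1)%N)))//= /A hermite_basis0// eqxx mulr1.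
  rewrite mulrAC -expr2 sqrr_sign mul1r.
  rewrite big1 ?addr0// => l lj; rewrite hermite_basis0//.
  by rewrite eq_sym (negbTE (lj : (l : nat) != j)) !mulr0.
move=> x /andP[x0 x1].
have nx : `|x| <= 1 by rewrite ger0_norm.
have nx' : `|1 - x| <= 1 by rewrite ger0_norm ?subr_ge0// gerBl.
set M := Cbin _ * _.
have HA l : (l <= n)%N -> A l n x ^+ 2 <= M / ((2 * l + 1)%:R * (l`!)%:R ^+ 2).
  by move=> ln; exact: hermite_basis_bound.
have HB l : (l <= n)%N -> B l n x ^+ 2 <= M / ((2 * l + 1)%:R * (l`!)%:R ^+ 2).
  move=> ln; rewrite /B exprMn sqrr_sign mul1r mulN1r.
  by apply: hermite_basis_bound => //; rewrite opprB addrCA subrr addr0.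
set sA := \sum_l _; set sB := \sum_(l < _) (_ * _) * _.
have : (sA + sB) ^+ 2 <= 2 * sA ^+ 2 + 2 * sB ^+ 2.
  by rewrite -subr_ge0 (_ : _ - _ = (sA - sB) ^+ 2) ?sqr_ge0//; ring.
move=> /le_trans; apply.
have -> : forall S : R, 2 * n.+1%:R * M * S = 2 * (n.+1%:R * (M * S)) by move=> S; ring.
rewrite -mulrDr ler_wpM2l//.
apply: le_trans (lerD (sqr_sum_le _) (sqr_sum_le _)) _.
rewrite -mulrDr ler_wpM2l// -big_split /= mulr_sumr; apply: ler_sum => l _.
have ln : (l <= n)%N by rewrite -ltnS.
rewrite [leRHS]mulrCA [leRHS]mulrDl; apply: lerD; rewrite exprMn.
  by apply: ler_wpM2l; [exact: sqr_ge0|exact: HA].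
by rewrite exprMn sqrr_sign mul1r; apply: ler_wpM2l; [exact: sqr_ge0|exact: HB].
Qed.

End HermiteBasis.

(** * Estimates on a single sample interval *)

Section IntervalEstimates.
Context {R : realType}.
Implicit Types (U : nat -> R -> R) (nu th a b h s : R).

(** The convexity parameter th distributes the square between U - H and H; it stays free here and is
    fixed only when the derivative term has to be absorbed. *)
Lemma hermite_estimate01 n nu th U : is_wirtinger_cimmino n.+1 nu ->
  0 < th < 1 -> tower U ->
  cint (fun x => U n x ^+ 2) 0 1 <=
  (th * nu ^+ 2)^-1 * cint (fun x => U n.+1 x ^+ 2) 0 1 +
  (1 - th)^-1 * (2 * n.+1%:R * (Cbin n.+1 * mu (2 * n.+1 - 1) ^+ n) *
    \sum_(l < n.+1) (U l 0 ^+ 2 + U l 1 ^+ 2) / ((2 * l + 1)%:R * (l`!)%:R ^+ 2)).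
Proof.
move=> wnu /andP[th0 th1] tU.
have th1' : 0 < 1 - th by rewrite subr_gt0.
have [H [tH H2 H01 HB]] := hermite_tower n (U ^~ 0) (U ^~ 1).
set K := _ * \sum_(l < _) _ in HB *.
have te := towerB tU tH.
have ce : clamped n.+1 (fun j x => U j x - H j x).
  by split=> // l ln; have [-> ->] := H01 l ln; rewrite !subrr.
have W := wirtinger01 wnu ce.
have cU j := tower_continuous j tU; have cH j := tower_continuous j tH.
have cE j := tower_continuous j te; rewrite /= in cE.
have o : cint (fun x => H (n.+1 + 0)%N x * (U n.+1 x - H n.+1 x)) 0 1 = 0.
  apply: (tower_orthogonal (tower_shift n.+1 tH) te).
    by move=> x; rewrite addnn -mul2n.
  by move=> l ln; have [_] := ce; exact.
rewrite addn0 in o.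
have nu0 : 0 < nu by case: wnu.
have proj : cint (fun x => (U n.+1 x - H n.+1 x) ^+ 2) 0 1 <= cint (fun x => U n.+1 x ^+ 2) 0 1.
  have -> : cint (fun x => U n.+1 x ^+ 2) 0 1 =
      cint (fun x => (U n.+1 x - H n.+1 x) ^+ 2 + H n.+1 x ^+ 2) 0 1.
    apply/eqP; rewrite -subr_eq0 -cintB; [|exact: cont_sqr|by apply: contD; exact: cont_sqr].
    rewrite [X in cint X](_ : _ = fun x => 2 * (H n.+1 x * (U n.+1 x - H n.+1 x))).
      by rewrite cintZ ?o ?mulr0//; exact: contM.
    by apply/funext => x; ring.
  rewrite cintD; [|exact: cont_sqr|exact: cont_sqr].
  by rewrite lerDl; exact: cint01_sqr_ge0.
have cK : cint (fun x => H n x ^+ 2) 0 1 <= K.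
  rewrite -[leRHS]mulr1 -[X in K * X]subr0 -cint_cst; apply: le_cint => //.
    exact: cont_sqr.
  exact: cont_cst.
have : cint (fun x => U n x ^+ 2) 0 1 <=
    cint (fun x => th^-1 * (U n x - H n x) ^+ 2 + (1 - th)^-1 * H n x ^+ 2) 0 1.
  apply: le_cint => //; first exact: cont_sqr.
    by apply: contD; apply/contZ/cont_sqr.
  move=> x _; rewrite -subr_ge0.
  have -> : th^-1 * (U n x - H n x) ^+ 2 + (1 - th)^-1 * H n x ^+ 2 - U n x ^+ 2 =
     (th * (1 - th))^-1 * ((1 - th) * (U n x - H n x) - th * H n x) ^+ 2.
    by field; rewrite !gt_eqF.
  by rewrite mulr_ge0 ?sqr_ge0// invr_ge0 mulr_ge0// ltW.
move=> /le_trans; apply; rewrite cintD; [|exact/contZ/cont_sqr|exact/contZ/cont_sqr].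
rewrite !cintZ; [|exact: cont_sqr|exact: cont_sqr].
apply: lerD; last by rewrite ler_wpM2l// invr_ge0 ltW.
rewrite invfM -mulrA ler_wpM2l ?invr_ge0 ?(ltW th0)//.
rewrite -(ler_pM2l (exprn_gt0 2 nu0)) mulrA divff ?mul1r ?gt_eqF ?exprn_gt0//.
exact: le_trans W proj.
Qed.

Lemma cint_sqr_affine (q : R -> R) c a h : 0 < h -> continuous q ->
  cint (fun x => (c * q (a + h * x)) ^+ 2) 0 1 =
  c ^+ 2 / h * cint (fun x => q x ^+ 2) a (a + h).
Proof.
move=> h0 cq; rewrite -cint_affine; last exact: cont_sqr.
rewrite mulrA divfK ?gt_eqF// -cintZ.
  by congr cint; apply/funext => x; rewrite exprMn.
exact: (cont_affine (cont_sqr cq)).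
Qed.

(** Substituting a + h x, each l-th derivative picks up h^l; this is the source of h^(2l+1) in the
    weights and of h^(2n) in the denominator. *)
Lemma hermite_estimate n nu th U a h : is_wirtinger_cimmino n.+1 nu ->
  0 < th < 1 -> 0 < h -> tower U ->
  cint (fun x => U n x ^+ 2) a (a + h) <=
  h ^+ 2 / (th * nu ^+ 2) * cint (fun x => U n.+1 x ^+ 2) a (a + h) +
  (1 - th)^-1 * (2 * n.+1%:R * (Cbin n.+1 * (mu (2 * n.+1 - 1) ^+ n / h ^+ (2 * n))) *
    \sum_(l < n.+1) (U l a ^+ 2 + U l (a + h) ^+ 2) *
      (h ^+ (2 * l + 1) / ((2 * l + 1)%:R * (l`!)%:R ^+ 2))).
Proof.
move=> wnu th01 h0 tU.
have := hermite_estimate01 wnu th01 (tower_affine h a tU).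
have cU j := tower_continuous j tU.
rewrite !cint_sqr_affine// mulr0 mulr1 addr0.
have [th0 th1] := andP th01.
have nu0 : 0 < nu by case: wnu.
have hn0 : h != 0 by rewrite gt_eqF.
have hp : 0 < (h ^+ n) ^+ 2 / h by rewrite divr_gt0// exprn_gt0// exprn_gt0.
move=> H; rewrite -(ler_pM2l hp); apply: le_trans H _.
set I1 := cint _ a (a + h); set C := Cbin _; set m := _ ^+ n; set k := n.+1%:R.
have -> : \sum_(l < n.+1) (U l a ^+ 2 + U l (a + h) ^+ 2) *
      (h ^+ (2 * l + 1) / ((2 * l + 1)%:R * (l`!)%:R ^+ 2)) =
    h * \sum_(l < n.+1) ((h ^+ l * U l a) ^+ 2 + (h ^+ l * U l (a + h)) ^+ 2) /
      ((2 * l + 1)%:R * (l`!)%:R ^+ 2).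
  rewrite mulr_sumr; apply: eq_bigr => l _.
  rewrite exprD expr1 mulnC exprM !exprMn; set d := _ / _; rewrite /d -mulrDr; ring.
set S := \sum_(l < _) _.
rewrite mulnC (exprM h n 2) (exprS h n); set hn := h ^+ n.
have hn0' : hn != 0 by rewrite expf_neq0.
rewrite le_eqVlt; apply/orP; left; apply/eqP.
by field; rewrite hn0' hn0 !gt_eqF// subr_gt0.
Qed.

(** Integration by parts of g^2 against x - (a + h) isolates the value at a, against x - a the value
    at a + h. The remaining 2 g g' is split by Young's inequality with parameter s, later equal to
    sigma. *)
Lemma sample_estimate (g g' : R -> R) a h s : has_derive g g' -> continuous g' ->
  0 < h -> 0 < s ->
  let X := cint (fun x => g x ^+ 2) a (a + h) +
    h * (s * cint (fun x => g x ^+ 2) a (a + h) +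
         s^-1 * cint (fun x => g' x ^+ 2) a (a + h)) in
  h * g a ^+ 2 <= X /\ h * g (a + h) ^+ 2 <= X.
Proof.
move=> dg cg' h0 s0 X; have cg := has_derive_continuous dg.
have cg2 := cont_sqr cg; have cg'2 := cont_sqr cg'.
have cgg : continuous (fun x => 2 * (g x * g' x)) by apply/contZ/contM.
have bound (c : R) : (forall x, a <= x <= a + h -> `|x - c| <= h) ->
    `|cint (fun x => (x - c) * (2 * (g x * g' x))) a (a + h)| <=
    h * (s * cint (fun x => g x ^+ 2) a (a + h) + s^-1 * cint (fun x => g' x ^+ 2) a (a + h)).
  move=> xc; have cc : continuous (fun x : R => x - c).
    exact: has_derive_continuous (has_deriveB (@has_derive_id R) (has_derive_cst c)).
  have cl : continuous (fun x => (x - c) * (2 * (g x * g' x))) by exact: contM.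
  have cr : continuous (fun x => h * (s * g x ^+ 2 + s^-1 * g' x ^+ 2)).
    by apply/contZ/contD; exact: contZ.
  have <- : cint (fun x => h * (s * g x ^+ 2 + s^-1 * g' x ^+ 2)) a (a + h) =
    h * (s * cint (fun x => g x ^+ 2) a (a + h) + s^-1 * cint (fun x => g' x ^+ 2) a (a + h)).
    rewrite cintZ; last by apply: contD; exact: contZ.
    by rewrite cintD; [rewrite !cintZ//|exact: contZ|exact: contZ].
  have ah : a <= a + h by rewrite lerDl ltW.
  have ptw x : a <= x <= a + h ->
      `|(x - c) * (2 * (g x * g' x))| <= h * (s * g x ^+ 2 + s^-1 * g' x ^+ 2).
    move=> /xc xh; rewrite normrM ler_pM// normrM ger0_norm//.
    have : 0 <= s^-1 * (s * `|g x| - `|g' x|) ^+ 2 by rewrite mulr_ge0 ?sqr_ge0// invr_ge0 ltW.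
    rewrite normrM -(real_normK (num_real (g x))) -(real_normK (num_real (g' x))).
    have -> : s^-1 * (s * `|g x| - `|g' x|) ^+ 2 =
      s * `|g x| ^+ 2 + s^-1 * `|g' x| ^+ 2 - 2 * (`|g x| * `|g' x|) by field; rewrite gt_eqF.
    by rewrite subr_ge0.
  rewrite ler_norml; apply/andP; split.
    rewrite -[X in - X]mul1r -mulNr -cintZ//; apply: le_cint => //; first exact: contZ.
    by move=> x /ptw; rewrite ler_norml mulN1r => /andP[].
  apply: le_cint => // x /ptw; rewrite ler_norml => /andP[]//.
have d c : has_derive (fun x : R => x - c) (fun=> 1).
  have := has_deriveB (@has_derive_id R) (has_derive_cst c).
  by apply: has_derive_eq => // x; rewrite subr0.
have parts c := cint_parts a (a + h) (d c) (has_derive_sqr dg) (@cont_cst R 1) cgg.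
have one : cint (fun x => 1 * g x ^+ 2) a (a + h) = cint (fun x => g x ^+ 2) a (a + h).
  by rewrite cintZ// mul1r.
split.
  have E := parts (a + h); rewrite one in E.
  set J := cint (fun x => (x - (a + h)) * _) _ _ in E.
  have {}E : cint (fun x => g x ^+ 2) a (a + h) = h * g a ^+ 2 - J by rewrite E; ring.
  have := bound (a + h); rewrite ler_norml => /(_ _)/andP[|_].
    by move=> x /andP[ax xh]; rewrite ler_norml; lra.
  by rewrite -/J /X; lra.
have E := parts a; rewrite one in E.
set J := cint (fun x => (x - a) * _) _ _ in E.
have {}E : cint (fun x => g x ^+ 2) a (a + h) = h * g (a + h) ^+ 2 - J by rewrite E; ring.
have := bound a; rewrite ler_norml => /(_ _)/andP[|_ B].
  by move=> x /andP[ax xh]; rewrite ler_norml; lra.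
by move: B; rewrite -/J /X; lra.
Qed.

End IntervalEstimates.

(** * Bernstein's inequality from the growth of the derivatives *)

Section SquareIntegrableTowers.
Context {R : realType}.
Implicit Types (U : nat -> R -> R) (q : R -> R) (n : nat -> R) (M a b s C : R).

(** If q exceeded eps on an interval of length (M + 1) / eps, its integral there would exceed M.
    This supplies cut-off points with small boundary terms in place of decay at infinity. *)
Lemma bounded_cint_small q M a eps : continuous q -> (forall x, 0 <= q x) ->
  (forall a b, a <= b -> cint q a b <= M) -> 0 < eps ->
  (exists2 b, a <= b & q b <= eps) /\ (exists2 b, b <= a & q b <= eps).
Proof.
move=> cq q0 qM e0; have M0 : 0 <= M by have := qM 0 0 (lexx _); rewrite cintxx.
set T := (M + 1) / eps; have T0 : 0 < T by rewrite divr_gt0// ltr_wpDl.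
have key c : ~ (forall x, c <= x <= c + T -> eps < q x).
  move=> H; have cT : c <= c + T by rewrite lerDl ltW.
  have : cint (fun=> eps) c (c + T) <= cint q c (c + T).
    by apply: le_cint => //; [exact: cont_cst|move=> x /H/ltW].
  rewrite cint_cst [c + T]addrC addrK /T mulrC divfK ?gt_eqF//.
  by have := qM c _ cT; rewrite [c + T]addrC /T; lra.
split; apply: contrapT => H.
  apply: (key a) => x /andP[ax _]; rewrite ltNge; apply/negP => qx.
  by apply: H; exists x.
apply: (key (a - T)) => x /andP[_ xa]; rewrite ltNge; apply/negP => qx.
by apply: H; exists x => //; rewrite subrK in xa.
Qed.

Lemma bounded_cint_integral q M : continuous q -> (forall x, 0 <= q x) ->
  (forall a b, a <= b -> cint q a b <= M) ->
  (\int[lebesgue_measure]_(x in [set: R]) (q x)%:E <= M%:E)%E.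
Proof.
move=> cq q0 qM.
pose F (i : nat) : set R := `[- i%:R, i%:R]%classic.
have FT : \bigcup_i F i = [set: R].
  apply/seteqP; split => // x _; exists (Num.truncn `|x|).+1 => //=.
  by rewrite /F /= in_itv/= -ler_norml; exact/ltW/truncnS_gt.
have nd : nondecreasing_seq F.
  move=> i j ij; apply/subsetPset => x /=; rewrite /F /= !in_itv/= => /andP[h1 h2].
  have : (i%:R : R) <= j%:R by rewrite ler_nat.
  by move=> hij; apply/andP; split; lra.
have mq i : measurable_fun (F i) (EFin \o q).
  apply/measurable_EFinP; apply: measurable_funS (continuous_measurable_fun cq) => //.
have H : (\int[lebesgue_measure]_(x in F i) (q x)%:E @[i --> \oo] -->
    \int[lebesgue_measure]_(x in \bigcup_i F i) (q x)%:E)%E.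
  apply: ge0_nondecreasing_set_cvg_integral => //; first by move=> i; exact: measurable_itv.
  by move=> i x _; rewrite lee_fin.
rewrite FT in H.
rewrite -(cvg_lim _ H)//; apply: lime_le; first exact: cvgP H.
apply: nearW => i; have i0 : - (i%:R : R) <= i%:R by rewrite ge0_cp.
by rewrite cint_lebesgue// lee_fin qM.
Qed.

Lemma cint_le_integral q a b : continuous q -> (forall x, 0 <= q x) -> a <= b ->
  ((cint q a b)%:E <= \int[lebesgue_measure]_(x in [set: R]) (q x)%:E)%E.
Proof.
move=> cq q0 ab; rewrite -cint_lebesgue//.
apply: ge0_subset_integral => //; last by move=> x _; rewrite lee_fin.
by apply/measurable_EFinP; exact: continuous_measurable_fun.
Qed.

(** A ratio r > s at one index persists at all later ones, so the sequence outgrows C s^j;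
    Bernoulli's inequality for (r / s)^m gives the contradiction. *)
Lemma log_convex_growth n s C : 0 < s -> (forall j, 0 <= n j) ->
  (forall j, n j.+1 ^+ 2 <= n j * n j.+2) -> (forall j, n j <= C * s ^+ j) ->
  forall j, n j.+1 <= s * n j.
Proof.
move=> s0 n0 nc nC j; rewrite leNgt; apply/negP => H.
have [nj0|nj0] := eqVneq (n j) 0.
  have := nc j; rewrite nj0 mul0r => h.
  move: H; rewrite nj0 mulr0 => /(exprn_gt0 2); by rewrite ltNge h.
have njp : 0 < n j by rewrite lt_def nj0 n0.
set r := n j.+1 / n j; have sr : s < r by rewrite ltr_pdivlMr.
have r0 : 0 < r by apply: lt_trans sr.
have grow m : n (j + m)%N > 0 /\ r * n (j + m)%N <= n (j + m).+1.
  elim: m => [|m [IH1 IH2]]; first by rewrite addn0 /r divfK.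
  have p1 : 0 < n (j + m).+1 by apply: lt_le_trans IH2; exact: mulr_gt0.
  rewrite addnS; split => //.
  rewrite -(ler_pM2l IH1); apply: le_trans (nc _).
  by rewrite mulrA [_ * r]mulrC expr2 ler_pM2r.
have lower m : r ^+ m * n j <= n (j + m)%N.
  elim: m => [|m IH]; first by rewrite mul1r addn0.
  rewrite addnS exprS -mulrA; apply: le_trans (grow m).2.
  by rewrite ler_pM2l.
have bnd m : (r / s) ^+ m <= C * s ^+ j / n j.
  rewrite ler_pdivlMr// expr_div_n mulrAC ler_pdivrMr ?exprn_gt0//.
  by rewrite -mulrA -exprD; apply: le_trans (lower m) (nC _).
set K := C * s ^+ j / n j in bnd.
have d0 : 0 < r / s - 1 by rewrite subr_gt0 ltr_pdivlMr ?mul1r.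
have bern m : 1 + m%:R * (r / s - 1) <= (r / s) ^+ m.
  elim: m => [|m IH]; first by rewrite mul0r addr0.
  have rs0 : 0 <= r / s by rewrite divr_ge0// ltW.
  rewrite exprS; apply: le_trans (ler_wpM2l rs0 IH).
  have : 0 <= m%:R * (r / s - 1) ^+ 2 by rewrite mulr_ge0 ?sqr_ge0.
  by rewrite -natr1; lra.
have := le_trans (bern (Num.truncn (K / (r / s - 1))).+1) (bnd _).
have := truncnS_gt (K / (r / s - 1)); rewrite ltr_pdivrMr//; lra.
Qed.

(* The geometric growth of the derivatives in L^2 stands for a Fourier support in
   [- sqrt s / 2 pi, sqrt s / 2 pi]. *)
Definition band_limited s U : Prop := tower U /\
  exists C, forall j a b, a <= b -> cint (fun x => U j x ^+ 2) a b <= C * s ^+ j.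

Definition energy U j : \bar R :=
  (\int[lebesgue_measure]_(x in [set: R]) (U j x ^+ 2)%:E)%E.

Lemma energy_fin s U j : band_limited s U -> energy U j \is a fin_num.
Proof.
move=> [tU [C UC]].
have cU := cont_sqr (tower_continuous j tU).
rewrite ge0_fin_numE; last by apply: integral_ge0 => x _; rewrite lee_fin sqr_ge0.
apply: le_lt_trans (ltry (C * s ^+ j)).
by apply: bounded_cint_integral => //; [move=> x; exact: sqr_ge0|exact: UC].
Qed.

(** Integration by parts and Young's inequality, which is why t is free. The interval is enlarged to
    end points where U_j^2 + U_(j+1)^2 <= e, so that each boundary term is at most e / 2. *)
Lemma energy_log_convex s U j t : band_limited s U -> 0 < t ->
  2 * fine (energy U j.+1) <= t * fine (energy U j) + t^-1 * fine (energy U j.+2).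
Proof.
move=> bU t0; have [tU [C UC]] := bU.
have cU i := tower_continuous i tU; have cU2 i := cont_sqr (cU i).
have en i a b : a <= b -> cint (fun x => U i x ^+ 2) a b <= fine (energy U i).
  move=> ab; rewrite -lee_fin fineK; last exact: energy_fin bU.
  by apply: cint_le_integral => // x; exact: sqr_ge0.
set K := _ + _.
suff : forall a b, a <= b -> cint (fun x => U j.+1 x ^+ 2) a b <= K / 2.
  move=> H; rewrite mulrC -ler_pdivlMr// -lee_fin fineK; last exact: energy_fin bU.
  by apply: bounded_cint_integral => // x; exact: sqr_ge0.
move=> a0 b0 ab0; apply/ler_addgt0Pr => e e0.
pose q x := U j x ^+ 2 + U j.+1 x ^+ 2.
have cq : continuous q by exact: contD.
have qM a b : a <= b -> cint q a b <= C * s ^+ j + C * s ^+ j.+1.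
  by move=> ab; rewrite cintD// lerD// UC.
have q0 x : 0 <= q x by rewrite addr_ge0 ?sqr_ge0.
have [[b bb qb] _] := bounded_cint_small b0 cq q0 qM e0.
have [_ [a aa qa]] := bounded_cint_small a0 cq q0 qM e0.
have ab : a <= b by lra.
have : cint (fun x => U j.+1 x ^+ 2) a0 b0 <= cint (fun x => U j.+1 x ^+ 2) a b.
  rewrite -(cint_cat _ a a0 b) -(cint_cat _ a0 b0 b).
  have g c d : c <= d -> 0 <= cint (fun x => U j.+1 x ^+ 2) c d.
    by move=> cd; apply: cint_ge0 => // x _; exact: sqr_ge0.
  by have := g _ _ aa; have := g _ _ bb; lra.
move=> /le_trans; apply.
have -> : cint (fun x => U j.+1 x ^+ 2) a b = cint (fun x => U j.+1 x * U j.+1 x) a b.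
  by congr cint; apply/funext => x; rewrite expr2.
rewrite (cint_parts _ _ (tU j) (tU j.+1))//.
have H x : q x <= e -> `|U j x * U j.+1 x| <= e / 2.
  rewrite /q => qe; rewrite ler_norml; apply/andP; split.
    by have := sqr_ge0 (U j x + U j.+1 x); rewrite sqrrD; lra.
  by have := sqr_ge0 (U j x - U j.+1 x); rewrite sqrrB; lra.
have := H _ qb; have := H _ qa; rewrite !ler_norml => /andP[Ha1 Ha2] /andP[Hb1 Hb2].
suff : - cint (fun x => U j x * U j.+2 x) a b <= K / 2 by lra.
apply: (@le_trans _ _ (cint (fun x => t / 2 * U j x ^+ 2 + t^-1 / 2 * U j.+2 x ^+ 2) a b)).
  rewrite -[X in X <= _]mulN1r -cintZ; last exact: contM.
  apply: le_cint => //; first by apply/contZ/contM.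
    by apply: contD; exact: contZ.
  move=> x _; rewrite -subr_ge0.
  have -> : t / 2 * U j x ^+ 2 + t^-1 / 2 * U j.+2 x ^+ 2 - -1 * (U j x * U j.+2 x) =
    t^-1 / 2 * (t * U j x + U j.+2 x) ^+ 2 by field; rewrite gt_eqF.
  by rewrite mulr_ge0 ?sqr_ge0// divr_ge0// invr_ge0 ltW.
rewrite cintD; [|exact: contZ|exact: contZ].
rewrite !cintZ//.
have t1 : 0 < t^-1 by rewrite invr_gt0.
have h1 : t * cint (fun x => U j x ^+ 2) a b <= t * fine (energy U j).
  by rewrite ler_pM2l// en.
have h2 : t^-1 * cint (fun x => U j.+2 x ^+ 2) a b <= t^-1 * fine (energy U j.+2).
  by rewrite ler_pM2l// en.
by rewrite /K; lra.
Qed.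

(* A log-convex sequence that is O(s^j) has all its ratios at most s. *)
Lemma energy_bernstein s U j : 0 < s -> band_limited s U ->
  (energy U j.+1 <= s%:E * energy U j)%E.
Proof.
move=> s0 bU; have fin i := energy_fin i bU.
rewrite -(fineK (fin j)) -(fineK (fin j.+1)) -EFinM lee_fin.
have ge0 i : 0 <= fine (energy U i).
  by apply/fine_ge0/integral_ge0 => x _; rewrite lee_fin sqr_ge0.
have [tU [C UC]] := bU.
apply: (@log_convex_growth (fun i => fine (energy U i)) s C s0 ge0) => {j} j /=; last first.
  rewrite -lee_fin fineK//; apply: bounded_cint_integral.
  - exact/cont_sqr/tower_continuous.
  - by move=> x /=; exact: sqr_ge0.
  - by move=> a b; exact: UC.
have lc t := energy_log_convex j bU (t := t).
move: lc (ge0 j) (ge0 j.+1) (ge0 j.+2).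
move: (fine (energy U j)) (fine (energy U j.+1)) (fine (energy U j.+2)) => p q r lc p0 q0 r0.
have [->|qn0] := eqVneq q 0; first by rewrite expr0n/= mulr_ge0.
have qp : 0 < q by rewrite lt_def qn0.
have [p00|pn0] := eqVneq p 0.
  (* For p = 0 this t makes the right-hand side at most q, against 2q on the left: impossible for q
     > 0. *)
  have t0 : 0 < (r + 1) / q by rewrite divr_gt0// ltr_wpDl.
  have := lc _ t0; rewrite p00 mulr0 add0r invf_div.
  have -> : q / (r + 1) * r = q * (r / (r + 1)) by ring.
  have : r / (r + 1) <= 1 by rewrite ler_pdivrMr ?mul1r ?lerDl// ltr_wpDl.
  by move=> /(ler_wpM2l q0); lra.
have pp : 0 < p by rewrite lt_def pn0.
(* The value t = q / p turns the inequality into q^2 <= p r. *)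
have t0 : 0 < q / p by rewrite divr_gt0.
have := lc _ t0; rewrite divfK// invf_div -(ler_pM2l qp).
have -> : q * (q + p / q * r) = q ^+ 2 + p * r by field.
by rewrite expr2; lra.
Qed.

End SquareIntegrableTowers.

(** * Band-limited functions as trigonometric integrals *)

Section RealIntegrability.
Context {R : realType}.
Notation mu := (@lebesgue_measure R).
Implicit Types (D : set (measurableTypeR R)) (f g h : R -> R).

Definition intg (D : set R) f : Prop := mu.-integrable D (EFin \o f).

Lemma intg_measurable D f : intg D f -> measurable_fun D f.
Proof. by move=> /integrableP[/measurable_EFinP]. Qed.

Lemma intgD D f g : measurable D -> intg D f -> intg D g ->
  intg D (fun x => f x + g x).
Proof. by move=> mD If Ig; exact: (integrableD mD If Ig). Qed.

Lemma intgB D f g : measurable D -> intg D f -> intg D g ->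
  intg D (fun x => f x - g x).
Proof. by move=> mD If Ig; exact: (integrableB mD If Ig). Qed.

Lemma intgZ D (c : R) f : measurable D -> intg D f ->
  intg D (fun x => c * f x).
Proof. by move=> mD If; exact: (integrableZl mD c If). Qed.

Lemma le_intg D f g : measurable D -> measurable_fun D f ->
  (forall x, D x -> `|f x| <= g x) -> intg D g -> intg D f.
Proof.
move=> mD mf fg; apply: le_integrable => //; first exact/measurable_EFinP.
move=> x Dx; rewrite lee_fin /=; apply: le_trans (fg x Dx) _.
by rewrite /= ler_norm.
Qed.

Lemma intg_eq D f g : measurable D -> (forall x, D x -> f x = g x) -> intg D f -> intg D g.
Proof. by move=> mD fg; apply: eq_integrable => // x /set_mem Dx; rewrite /= fg. Qed.

Lemma intg_norm D f : intg D f -> intg D (fun x => `|f x|).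
Proof. by move=> If; exact: integrable_norm. Qed.

Lemma intg_sum D n (f : 'I_n -> R -> R) : measurable D ->
  (forall i, intg D (f i)) ->
  intg D (fun x => \sum_i f i x) /\
  (\int[mu]_(x in D) (\sum_i f i x))%R = \sum_i (\int[mu]_(x in D) f i x)%R.
Proof.
move=> mD; elim: n f => [|n IH] f If.
  have e : (fun x : R => \sum_(i < 0) f i x) = (fun=> 0).
    by apply/funext => x; rewrite big_ord0.
  rewrite e big_ord0; split; first exact: integrable0.
  by rewrite Rintegral_cst// mul0r.
have [IH1 IH2] := IH _ (fun i => If (widen_ord (leqnSn n) i)).
have e : (fun x : R => \sum_(i < n.+1) f i x) =
    (fun x => \sum_(i < n) f (widen_ord (leqnSn n) i) x + f ord_max x).
  by apply/funext => x; rewrite big_ord_recr.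
split; first by rewrite e; exact: intgD.
rewrite big_ord_recr /= -IH2 -RintegralD//; last exact: If.
by congr (Rintegral _ _ _); exact: e.
Qed.

Lemma measurable_itvcc (a b : R) : measurable (`[a, b]%classic : set (measurableTypeR R)).
Proof. exact: measurable_itv. Qed.

Lemma intg_continuous (a b : R) f : continuous f -> intg `[a, b]%classic f.
Proof.
move=> cf; apply: continuous_compact_integrable; first exact: segment_compact.
exact: continuous_subspaceT.
Qed.

Lemma Rintegral_cint (a b : R) f : continuous f -> a <= b ->
  (\int[mu]_(x in `[a, b]) f x)%R = cint f a b.
Proof. by move=> cf ab; rewrite /Rintegral cint_lebesgue. Qed.

Lemma cont_measurable D f : measurable D -> continuous f -> measurable_fun D f.
Proof.
by move=> mD cf; apply: measurable_funS (continuous_measurable_fun cf).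
Qed.

End RealIntegrability.

Lemma trig_norm_le (R : realType) (p q t : R) :
  `|p * cos t + q * sin t| <= `|p| + `|q|.
Proof.
apply: le_trans (ler_normD _ _) _; rewrite !normrM.
have c1 : `|cos t| <= 1 by rewrite ler_norml cos_geN1 cos_le1.
have s1 : `|sin t| <= 1 by rewrite ler_norml sin_geN1 sin_le1.
by apply: lerD; rewrite -[leRHS]mulr1 ler_wpM2l.
Qed.

Lemma sin_mulrn_pi (R : realType) n : sin (pi *+ n) = 0 :> R.
Proof. by elim: n => [|n IH]; rewrite ?sin0// mulrSr sinDpi IH oppr0. Qed.

(** * Inverse transforms of square integrable spectra on [-B, B] *)

Section TrigTransform.
Context {R : realType}.
Notation mu := (@lebesgue_measure R).
Variable B : R.
Hypothesis B0 : 0 < B.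
Let D : set (measurableTypeR R) := `[- B, B]%classic.
Let mD : measurable D := measurable_itvcc (- B) B.
Implicit Types (h k f g phi : R -> R) (x w : R).

Definition sqintg h : Prop := measurable_fun D h /\ intg D (fun w => h w ^+ 2).

Lemma sqintgM h phi : sqintg h -> continuous phi -> intg D (fun w => h w * phi w).
Proof.
move=> [mh h2] cphi.
have cphi2 := cont_sqr cphi.
apply: (@le_intg _ D _ (fun w => h w ^+ 2 + phi w ^+ 2)) => //.
- by apply: measurable_funM => //; exact: cont_measurable.
- move=> w _; rewrite ler_norml; apply/andP; split.
    by have := sqr_ge0 (h w + phi w); have := sqr_ge0 (h w); have := sqr_ge0 (phi w); rewrite sqrrD; lra.
  by have := sqr_ge0 (h w - phi w); have := sqr_ge0 (h w); have := sqr_ge0 (phi w); rewrite sqrrB; lra.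
- by apply: intgD => //; exact: intg_continuous.
Qed.

Lemma sqintg_intg h : sqintg h -> intg D h.
Proof.
move=> sh; apply: (intg_eq mD) (sqintgM sh (@cont_cst R 1)) => w _.
by rewrite mulr1.
Qed.

Definition tw (x w : R) : R := 2 * pi * w * x.

Lemma cont_cosw x : continuous (fun w : R => cos (tw x w)).
Proof.
have -> : (fun w => cos (tw x w)) = (fun w => cos (0 + 2 * pi * x * w)).
  by apply/funext => w; rewrite /tw add0r; congr cos; ring.
exact: has_derive_continuous (has_derive_affine (2 * pi * x) 0 (@has_derive_cos R)).
Qed.

Lemma cont_sinw x : continuous (fun w : R => sin (tw x w)).
Proof.
have -> : (fun w => sin (tw x w)) = (fun w => sin (0 + 2 * pi * x * w)).
  by apply/funext => w; rewrite /tw add0r; congr sin; ring.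
exact: has_derive_continuous (has_derive_affine (2 * pi * x) 0 (@has_derive_sin R)).
Qed.

(** The real part of int (h - i k)(w) e^(2 pi i w x) dw over the band. *)
Definition trig h k x : R :=
  (\int[mu]_(w in D) (h w * cos (tw x w) + k w * sin (tw x w)))%R.

Lemma intg_trig h k x : sqintg h -> sqintg k ->
  intg D (fun w => h w * cos (tw x w) + k w * sin (tw x w)).
Proof.
by move=> sh sk; apply: intgD => //; apply: sqintgM => //;
  [exact: cont_cosw|exact: cont_sinw].
Qed.

Definition freqM h w : R := 2 * pi * w * h w.

Lemma freqM_sqr_le h w : D w -> freqM h w ^+ 2 <= (2 * pi * B) ^+ 2 * h w ^+ 2.
Proof.
rewrite /D /= in_itv/= -ler_norml => wB; rewrite /freqM exprMn ler_wpM2r ?sqr_ge0//.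
rewrite -(real_normK (num_real (2 * pi * w))) lerXn2r ?nnegrE//.
  by rewrite mulr_ge0 ?(ltW B0)// mulr_ge0// pi_ge0.
by rewrite normrM [`|2 * pi|]ger0_norm ?ler_wpM2l// mulr_ge0// pi_ge0.
Qed.

Lemma sqintg_freqM h : sqintg h -> sqintg (freqM h).
Proof.
move=> [mh h2].
have mf : measurable_fun D (freqM h).
  by apply: measurable_funM => //; apply: cont_measurable.
split => //; apply: (@le_intg _ D _ (fun w => (2 * pi * B) ^+ 2 * h w ^+ 2)) => //.
- exact: measurable_funX.
- by move=> w Dw; rewrite ger0_norm ?sqr_ge0// freqM_sqr_le.
- exact: intgZ.
Qed.

Lemma sqintgN h : sqintg h -> sqintg (fun w => - h w).
Proof.
move=> [mh h2]; split; first exact: measurableT_comp.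
by apply: (intg_eq mD) h2 => w _; rewrite sqrrN.
Qed.

(** Differentiation under the integral; the majorant |freqM k| + |freqM h| is integrable because the
    band is bounded. *)
Lemma trig_derive h k : sqintg h -> sqintg k ->
  has_derive (trig h k) (trig (freqM k) (fun w => - freqM h w)).
Proof.
move=> sh sk x.
have sfh := sqintg_freqM sh; have sfk := sqintg_freqM sk.
pose f x w := h w * cos (tw x w) + k w * sin (tw x w).
have df w : has_derive (f ^~ w) (fun x => freqM k w * cos (tw x w) + - freqM h w * sin (tw x w)).
  have dc := has_derive_affine (2 * pi * w) 0 (@has_derive_cos R).
  have ds := has_derive_affine (2 * pi * w) 0 (@has_derive_sin R).
  have := has_deriveD (has_deriveZ (h w) dc) (has_deriveZ (k w) ds).
  by apply: has_derive_eq => y; rewrite /f /freqM /tw add0r //; ring.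
pose G (w : R) : R := `|freqM k w| + `|freqM h w|.
have IG : intg D G.
  by apply: intgD => //; apply: intg_norm; exact: sqintg_intg.
have xI : (`]x - 1, x + 1[%classic : set R) x by rewrite /= in_itv/=; apply/andP; split; lra.
have If (y : R) : (`]x - 1, x + 1[%classic : set R) y -> mu.-integrable D (EFin \o f y).
  by move=> _; exact: intg_trig.
have dfy (y w : R) : (`]x - 1, x + 1[%classic : set R) y -> D w -> derivable (f ^~ w) y 1.
  by move=> _ _; exact: has_derive_derivable (df w).
have G0 w : 0 <= G w by rewrite addr_ge0.
have p1 (y w : R) : partial1of2 f y w = freqM k w * cos (tw y w) + - freqM h w * sin (tw y w).
  by rewrite /partial1of2 (has_derive_derive1 (df w)).
have Gub (y w : R) : (`]x - 1, x + 1[%classic : set R) y -> D w -> `|partial1of2 f y w| <= G w.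
  move=> _ _; rewrite p1 /G; apply: le_trans (trig_norm_le _ _ _) _.
  by rewrite normrN.
have d := derivable_under_integral mD xI If dfy G0 IG Gub.
have e := differentiation_under_integral mD xI If dfy G0 IG Gub.
apply: DeriveDef => //; rewrite -derive1E e /trig.
by apply: eq_Rintegral => w _; rewrite p1.
Qed.

Fixpoint trig_coeff h k (j : nat) : (R -> R) * (R -> R) :=
  if j is j'.+1 then
    let: (h', k') := trig_coeff h k j' in (freqM k', fun w => - freqM h' w)
  else (h, k).

Definition trig_tower h k j x : R :=
  trig (trig_coeff h k j).1 (trig_coeff h k j).2 x.

Lemma sqintg_trig_coeff h k j : sqintg h -> sqintg k ->
  sqintg (trig_coeff h k j).1 /\ sqintg (trig_coeff h k j).2.
Proof.
move=> sh sk; elim: j => [//|j] /=; case: (trig_coeff h k j) => h' k' /= [sh' sk'].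
by split; [exact: sqintg_freqM|apply: sqintgN; exact: sqintg_freqM].
Qed.

Lemma trig_tower_tower h k : sqintg h -> sqintg k -> tower (trig_tower h k).
Proof.
move=> sh sk j; have := sqintg_trig_coeff j sh sk; rewrite /trig_tower /=.
by case: (trig_coeff h k j) => h' k' /= [sh' sk']; exact: trig_derive.
Qed.

Definition sqnorm2 h k : R := (\int[mu]_(w in D) (h w ^+ 2 + k w ^+ 2))%R.

Lemma intg_sqnorm2 h k : sqintg h -> sqintg k -> intg D (fun w => h w ^+ 2 + k w ^+ 2).
Proof. by move=> [_ h2] [_ k2]; exact: intgD. Qed.

Lemma sqnorm2_trig_coeff h k j : sqintg h -> sqintg k ->
  sqnorm2 (trig_coeff h k j).1 (trig_coeff h k j).2 <=
  sqnorm2 h k * ((2 * pi * B) ^+ 2) ^+ j.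
Proof.
move=> sh sk; elim: j => [|j IH]; first by rewrite mulr1.
have := sqintg_trig_coeff j sh sk; move: IH; rewrite /=.
case: (trig_coeff h k j) => h' k' /= IH [sh' sk'].
rewrite exprSr mulrA mulrC; apply: le_trans (ler_wpM2l _ IH); last exact: sqr_ge0.
rewrite /sqnorm2 -RintegralZl//; last exact: intg_sqnorm2.
apply: le_Rintegral => //.
- apply: intg_sqnorm2; first exact: sqintg_freqM.
  by apply: sqintgN; exact: sqintg_freqM.
- by apply: intgZ => //; exact: intg_sqnorm2.
- by move=> w Dw; rewrite sqrrN mulrDr addrC lerD// freqM_sqr_le.
Qed.

(* Bessel's inequality for the system w |-> (cos 2 pi w x_n, sin 2 pi w x_n),
   orthogonal in L^2([-B, B]; R^2) because the points are spaced by 1/(2B). *)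
Lemma trig_bessel h k x0 M : sqintg h -> sqintg k ->
  \sum_(n < M) trig h k (x0 + n%:R / (2 * B)) ^+ 2 <= 2 * B * sqnorm2 h k.
Proof.
move=> sh sk.
have Bn0 : B != 0 by rewrite gt_eqF.
have NB : - B <= B by apply/ltW/gtrN.
pose p (n : 'I_M) := x0 + n%:R / (2 * B); pose c n := trig h k (p n).
(* Each vector (cos, sin) has squared norm 2B, so b (u, v) is the orthogonal projection of (h, k),
   and Bessel's inequality is the nonnegativity of the squared distance to it. *)
pose b := (2 * B)^-1.
pose u w := \sum_(n < M) c n * cos (tw (p n) w).
pose v w := \sum_(n < M) c n * sin (tw (p n) w).
have cu : continuous u by apply: cont_sum => n; apply: contZ; exact: cont_cosw.
have cv : continuous v by apply: cont_sum => n; apply: contZ; exact: cont_sinw.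
set S := \sum_(n < M) _.
have cross : intg D (fun w => h w * u w + k w * v w) /\
    (\int[mu]_(w in D) (h w * u w + k w * v w))%R = S.
  have [I1 I2] := intg_sum mD (fun n => intgZ (c n) mD (intg_trig (p n) sh sk)).
  have e : (fun w => \sum_i c i * (h w * cos (tw (p i) w) + k w * sin (tw (p i) w))) =
      (fun w => h w * u w + k w * v w).
    apply/funext => w; rewrite /u /v !mulr_sumr -big_split; apply: eq_bigr => i _ /=.
    by ring.
  rewrite e in I1 I2; split=> //; rewrite I2; apply: eq_bigr => n _.
  by rewrite RintegralZl//; exact: intg_trig.
have gram : cint (fun w => u w ^+ 2 + v w ^+ 2) (- B) B = 2 * B * S.
  have e : (fun w => u w ^+ 2 + v w ^+ 2) =
      (fun w => \sum_(n < M) c n * \sum_(m < M) c m * cos (tw (p n - p m) w)).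
    apply/funext => w; rewrite !expr2 /u /v !mulr_suml -big_split; apply: eq_bigr => n _ /=.
    rewrite -!mulrA -mulrDr; congr (_ * _); rewrite !mulr_sumr -big_split; apply: eq_bigr => m _ /=.
    have -> : tw (p n - p m) w = tw (p n) w - tw (p m) w by rewrite /tw; ring.
    by rewrite cosB; ring.
  pose s n m := if n == m :> 'I_M then (fun w : R => w) else
    (fun w : R => (2 * pi * (p n - p m))^-1 * sin (tw (p n - p m) w)).
  have ds n m : has_derive (s n m) (fun w => cos (tw (p n - p m) w)).
    rewrite /s; case: eqVneq => [->|nm].
      have := @has_derive_id R; apply: has_derive_eq => // w.
      by rewrite subrr /tw mulr0 cos0.
    have pn0 : p n - p m != 0.
      rewrite /p opprD addrACA subrr add0r -mulrBl mulf_neq0//.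
        by rewrite subr_eq0 eqr_nat; exact: nm.
      by rewrite invr_eq0 mulf_neq0.
    have pin0 : pi != 0 :> R by rewrite gt_eqF// pi_gt0.
    have := has_deriveZ (2 * pi * (p n - p m))^-1
      (has_derive_affine (2 * pi * (p n - p m)) 0 (@has_derive_sin R)).
    apply: has_derive_eq => w; rewrite add0r /tw.
      by congr (_ * sin _); ring.
    by rewrite mulrA mulVf ?mul1r ?mulf_neq0//; congr cos; ring.
  have ints n m : s n m B - s n m (- B) = 2 * B * (n == m)%:R.
    rewrite /s; case: eqVneq => [_|nm]; first by rewrite mulr1; ring.
    (* Since p n - p m = (n - m) / (2B), the argument is pi (n - m). *)
    have z : sin (tw (p n - p m) B) = 0.
      rewrite /tw /p (_ : _ * _ = pi *+ n - pi *+ m).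
        by rewrite sinB !sin_mulrn_pi mul0r mulr0 subrr.
      by rewrite -[pi *+ n]mulr_natl -[pi *+ m]mulr_natl; field.
    have z' : sin (tw (p n - p m) (- B)) = 0.
      by rewrite (_ : tw _ _ = - tw (p n - p m) B) ?sinN ?z ?oppr0// /tw; ring.
    by rewrite z z' !mulr0 subrr.
  rewrite e.
  have dd := has_derive_sum (fun n => has_deriveZ (c n) (has_derive_sum (fun m => has_deriveZ (c m) (ds n m)))).
  rewrite (cintE _ _ dd) -sumrB /S mulr_sumr; apply: eq_bigr => n _.
  rewrite -mulrBr -sumrB (bigD1 n)//= -mulrBr ints eqxx big1 ?addr0.
    by rewrite /c /p mulr1; ring.
  by move=> m mn; rewrite -mulrBr ints eq_sym (negbTE mn) !mulr0.
have : 0 <= (\int[mu]_(w in D) ((h w ^+ 2 + k w ^+ 2) - 2 * b * (h w * u w + k w * v w) + b ^+ 2 * (u w ^+ 2 + v w ^+ 2)))%R.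
  apply: Rintegral_ge0 => w _.
  rewrite (_ : _ + _ = (h w - b * u w) ^+ 2 + (k w - b * v w) ^+ 2); last by ring.
  by rewrite addr_ge0 ?sqr_ge0.
have [Ic Ec] := cross.
have Ih := intg_sqnorm2 sh sk.
have cuv : continuous (fun w => u w ^+ 2 + v w ^+ 2) by apply: contD; exact: cont_sqr.
have Iuv : intg D (fun w => u w ^+ 2 + v w ^+ 2) by exact: intg_continuous.
rewrite RintegralD//; [|by apply: intgB => //; exact: intgZ|exact: intgZ].
rewrite RintegralB//; [|exact: intgZ].
rewrite RintegralZl// Ec RintegralZl// (Rintegral_cint cuv NB) gram -/(sqnorm2 h k).
have -> : sqnorm2 h k - 2 * b * S + b ^+ 2 * (2 * B * S) = sqnorm2 h k - (2 * B)^-1 * S.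
  by rewrite /b; field.
by rewrite subr_ge0 ler_pdivrMl// mulr_gt0.
Qed.

(* The integral is the mean over s in [0, 1/(2B)] of 1/(2B) times the sum of the
   integrand over a grid of step 1/(2B) shifted by s; the mean value theorem
   selects a shift for which Bessel's inequality applies. *)
Lemma trig_energy h k a b : sqintg h -> sqintg k -> a <= b ->
  cint (fun x => trig h k x ^+ 2) a b <= sqnorm2 h k.
Proof.
move=> sh sk ab; have cF := cont_sqr (has_derive_continuous (trig_derive sh sk)).
pose P := cint (fun x => trig h k x ^+ 2) a.
have dP : has_derive P (fun x => trig h k x ^+ 2) by exact: cint_derive.
have B2 : 0 < 2 * B by rewrite mulr_gt0.
pose M := (Num.truncn ((b - a) * (2 * B))).+1.
have Mb : b <= a + M%:R / (2 * B).
  by rewrite -lerBlDl ler_pdivlMr//; apply/ltW; rewrite /M truncnS_gt.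
apply: (@le_trans _ _ (P (a + M%:R / (2 * B)))).
  rewrite /P -(cint_cat _ a b (a + _)) lerDl; apply: cint_ge0 => // x _; exact: sqr_ge0.
(* The increment of [Phi] over [0, 1/(2B)] telescopes to the integral over M grid cells, while its
   derivative is the sum over the shifted grid. *)
pose Phi s := \sum_(n < M) P (a + n%:R / (2 * B) + 1 * s).
have dPhi : has_derive Phi (fun s => \sum_(n < M) 1 * trig h k (a + n%:R / (2 * B) + 1 * s) ^+ 2).
  by apply: has_derive_sum => n; exact: has_derive_affine dP.
have b0 : 0 <= (2 * B)^-1 by rewrite invr_ge0 ltW.
have [s _] := MVT_segment b0 (fun y _ => dPhi y) (continuous_subspaceT (has_derive_continuous dPhi)).
have -> : Phi (2 * B)^-1 - Phi 0 = P (a + M%:R / (2 * B)).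
  rewrite /Phi -sumrB.
  rewrite (eq_bigr (fun n : 'I_M => P (a + n.+1%:R / (2 * B)) - P (a + n%:R / (2 * B)))); last first.
    move=> n _; rewrite mulr0 addr0; congr (P _ - _).
    by rewrite -[n.+1%:R]natr1; field; rewrite gt_eqF.
  rewrite -(big_mkord xpredT (fun n => P (a + n.+1%:R / (2 * B)) - P (a + n%:R / (2 * B)))).
  rewrite telescope_sumr// mul0r addr0 [P a](_ : _ = 0) ?subr0//.
  exact: cintxx.
move=> ->; rewrite subr0 ler_pdivrMr//.
rewrite (eq_bigr (fun n : 'I_M => trig h k (a + s + n%:R / (2 * B)) ^+ 2)).
  rewrite [leRHS](_ : _ = 2 * B * sqnorm2 h k); first exact: trig_bessel.
  by ring.
by move=> n _; rewrite !mul1r addrAC.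
Qed.

Lemma trig_band_limited h k : sqintg h -> sqintg k ->
  band_limited ((2 * pi * B) ^+ 2) (trig_tower h k).
Proof.
move=> sh sk; split; first exact: trig_tower_tower.
exists (sqnorm2 h k) => j a b ab.
have [sh' sk'] := sqintg_trig_coeff j sh sk.
exact: le_trans (trig_energy sh' sk' ab) (sqnorm2_trig_coeff j sh sk).
Qed.

End TrigTransform.

(** * Fejer kernels *)

Section IntegralsOnTheLine.
Context {R : realType}.
Notation mu := (@lebesgue_measure R).
Implicit Types (q f g : R -> R) (a b c M : R).

Lemma cint_eq f g a b : continuous f -> continuous g -> a <= b ->
  (forall x, a <= x <= b -> f x = g x) -> cint f a b = cint g a b.
Proof.
by move=> cf cg ab fg; apply/eqP; rewrite eq_le !le_cint// => x xab; rewrite fg.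
Qed.

Lemma measurable_setR : measurable ([set: R] : set (measurableTypeR R)).
Proof. exact: measurableT. Qed.

Lemma intg_bounded_cint q M : continuous q -> (forall x, 0 <= q x) ->
  (forall a b, a <= b -> cint q a b <= M) -> intg [set: R] q.
Proof.
move=> cq q0 qM; apply/integrableP; split.
  by apply/measurable_EFinP; exact: continuous_measurable_fun.
apply: le_lt_trans (ltry M).
apply: le_trans (bounded_cint_integral cq q0 qM).
rewrite le_eqVlt; apply/orP; left; apply/eqP; apply: eq_integral => x _.
by rewrite /= ger0_norm.
Qed.

Lemma cint_le_Rintegral q a b : continuous q -> (forall x, 0 <= q x) ->
  intg [set: R] q -> a <= b -> cint q a b <= (\int[mu]_x q x)%R.
Proof.
move=> cq q0 Iq ab; rewrite -lee_fin /Rintegral fineK.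
  exact: cint_le_integral.
exact: (integrable_fin_num measurable_setR Iq).
Qed.

Lemma Rintegral_le_bounded q M : continuous q -> (forall x, 0 <= q x) ->
  intg [set: R] q -> (forall a b, a <= b -> cint q a b <= M) ->
  (\int[mu]_x q x)%R <= M.
Proof.
move=> cq q0 Iq qM; rewrite -lee_fin /Rintegral fineK.
  exact: bounded_cint_integral.
exact: (integrable_fin_num measurable_setR Iq).
Qed.

(** The integral of a nonnegative continuous function over the line is controlled by those over
    compact intervals, where the substitution is the chain rule for an antiderivative. *)
Lemma intg_affine q c p : 0 < c -> continuous q -> (forall x, 0 <= q x) ->
  intg [set: R] q ->
  intg [set: R] (fun x => c * q (c * (x - p))) /\
  (\int[mu]_x (c * q (c * (x - p))))%R = (\int[mu]_x q x)%R.
Proof.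
move=> c0 cq q0 Iq; have cn0 : c != 0 by rewrite gt_eqF.
have e (x : R) : c * (x - p) = - (c * p) + c * x by ring.
have cq' : continuous (fun x => c * q (c * (x - p))).
  apply: contZ; rewrite (_ : (fun x => _) = (fun x => q (- (c * p) + c * x))).
    exact: cont_affine.
  by apply/funext => x; rewrite e.
have q'0 x : 0 <= c * q (c * (x - p)) by rewrite mulr_ge0// ltW.
have [P dP] := continuous_has_antiderivative cq.
have dP' : has_derive (fun x => P (c * (x - p))) (fun x => c * q (c * (x - p))).
  by have := has_derive_affine c (- (c * p)) dP; apply: has_derive_eq => x; rewrite e.
have ce a b : cint (fun x => c * q (c * (x - p))) a b = cint q (c * (a - p)) (c * (b - p)).
  by rewrite (cintE _ _ dP) (cintE _ _ dP').
have le1 a b : a <= b -> cint (fun x => c * q (c * (x - p))) a b <= (\int[mu]_x q x)%R.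
  by move=> ab; rewrite ce; apply: cint_le_Rintegral => //; rewrite ler_pM2l// lerD2r.
have I' := intg_bounded_cint cq' q'0 le1.
split=> //; apply/eqP; rewrite eq_le; apply/andP; split.
  exact: Rintegral_le_bounded.
apply: Rintegral_le_bounded => // a b ab.
have := @cint_le_Rintegral _ (p + a / c) (p + b / c) cq' q'0 I'.
rewrite ce [p + _]addrC addrK [p + _]addrC addrK mulrCA divff// mulr1.
rewrite mulrCA divff// mulr1; apply.
by rewrite lerD2r ler_pM2r ?invr_gt0.
Qed.

Lemma intg_cauchy p : intg [set: R] (fun x => (1 + (x - p) ^+ 2)^-1).
Proof.
have c1 : continuous (fun x : R => (1 + x ^+ 2)^-1) by exact: continuous_oneDsqrV.
have cq : continuous (fun x : R => (1 + (x - p) ^+ 2)^-1).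
  have -> : (fun x : R => (1 + (x - p) ^+ 2)^-1) = (fun x => (1 + (- p + 1 * x) ^+ 2)^-1).
    by apply/funext => x; rewrite mul1r [- p + x]addrC.
  exact: (cont_affine c1).
apply: (@intg_bounded_cint _ pi) => //.
  by move=> x; rewrite invr_ge0 addr_ge0 ?sqr_ge0.
move=> a b ab.
have d : has_derive (fun x => atan (x - p)) (fun x => (1 + (x - p) ^+ 2)^-1).
  have := has_derive_affine 1 (- p) (fun x : R => is_derive1_atan x).
  by apply: has_derive_eq => x; rewrite !mul1r [- p + x]addrC.
rewrite (cintE _ _ d).
have := atan_ltpi2 (b - p); have := atan_gtNpi2 (a - p).
lra.
Qed.

(** Stands in for Cauchy-Schwarz: if the integral of f^2 is at most e^2, its term contributes at
    most e. *)
Lemma Rintegral_young (D : set (measurableTypeR R)) f g e : measurable D ->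
  measurable_fun D f -> measurable_fun D g -> 0 < e ->
  intg D (fun x => f x ^+ 2) -> intg D (fun x => g x ^+ 2) ->
  intg D (fun x => f x * g x) /\
  `|(\int[mu]_(x in D) (f x * g x))%R| <=
    e^-1 * (\int[mu]_(x in D) (f x ^+ 2))%R + e * (\int[mu]_(x in D) (g x ^+ 2))%R.
Proof.
move=> mD mf mg e0 If Ig.
have e1 : 0 < e^-1 by rewrite invr_gt0.
have IS : intg D (fun x => e^-1 * f x ^+ 2 + e * g x ^+ 2).
  by apply: intgD => //; exact: intgZ.
have fg x : `|f x * g x| <= e^-1 * f x ^+ 2 + e * g x ^+ 2.
  have h1 : 0 <= e^-1 * f x ^+ 2 by rewrite mulr_ge0 ?sqr_ge0// ltW.
  have h2 : 0 <= e * g x ^+ 2 by rewrite mulr_ge0 ?sqr_ge0// ltW.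
  have p1 : 0 <= e^-1 * (f x - e * g x) ^+ 2 by rewrite mulr_ge0 ?sqr_ge0// ltW.
  have p2 : 0 <= e^-1 * (f x + e * g x) ^+ 2 by rewrite mulr_ge0 ?sqr_ge0// ltW.
  have E1 : e^-1 * (f x - e * g x) ^+ 2 = e^-1 * f x ^+ 2 + e * g x ^+ 2 - 2 * (f x * g x).
    by field; rewrite gt_eqF.
  have E2 : e^-1 * (f x + e * g x) ^+ 2 = e^-1 * f x ^+ 2 + e * g x ^+ 2 + 2 * (f x * g x).
    by field; rewrite gt_eqF.
  by rewrite ler_norml; apply/andP; split; lra.
have Ifg : intg D (fun x => f x * g x).
  apply: le_intg IS => //; exact: measurable_funM.
split=> //; apply: le_trans (le_normr_Rintegral mD Ifg) _.
rewrite -!RintegralZl// -RintegralD//; [|exact: intgZ|exact: intgZ].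
by apply: le_Rintegral => //; exact: intg_norm.
Qed.

End IntegralsOnTheLine.

(** * The Fejer kernel as the transform of a triangle *)

Section FejerKernel.
Context {R : realType}.
Notation mu := (@lebesgue_measure R).
Implicit Types (N y w : R).

(** Negative outside [-N, N]: it is integrated over that interval or replaced by its positive
    part. *)
Definition triangle N w : R := 1 - N^-1 * `|w|.

(** For N > 0 and y nonzero this equals N (sin(pi N y) / (pi N y))^2; the peak at 0 is N. *)
Definition fejer N y : R := trig N (triangle N) (fun=> 0) y.

Lemma cont_triangle N : continuous (triangle N).
Proof.
apply: contB; first exact: cont_cst.
by apply: contZ; exact: norm_continuous.
Qed.

Lemma sqintg_cont N f : continuous f -> sqintg N f.
Proof.
move=> cf; split; first by apply: cont_measurable => //; exact: measurable_itvcc.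
by apply: intg_continuous; exact: cont_sqr.
Qed.

Lemma triangle_le1 N w : 0 < N -> - N <= w <= N -> 0 <= triangle N w <= 1.
Proof.
move=> N0; rewrite -ler_norml => wN; rewrite /triangle subr_ge0 ler_pdivrMl// mulr1 wN/=.
by rewrite gerBl mulr_ge0// invr_ge0 ltW.
Qed.

Lemma fejer_cont N : 0 < N -> continuous (fejer N).
Proof.
move=> N0; apply: (has_derive_continuous (trig_derive N0 _ _)); apply: sqintg_cont.
  exact: cont_triangle.
exact: cont_cst.
Qed.

Lemma fejer_cint N y : 0 < N ->
  fejer N y = cint (fun w => triangle N w * cos (tw y w)) (- N) N.
Proof.
move=> N0; rewrite -Rintegral_cint; last 2 first.
- by apply: contM; [exact: cont_triangle|exact: cont_cosw].
- by apply/ltW/gtrN.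
by apply: eq_Rintegral => w _; rewrite mul0r addr0.
Qed.

Let cont_tri_l N y (s : R -> R) : continuous (fun w => s (tw y w)) ->
  continuous (fun w => (1 + N^-1 * w) * s (tw y w)).
Proof.
move=> cs; apply: contM => //; apply: contD; first exact: cont_cst.
exact: (has_derive_continuous (has_deriveZ _ (@has_derive_id R))).
Qed.

(** The right half is written with slope (- N)^-1 so that a single antiderivative, with parameter M
    = N or M = - N, serves both halves. *)
Let cint_triangle N y (s : R -> R) : 0 < N -> continuous (fun w => s (tw y w)) ->
  cint (fun w => triangle N w * s (tw y w)) (- N) N =
  cint (fun w => (1 + N^-1 * w) * s (tw y w)) (- N) 0 +
  cint (fun w => (1 + (- N)^-1 * w) * s (tw y w)) 0 N.
Proof.
move=> N0 cs; have cT : continuous (fun w => triangle N w * s (tw y w)).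
  by apply: contM => //; exact: cont_triangle.
rewrite -(cint_cat _ (- N) 0 N); congr (_ + _).
  apply: cint_eq => //; [exact: cont_tri_l|by rewrite lerNl oppr0 ltW|].
  by move=> w /andP[_ w0]; rewrite /triangle ler0_norm// mulrN opprK.
apply: cint_eq => //; [exact: cont_tri_l|exact: ltW|].
by move=> w /andP[w0 _]; rewrite /triangle ger0_norm// invrN mulNr.
Qed.

Lemma tw_derive y : has_derive (fun w => tw y w) (fun=> 2 * pi * y).
Proof.
have := has_deriveZ (2 * pi * y) (@has_derive_id R).
by apply: has_derive_eq => w; rewrite /tw; ring.
Qed.

Let pin0 : pi != 0 :> R. Proof. by rewrite gt_eqF// pi_gt0. Qed.

Let tri_cos_anti (M y : R) : M != 0 -> y != 0 ->
  has_derive (fun w => (1 + M^-1 * w) * sin (tw y w) / (2 * pi * y) +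
     cos (tw y w) / (M * (2 * pi * y) ^+ 2))
    (fun w => (1 + M^-1 * w) * cos (tw y w)).
Proof.
move=> M0 y0; have th0 : 2 * pi * y != 0 by rewrite !mulf_neq0.
have dl := has_deriveD (has_derive_cst 1) (has_deriveZ M^-1 (@has_derive_id R)).
have ds := has_derive_comp (@has_derive_sin R) (tw_derive y).
have dc := has_derive_comp (@has_derive_cos R) (tw_derive y).
have := has_deriveD (has_deriveZ (2 * pi * y)^-1 (has_deriveM dl ds))
  (has_deriveZ (M * (2 * pi * y) ^+ 2)^-1 dc).
by move: (2 * pi * y) th0 => th th0; apply: has_derive_eq => w; field; rewrite ?M0 th0.
Qed.

Let tri_sin_anti (M y : R) : M != 0 -> y != 0 ->
  has_derive (fun w => - ((1 + M^-1 * w) * cos (tw y w)) / (2 * pi * y) +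
     sin (tw y w) / (M * (2 * pi * y) ^+ 2))
    (fun w => (1 + M^-1 * w) * sin (tw y w)).
Proof.
move=> M0 y0; have th0 : 2 * pi * y != 0 by rewrite !mulf_neq0.
have dl := has_deriveD (has_derive_cst 1) (has_deriveZ M^-1 (@has_derive_id R)).
have ds := has_derive_comp (@has_derive_sin R) (tw_derive y).
have dc := has_derive_comp (@has_derive_cos R) (tw_derive y).
have := has_deriveD (has_deriveZ (- (2 * pi * y)^-1) (has_deriveM dl dc))
  (has_deriveZ (M * (2 * pi * y) ^+ 2)^-1 ds).
by move: (2 * pi * y) th0 => th th0; apply: has_derive_eq => w; field; rewrite ?M0 th0.
Qed.

Let tw0 y : tw y 0 = 0. Proof. by rewrite /tw; ring. Qed.
Let twN y w : tw y (- w) = - tw y w. Proof. by rewrite /tw; ring. Qed.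

Lemma fejerE N y : 0 < N -> y != 0 ->
  fejer N y = 2 * (1 - cos (tw y N)) / (N * (2 * pi * y) ^+ 2).
Proof.
move=> N0 y0; have Nn0 : N != 0 by rewrite gt_eqF.
have NN0 : - N != 0 by rewrite oppr_eq0.
rewrite fejer_cint// (cint_triangle N0 (@cont_cosw _ y)).
rewrite (cintE _ _ (tri_cos_anti Nn0 y0)) (cintE _ _ (tri_cos_anti NN0 y0)).
rewrite tw0 twN sinN cosN sin0 cos0.
have : 2 * pi * y != 0 by rewrite !mulf_neq0.
by move: (2 * pi * y) => th th0; field; rewrite Nn0 th0.
Qed.

Lemma triangle_sin N y : 0 < N ->
  (\int[mu]_(w in `[- N, N]) (triangle N w * sin (tw y w)))%R = 0.
Proof.
move=> N0; have Nn0 : N != 0 by rewrite gt_eqF.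
have NN0 : - N != 0 by rewrite oppr_eq0.
rewrite Rintegral_cint; last 2 first.
- by apply: contM; [exact: cont_triangle|exact: cont_sinw].
- by apply/ltW/gtrN.
have [->|y0] := eqVneq y 0.
  rewrite (_ : (fun w => _) = (fun=> 0)); first by rewrite cint_cst mul0r.
  by apply/funext => w; rewrite /tw mulr0 sin0 mulr0.
rewrite (cint_triangle N0 (@cont_sinw _ y)).
rewrite (cintE _ _ (tri_sin_anti Nn0 y0)) (cintE _ _ (tri_sin_anti NN0 y0)).
rewrite tw0 twN sinN cosN sin0 cos0.
have : 2 * pi * y != 0 by rewrite !mulf_neq0.
by move: (2 * pi * y) => th th0; field; rewrite Nn0 th0.
Qed.

Lemma fejer0 N : 0 < N -> fejer N 0 = N.
Proof.
move=> N0; have Nn0 : N != 0 by rewrite gt_eqF.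
have NN0 : - N != 0 by rewrite oppr_eq0.
rewrite fejer_cint// (cint_triangle N0 (@cont_cosw _ 0)).
have d (M : R) : has_derive (fun w => w + M^-1 * w ^+ 2 / 2) (fun w => (1 + M^-1 * w) * cos (tw 0 w)).
  have := has_deriveD (@has_derive_id R) (has_deriveZ (M^-1 / 2) (has_derive_sqr (@has_derive_id R))).
  apply: has_derive_eq => w; first by ring.
  by rewrite /tw mulr0 cos0 !mulr1; move: (M^-1) => c; field.
by rewrite (cintE _ _ (d N)) (cintE _ _ (d (- N))); field; rewrite Nn0.
Qed.

Lemma fejer_ge0 N y : 0 < N -> 0 <= fejer N y.
Proof.
move=> N0; have [->|y0] := eqVneq y 0; first by rewrite fejer0// ltW.
rewrite fejerE//; apply: divr_ge0; apply: mulr_ge0.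
- by [].
- by rewrite subr_ge0; exact: cos_le1.
- exact: ltW.
- exact: sqr_ge0.
Qed.

Lemma fejer_scale N y : 0 < N -> fejer N y = N * fejer 1 (N * y).
Proof.
move=> N0; have Nn0 : N != 0 by rewrite gt_eqF.
have [->|y0] := eqVneq y 0; first by rewrite mulr0 !fejer0// mulr1.
rewrite !fejerE//; last by rewrite mulf_neq0.
have -> : tw (N * y) 1 = tw y N by rewrite /tw; ring.
have -> : 2 * pi * (N * y) = N * (2 * pi * y) by ring.
have : 2 * pi * y != 0 by rewrite !mulf_neq0.
by move: (2 * pi * y) => th th0; field; rewrite Nn0 th0.
Qed.

Lemma fejer_le N y : 0 < N -> y != 0 -> fejer N y <= (N * y ^+ 2)^-1.
Proof.
move=> N0 y0; rewrite fejerE// ler_pdivrMr; last first.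
  by rewrite mulr_gt0// exprn_even_gt0//= !mulf_neq0.
have -> : (N * y ^+ 2)^-1 * (N * (2 * pi * y) ^+ 2) = (2 * pi) ^+ 2.
  rewrite [(2 * pi * y) ^+ 2]exprMn; move: ((2 * pi) ^+ 2) => c.
  by field; rewrite y0 gt_eqF.
have p2 : 2 <= pi :> R by exact: pi_ge2.
have : 2 ^+ 2 <= pi ^+ 2 :> R by rewrite lerXn2r// nnegrE// pi_ge0.
have := cos_geN1 (tw y N); rewrite exprMn; lra.
Qed.

(** The constant is 2 + 1: the kernel is at most 2, the length of [-1, 1], and its product with y^2
    is at most 1. *)
Lemma fejer1_le y : fejer 1 y <= 3 * (1 + y ^+ 2)^-1.
Proof.
have y2 : 0 < 1 + y ^+ 2 by rewrite ltr_pwDl// sqr_ge0.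
rewrite ler_pdivlMr// mulrDr mulr1.
have h2 : fejer 1 y <= 2.
  rewrite fejer_cint// (_ : 2 = cint (fun=> 1) (- 1) 1); last by rewrite cint_cst; ring.
  apply: le_cint.
  - by apply: contM; [exact: cont_triangle|exact: cont_cosw].
  - exact: cont_cst.
  - by lra.
  move=> w /(triangle_le1 (@ltr01 R))/andP[t0 t1].
  by apply: le_trans (ler_piMr t0 (cos_le1 _)) t1.
have [->|y0] := eqVneq y 0; first by rewrite fejer0// expr0n/= mulr0; lra.
have : fejer 1 y * y ^+ 2 <= 1.
  rewrite -ler_pdivlMr ?exprn_even_gt0//=.
  by have := fejer_le (@ltr01 R) y0; rewrite !mul1r.
lra.
Qed.

Lemma intg_fejer1 : intg [set: R] (fejer 1).
Proof.
have c := fejer_cont (@ltr01 R).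
apply: (@le_intg _ _ _ (fun y => 3 * (1 + (y - 0) ^+ 2)^-1)) => //.
- exact: continuous_measurable_fun.
- by move=> y _; rewrite subr0 ger0_norm ?fejer_ge0// fejer1_le.
- by apply: intgZ => //; exact: intg_cauchy.
Qed.

(** The common integral of all the kernels, carried as a positive constant: reconstruction yields
    [fejer_mass] times the value sought. *)
Definition fejer_mass : R := (\int[mu]_y fejer 1 y)%R.

Lemma fejer_mass_gt0 : 0 < fejer_mass.
Proof.
have c := fejer_cont (@ltr01 R).
have K : 0 < fejer 1 0 by rewrite fejer0.
have : \forall y \near (0 : R), 1 / 2 < fejer 1 y.
  by apply: (cvgr_gt _ (c 0)); rewrite fejer0//; lra.
move=> [r /= r0 Hr].
apply: (@lt_le_trans _ _ (r / 2 * (1 / 2))); first by rewrite !mulr_gt0.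
apply: (@le_trans _ _ (cint (fejer 1) 0 (r / 2))).
  rewrite -[r / 2 in X in X <= _]subr0 mulrC -cint_cst; apply: le_cint => //.
  - exact: cont_cst.
  - by rewrite ltW// divr_gt0.
  move=> y /andP[y0 yr]; apply/ltW/Hr; rewrite /ball_ /= sub0r normrN ger0_norm//.
  by lra.
apply: cint_le_Rintegral => //.
- by move=> y; exact: fejer_ge0.
- exact: intg_fejer1.
- by rewrite ltW// divr_gt0.
Qed.

Lemma intg_fejer N p : 0 < N ->
  intg [set: R] (fun x => fejer N (x - p)) /\
  (\int[mu]_x fejer N (x - p))%R = fejer_mass.
Proof.
move=> N0; have e : (fun x => fejer N (x - p)) = (fun x => N * fejer 1 (N * (x - p))).
  by apply/funext => x; rewrite fejer_scale.
have [I1 I2] := intg_affine p N0 (fejer_cont (@ltr01 R)) (fun y => fejer_ge0 y (@ltr01 R)) intg_fejer1.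
by split; [rewrite e|rewrite /fejer_mass -I2; congr (Rintegral _ _ _)].
Qed.

Lemma intg_fejer_sqr N p : 0 < N -> intg [set: R] (fun x => fejer N (x - p) ^+ 2).
Proof.
move=> N0; have cK : continuous (fun x => fejer N (x - p)).
  rewrite (_ : (fun x => _) = (fun x => fejer N (- p + 1 * x))).
    by apply: cont_affine; exact: fejer_cont.
  by apply/funext => x; rewrite mul1r addrC.
have [IK _] := intg_fejer p N0.
apply: (@le_intg _ _ _ (fun x => 3 * N * fejer N (x - p))) => //.
- by apply: continuous_measurable_fun; exact: cont_sqr.
- move=> x _; rewrite ger0_norm ?sqr_ge0// expr2 ler_wpM2r ?fejer_ge0//.
  rewrite fejer_scale// mulrC ler_wpM2r ?(ltW N0)//.
  apply: le_trans (fejer1_le _) _; rewrite -[leRHS]mulr1 ler_wpM2l// invf_le1.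
    by rewrite lerDl sqr_ge0.
  by rewrite ltr_pwDl// sqr_ge0.
- exact: intgZ.
Qed.

End FejerKernel.

(** * Moving the Fourier transform onto the Fejer kernel *)

Section Duality.
Context {R : realType}.
Notation mu := (@lebesgue_measure R).
Implicit Types (a b u v : R -> R) (w x p N : R).

Lemma Rintegral_fubini (f : measurableTypeR R * measurableTypeR R -> R) u v :
  measurable_fun [set: _] f -> intg [set: R] u -> intg [set: R] v ->
  (forall w x, `|f (w, x)| <= u w * v x) ->
  (\int[mu]_w (\int[mu]_x f (w, x)))%R = (\int[mu]_x (\int[mu]_w f (w, x)))%R.
Proof.
move=> mf Iu Iv fuv.
have mfE : measurable_fun [set: _] (EFin \o f) by exact/measurable_EFinP.
have mT := @measurable_setR R.
have Ix w : intg [set: R] (fun x => f (w, x)).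
  apply: (@le_intg _ _ _ (fun x => u w * v x)) => //; last exact: intgZ.
  exact: measurableT_comp (measurable_pair1 w).
have Iw x : intg [set: R] (fun w => f (w, x)).
  apply: (@le_intg _ _ _ (fun w => v x * u w)) => //; last exact: intgZ.
    exact: measurableT_comp (measurable_pair2 x).
  by move=> w _; rewrite mulrC; exact: fuv.
have If : (mu \x mu)%E.-integrable [set: _] (EFin \o f).
  apply/(integrable12ltyP _ _ mfE).
  apply: (@le_lt_trans _ _ (\int[mu]_w (`|u w| * (\int[mu]_x `|v x|)%R)%:E)%E); last first.
    have := intgZ (\int[mu]_x `|v x|)%R mT (intg_norm Iu).
    move=> /integrableP[_]; apply: le_lt_trans.
    apply: ge0_le_integral => //.
    - by move=> w _; rewrite lee_fin mulr_ge0// Rintegral_ge0.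
    - by apply/measurable_EFinP; apply: measurable_funM => //; apply: measurableT_comp => //; exact: intg_measurable.
    - apply/measurable_EFinP; apply: measurableT_comp => //; apply: measurable_funM => //.
      by apply: measurableT_comp => //; exact: intg_measurable.
    - by move=> w _; rewrite lee_fin mulrC ler_norm.
  apply: ge0_le_integral => //.
  - by move=> w _; exact: integral_ge0.
  - by apply: (measurable_fun_fubini_tonelli_F (abse \o (EFin \o f))) => //=; exact: measurableT_comp.
  - apply/measurable_EFinP; apply: measurable_funM => //; apply: measurableT_comp => //; exact: intg_measurable.
  - move=> w _; have Iv' := intg_norm Iv.
    have h : intg [set: R] (fun x => `|u w| * `|v x|) by exact: intgZ.
    rewrite -RintegralZl// /Rintegral fineK; last exact: (integrable_fin_num mT h).
    apply: ge0_le_integral => //.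
    + by apply/measurable_EFinP; apply: measurableT_comp => //; exact: intg_measurable (Ix w).
    + by apply/measurable_EFinP; exact: intg_measurable h.
    + by move=> x _; rewrite /= lee_fin -normrM; apply: le_trans (fuv _ _) (ler_norm _).
have := Fubini If; rewrite /fubini_F /fubini_G /=.
have -> : (fun w => \int[mu]_x (f (w, x))%:E)%E = (fun w => ((\int[mu]_x f (w, x))%R)%:E).
  by apply/funext => w; rewrite /Rintegral fineK//; exact: (integrable_fin_num mT (Ix w)).
have -> : (fun x => \int[mu]_w (f (w, x))%:E)%E = (fun x => ((\int[mu]_w f (w, x))%R)%:E).
  by apply/funext => x; rewrite /Rintegral fineK//; exact: (integrable_fin_num mT (Iw x)).
by rewrite [X in X = _ -> _]/integral => H; congr fine.
Qed.

(** For f = a + i b, the real part of the Fourier transform is [ft a b] and its imaginary part is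
    [ft b (- a)]. *)
Definition ft a b w : R :=
  (\int[mu]_x (a x * cos (tw x w) + b x * sin (tw x w)))%R.

Lemma intg_bounded_trig a w : intg [set: R] a ->
  intg [set: R] (fun x => a x * cos (tw x w)) /\
  intg [set: R] (fun x => a x * sin (tw x w)).
Proof.
move=> Ia; have mT := @measurable_setR R.
have ctw : continuous (fun x => tw x w).
  exact: (has_derive_continuous (has_deriveZ (2 * pi * w) (@has_derive_id R))).
have mc : measurable_fun [set: R] (fun x => cos (tw x w)).
  by apply: continuous_measurable_fun => x; apply: (continuous_comp (ctw x)); exact: continuous_cos.
have ms : measurable_fun [set: R] (fun x => sin (tw x w)).
  by apply: continuous_measurable_fun => x; apply: (continuous_comp (ctw x)); exact: continuous_sin.
split; apply: (@le_intg _ _ _ (fun x => `|a x|)) => //; try exact: intg_norm.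
- by apply: measurable_funM => //; exact: intg_measurable.
- by move=> x _; have := trig_norm_le (a x) 0 (tw x w); rewrite mul0r addr0 normr0 addr0.
- by apply: measurable_funM => //; exact: intg_measurable.
- by move=> x _; have := trig_norm_le 0 (a x) (tw x w); rewrite mul0r add0r normr0 add0r.
Qed.

Lemma ft_cont a b : intg [set: R] a -> intg [set: R] b -> continuous (ft a b).
Proof.
move=> Ia Ib w; have mT := @measurable_setR R.
pose f w x := a x * cos (tw x w) + b x * sin (tw x w).
have If (y : R) : (`]w - 1, w + 1[%classic : set R) y -> mu.-integrable [set: R] (EFin \o f y).
  move=> _; have [Ia1 _] := intg_bounded_trig y Ia; have [_ Ib1] := intg_bounded_trig y Ib.
  exact: intgD.
have cf : {ae mu, forall y, [set: R] y -> {in (`]w - 1, w + 1[%classic : set R), continuous (f ^~ y)}}.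
  apply: aeW => y _ z _.
  have d := has_derive_affine (2 * pi * y) 0.
  have := has_derive_continuous (has_deriveD (has_deriveZ (a y) (d _ _ (@has_derive_cos R)))
    (has_deriveZ (b y) (d _ _ (@has_derive_sin R)))).
  have -> : (fun x => a y * cos (0 + 2 * pi * y * x) + b y * sin (0 + 2 * pi * y * x)) = f ^~ y.
    by apply/funext => t; rewrite /f /tw add0r (_ : 2 * pi * y * t = 2 * pi * t * y)//; ring.
  by apply.
have Ig : intg [set: R] (fun x => `|a x| + `|b x|) by apply: intgD => //; exact: intg_norm.
have ub (y : R) : (`]w - 1, w + 1[%classic : set R) y ->
    {ae mu, forall x, [set: R] x -> `|f y x| <= `|a x| + `|b x|}.
  by move=> _; apply: aeW => x _; exact: trig_norm_le.
have wI : w \in (`]w - 1, w + 1[%classic : set R).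
  by rewrite inE /= in_itv/=; apply/andP; split; lra.
exact: (continuity_under_integral mT If cf Ig ub wI).
Qed.

Lemma triangle_out N w : 0 < N -> N < `|w| -> triangle N w < 0.
Proof. by move=> N0 Nw; rewrite /triangle subr_lt0 ltr_pdivlMl// mulr1. Qed.

Lemma Rintegral_triangle N (s : R -> R) : 0 < N ->
  (\int[mu]_w (Num.max (triangle N w) 0 * s w))%R =
  (\int[mu]_(w in `[- N, N]) (triangle N w * s w))%R.
Proof.
move=> N0; rewrite [RHS]Rintegral_mkcond; apply: eq_Rintegral => w _.
rewrite patchE; case: ifPn => [|]; rewrite ?inE ?notin_setE /= in_itv/= -ler_norml.
  by rewrite ler_norml => /(triangle_le1 N0)/andP[t0 _]; rewrite max_l.
move/negP; rewrite -ltNge => /(triangle_out N0) /ltW t0.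
by rewrite max_r// mul0r.
Qed.

(** The left side pairs the triangle with the real part of e^(2 pi i p w) times the transform of a +
    i b. Integrating in w before x, the cosine transform of the triangle goes with a and gives the
    kernel, while its sine transform goes with b and vanishes by evenness. *)
Lemma fejer_duality N p a b : 0 < N -> intg [set: R] a -> intg [set: R] b ->
  (\int[mu]_(w in `[- N, N]) (triangle N w *
     (ft a b w * cos (tw p w) - ft b (fun x => - a x) w * sin (tw p w))))%R =
  (\int[mu]_x (a x * fejer N (x - p)))%R.
Proof.
move=> N0 Ia Ib; have mT := @measurable_setR R.
(* The positive part lets both integrals run over the whole line, as [Rintegral_fubini] requires. *)
pose T w := Num.max (triangle N w) 0.
have cT : continuous T.
  by move=> w; apply: continuous_max; [exact: cont_triangle|exact: cont_cst].
have T0 w : 0 <= T w by rewrite /T le_max lexx orbT.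
have mT' := continuous_measurable_fun cT.
have IT : intg [set: R] T.
  apply: (@intg_bounded_cint _ _ (2 * N)) => // c d cd.
  have := @cint_ge0 R.
  pose e := Num.max (Num.max `|c| `|d|) N.
  have [ce de Ne] : [/\ `|c| <= e, `|d| <= e & N <= e].
    by rewrite /e !le_max !lexx !orbT.
  have ge x y : x <= y -> 0 <= cint T x y by move=> xy; apply: cint_ge0.
  have := ler_norm (- c); rewrite normrN => c1; have := ler_norm d => d1 _.
  have z x y : x <= y -> (forall t, x <= t <= y -> T t = 0) -> cint T x y = 0.
    move=> xy t0; rewrite (@cint_eq _ _ (fun=> 0) _ _ cT (@cont_cst R 0) xy t0).
    by rewrite cint_cst mul0r.
  have zl : cint T (- e) (- N) = 0.
    apply: z; first by rewrite lerN2.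
    move=> t /andP[_ tN]; rewrite /T max_r// /triangle subr_le0 ler_pdivlMl// mulr1.
    by rewrite ler0_norm; lra.
  have zr : cint T N e = 0.
    apply: z => // t /andP[tN _]; rewrite /T max_r// /triangle subr_le0 ler_pdivlMl// mulr1.
    by rewrite ger0_norm; lra.
  have mid : cint T (- N) N <= 2 * N.
    rewrite (_ : 2 * N = cint (fun=> 1) (- N) N); last by rewrite cint_cst; ring.
    apply: le_cint => //; [exact: cont_cst|by apply/ltW/gtrN|].
    by move=> w /(triangle_le1 N0)/andP[t0 t1]; rewrite /T max_l.
  have := cint_cat T (- e) c e; have := cint_cat T c d e.
  have := cint_cat T (- e) (- N) e; have := cint_cat T (- N) N e.
  have := ge (- e) c; have := ge d e.
  by move=> /(_ ltac:(lra)) g1 /(_ ltac:(lra)) g2; lra.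
pose f (z : measurableTypeR R * measurableTypeR R) : R :=
  T z.1 * (a z.2 * cos (2 * pi * z.1 * (z.2 - p)) + b z.2 * sin (2 * pi * z.1 * (z.2 - p))).
have mth : measurable_fun [set: measurableTypeR R * measurableTypeR R]
    (fun z : measurableTypeR R * measurableTypeR R => 2 * pi * z.1 * (z.2 - p) : R).
  apply: measurable_funM; first by apply: measurable_funM => //; exact: measurable_fst.
  by apply: measurable_funB => //; exact: measurable_snd.
have mf : measurable_fun [set: _] f.
  apply: measurable_funM; first exact: (measurableT_comp mT' measurable_fst).
  apply: measurable_funD; apply: measurable_funM.
  - exact: (measurableT_comp (intg_measurable Ia) measurable_snd).
  - by apply: (measurableT_comp _ mth); apply: continuous_measurable_fun; exact: continuous_cos.
  - exact: (measurableT_comp (intg_measurable Ib) measurable_snd).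
  - by apply: (measurableT_comp _ mth); apply: continuous_measurable_fun; exact: continuous_sin.
have Iab : intg [set: R] (fun x => `|a x| + `|b x|) by apply: intgD => //; exact: intg_norm.
have fle (w x : R) : `|f (w, x)| <= T w * (`|a x| + `|b x|).
  by rewrite /f /= normrM ger0_norm// ler_wpM2l// trig_norm_le.
have := Rintegral_fubini mf IT Iab fle.
have -> : (fun w => (\int[mu]_x f (w, x))%R) = (fun w => T w *
   (ft a b w * cos (tw p w) - ft b (fun x => - a x) w * sin (tw p w))).
  apply/funext => w.
  have [Iac Ias] := intg_bounded_trig w Ia; have [Ibc Ibs] := intg_bounded_trig w Ib.
  have Ina : intg [set: R] (fun x => - a x) by have := intgZ (-1) mT Ia; apply: (intg_eq mT) => x _; rewrite mulN1r.
  have [_ Inas] := intg_bounded_trig w Ina.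
  have I1 := intgD mT Iac Ibs; have I2 := intgD mT Ibc Inas.
  rewrite /ft ![_ * cos (tw p w)]mulrC ![_ * sin (tw p w)]mulrC.
  rewrite -RintegralZl// -[in X in _ * (_ - X)]RintegralZl//.
  have I1' := intgZ (cos (tw p w)) mT I1; have I2' := intgZ (sin (tw p w)) mT I2.
  rewrite -RintegralB// -RintegralZl//; last exact: intgB.
  apply: eq_Rintegral => x _; rewrite /f /=; congr (_ * _).
  have -> : 2 * pi * w * (x - p) = tw x w - tw p w by rewrite /tw; ring.
  by rewrite cosB sinB; ring.
have -> : (fun x => (\int[mu]_w f (w, x))%R) = (fun x => a x * fejer N (x - p)).
  apply/funext => x.
  have e : (fun w => f (w, x)) = (fun w => T w * (a x * cos (tw (x - p) w) + b x * sin (tw (x - p) w))).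
    by [].
  rewrite (_ : (\int[mu]_w f (w, x))%R = (\int[mu]_w (T w * (a x * cos (tw (x - p) w) + b x * sin (tw (x - p) w))))%R)//.
  rewrite Rintegral_triangle//.
  have mD := measurable_itvcc (- N) N.
  have Ic : intg `[- N, N]%classic (fun w => triangle N w * cos (tw (x - p) w)).
    by apply: intg_continuous; apply: contM; [exact: cont_triangle|exact: cont_cosw].
  have Is : intg `[- N, N]%classic (fun w => triangle N w * sin (tw (x - p) w)).
    by apply: intg_continuous; apply: contM; [exact: cont_triangle|exact: cont_sinw].
  transitivity ((\int[mu]_(w in `[- N, N]) (a x * (triangle N w * cos (tw (x - p) w)) +
     b x * (triangle N w * sin (tw (x - p) w))))%R).
    by apply: eq_Rintegral => w _; ring.
  rewrite RintegralD//; [|exact: intgZ|exact: intgZ].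
  rewrite RintegralZl// RintegralZl// triangle_sin// mulr0 addr0; congr (_ * _).
  by apply: eq_Rintegral => w _; rewrite mul0r addr0.
by rewrite Rintegral_triangle.
Qed.

End Duality.

(** * The Bernstein space *)

Section Reconstruction.
Context {R : realType}.
Notation mu := (@lebesgue_measure R).
Implicit Types (a b g : R -> R) (w x p e N B : R).

Lemma eq_of_norm_le (x y C : R) : (forall e, 0 < e -> `|x - y| <= C * e) -> x = y.
Proof.
move=> H; apply/eqP; rewrite -subr_eq0 -normr_le0; apply/ler_addgt0Pr => e e0.
rewrite add0r; have C1 : 0 < `|C| + 1 by rewrite ltr_wpDl.
apply: le_trans (H (e / (`|C| + 1)) (divr_gt0 e0 C1)) _.
rewrite mulrCA ler_piMr ?(ltW e0)// ler_pdivrMr// mul1r.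
by apply: le_trans (ler_norm C) _; rewrite lerDl.
Qed.

(* [a] and [g1, g2] are limits in L^2 of integrable functions and of their
   Fourier transforms. *)
Definition ft_approx a g1 g2 : Prop := forall e : R, 0 < e -> exists an bn,
  [/\ intg [set: R] an, intg [set: R] bn,
      intg [set: R] (fun x => (an x - a x) ^+ 2) /\
        (\int[mu]_x ((an x - a x) ^+ 2))%R <= e &
      intg [set: R] (fun w => (ft an bn w - g1 w) ^+ 2 +
          (ft bn (fun x => - an x) w - g2 w) ^+ 2) /\
        (\int[mu]_w ((ft an bn w - g1 w) ^+ 2 +
          (ft bn (fun x => - an x) w - g2 w) ^+ 2))%R <= e].

Lemma intgS (A D : set (measurableTypeR R)) (f : R -> R) :
  measurable A -> measurable D -> A `<=` D -> intg D f -> intg A f.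
Proof. by move=> mA mD AD; apply: integrableS. Qed.

Lemma fejer_shift_cont N p : 0 < N -> continuous (fun x => fejer N (x - p)).
Proof.
move=> N0; have -> : (fun x => fejer N (x - p)) = (fun x => fejer N (- p + 1 * x)).
  by apply/funext => x; rewrite mul1r addrC.
by apply: cont_affine; exact: fejer_cont.
Qed.

(* Both sides are L^2-continuous in [a] and [g1, g2], so duality for integrable
   functions passes to the limit. *)
Lemma fejer_identity N p a g1 g2 : 0 < N ->
  measurable_fun [set: R] a -> intg [set: R] (fun x => a x ^+ 2) ->
  sqintg N g1 -> sqintg N g2 -> ft_approx a g1 g2 ->
  (\int[mu]_(w in `[- N, N]) (triangle N w * (g1 w * cos (tw p w) - g2 w * sin (tw p w))))%R =
  (\int[mu]_x (a x * fejer N (x - p)))%R.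
Proof.
move=> N0 ma a2 s1 s2 app; have mT := @measurable_setR R.
have mD := measurable_itvcc (- N) N; set D := `[- N, N]%classic in mD *.
have K2 := intg_fejer_sqr p N0.
have mK := continuous_measurable_fun (fejer_shift_cont (p := p) N0).
have cT := @cont_triangle R N.
have IT2 : intg D (fun w => triangle N w ^+ 2) by apply: intg_continuous; exact: cont_sqr.
have mTr : measurable_fun D (triangle N) by exact: cont_measurable.
set K := (\int[mu]_x (fejer N (x - p) ^+ 2))%R.
set T2 := (\int[mu]_(w in D) (triangle N w ^+ 2))%R.
apply: (@eq_of_norm_le _ _ (2 + K + T2)) => e e0.
(* Tolerance e^2, because Young's inequality with parameter e divides it by e. *)
have [an [bn [Ian Ibn [Id dle] [IE Ele]]]] := app (e ^+ 2) (exprn_gt0 2 e0).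
have Inan : intg [set: R] (fun x => - an x).
  by have := intgZ (-1) mT Ian; apply: (intg_eq mT) => x _; rewrite mulN1r.
have dual := fejer_duality p N0 Ian Ibn.
have man := intg_measurable Ian.
have [IaK _] := Rintegral_young mT ma mK e0 a2 K2.
have mdn : measurable_fun [set: R] (fun x => an x - a x) by exact: measurable_funB.
have [IdK dK] := Rintegral_young mT mdn mK e0 Id K2.
have rhs : `|(\int[mu]_x (an x * fejer N (x - p)))%R - (\int[mu]_x (a x * fejer N (x - p)))%R| <= e + e * K.
  have -> : (\int[mu]_x (an x * fejer N (x - p)))%R - (\int[mu]_x (a x * fejer N (x - p)))%R =
     (\int[mu]_x ((an x - a x) * fejer N (x - p)))%R.
    rewrite -RintegralB//; first by apply: eq_Rintegral => x _; rewrite mulrBl.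
    by have := intgD mT IdK IaK; apply: (intg_eq mT) => x _; rewrite mulrBl subrK.
  apply: le_trans dK _; rewrite lerD2r.
  by rewrite ler_pdivrMl// -expr2.
pose c w := cos (tw p w); pose s w := sin (tw p w).
have cc : continuous c by exact: cont_cosw.
have cs : continuous s by exact: cont_sinw.
have cA := ft_cont Ian Ibn; have cB := ft_cont Ibn Inan.
pose dA w := ft an bn w - g1 w; pose dB w := ft bn (fun x => - an x) w - g2 w.
(* A component of (dA, dB) rotated by the angle 2 pi w p, hence E^2 <= dA^2 + dB^2. *)
pose E w := dA w * c w - dB w * s w.
have [mg1 _] := s1; have [mg2 _] := s2.
have mdA : measurable_fun D dA.
  by apply: measurable_funB => //; exact: cont_measurable.
have mdB : measurable_fun D dB.
  by apply: measurable_funB => //; exact: cont_measurable.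
have mE : measurable_fun D E.
  by apply: measurable_funB; apply: measurable_funM => //; exact: cont_measurable.
have E2 w : E w ^+ 2 <= dA w ^+ 2 + dB w ^+ 2.
  have -> : dA w ^+ 2 + dB w ^+ 2 = E w ^+ 2 + (dA w * s w + dB w * c w) ^+ 2.
    rewrite -[LHS]mulr1 -(cos2Dsin2 (tw p w)) -/(c w) -/(s w) /E; ring.
  by rewrite lerDl sqr_ge0.
have IED : intg D (fun w => dA w ^+ 2 + dB w ^+ 2) by apply: intgS IE.
have IE2 : intg D (fun w => E w ^+ 2).
  apply: le_intg IED => //; first exact: measurable_funX.
  by move=> w _; rewrite ger0_norm ?sqr_ge0.
have [IET ET] := Rintegral_young mD mE mTr e0 IE2 IT2.
have E2le : (\int[mu]_(w in D) (E w ^+ 2))%R <= e ^+ 2.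
  apply: le_trans Ele; apply: (@le_trans _ _ (\int[mu]_(w in D) (dA w ^+ 2 + dB w ^+ 2))%R).
    exact: le_Rintegral.
  rewrite /Rintegral fine_le//.
  - exact: (integrable_fin_num mD IED).
  - exact: (integrable_fin_num mT IE).
  apply: ge0_subset_integral => //.
    by have := intg_measurable IE => /measurable_EFinP.
  by move=> w _; rewrite lee_fin addr_ge0 ?sqr_ge0.
have IL : intg D (fun w => triangle N w * (g1 w * c w - g2 w * s w)).
  have I1 := sqintgM s1 (contM cc cT); have I2 := sqintgM s2 (contM cs cT).
  by have := intgB mD I1 I2; apply: (intg_eq mD) => w _; ring.
have lhs : `|(\int[mu]_(w in D) (triangle N w * (ft an bn w * c w - ft bn (fun x => - an x) w * s w)))%R -
    (\int[mu]_(w in D) (triangle N w * (g1 w * c w - g2 w * s w)))%R| <= e + e * T2.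
  have IL' : intg D (fun w => triangle N w * (ft an bn w * c w - ft bn (fun x => - an x) w * s w)).
    by apply: intg_continuous; apply: contM => //; apply: contB; exact: contM.
  rewrite -RintegralB//.
  have -> : (\int[mu]_(w in D) (triangle N w * (ft an bn w * c w - ft bn (fun x => - an x) w * s w) -
      triangle N w * (g1 w * c w - g2 w * s w)))%R = (\int[mu]_(w in D) (E w * triangle N w))%R.
    by apply: eq_Rintegral => w _; rewrite /E /dA /dB; ring.
  apply: le_trans ET _; rewrite lerD2r.
  by rewrite ler_pdivrMl// -expr2.
move: lhs rhs; rewrite dual; set Y := (\int[mu]_x (an x * _))%R.
set X := (\int[mu]_(w in D) _)%R; set Z := (\int[mu]_x (a x * _))%R => lhs rhs.
have -> : X - Z = (Y - Z) - (Y - X) by ring.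
apply: le_trans (ler_normB _ _) _; lra.
Qed.

(** Near p continuity bounds |a x - a p|. Away from p the kernel is at most Cr / N times k(x) = 1 /
    (1 + (x - p)^2); since a is only square integrable there, |a| k is controlled by a^2 + k, which
    gives the integrable majorant [M]. *)
Lemma fejer_approx_identity a p e : continuous a ->
  intg [set: R] (fun x => a x ^+ 2) -> 0 < e -> exists2 N0, 0 < N0 &
  forall N, N0 <= N ->
    `|(\int[mu]_x (a x * fejer N (x - p)))%R - fejer_mass * a p| <= (fejer_mass + 1) * e.
Proof.
move=> ca a2 e0; have mT := @measurable_setR R.
have [r /= r0 Hr] : \forall x \near p, `|a p - a x| <= e.
  exact: (@cvgrPdist_le _ _ _ _ _ a (a p)).1 (ca p) e e0.
pose k x := (1 + (x - p) ^+ 2)^-1.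
have k0 x : 0 <= k x by rewrite invr_ge0 addr_ge0 ?sqr_ge0.
have k1 x : k x <= 1 by rewrite invf_le1 ?lerDl ?sqr_ge0// ltr_pwDl// sqr_ge0.
have Ik : intg [set: R] k by exact: intg_cauchy.
pose M x := a x ^+ 2 + (1 + `|a p|) * k x.
have IM : intg [set: R] M by apply: intgD => //; exact: intgZ.
have M0 x : 0 <= M x by rewrite addr_ge0 ?sqr_ge0// mulr_ge0// addr_ge0.
(* For |y| >= r one has (1 + y^2) / y^2 <= Cr. *)
pose Cr := 1 + (r ^+ 2)^-1.
have Cr0 : 0 < Cr by rewrite /Cr ltr_pwDl// invr_ge0 sqr_ge0.
have I0 : 0 <= (\int[mu]_x M x)%R by exact: Rintegral_ge0.
have [I EI] : exists I, (\int[mu]_x M x)%R = I by eexists.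
rewrite EI in I0.
exists (Cr * I / e + 1); first by rewrite ltr_wpDl// divr_ge0 ?(ltW e0)// mulr_ge0// ltW.
move=> N NN; have N0 : 0 < N by apply: lt_le_trans NN; rewrite ltr_wpDl// divr_ge0 ?(ltW e0)// mulr_ge0// ltW.
have small : Cr / N * I <= e.
  rewrite mulrAC ler_pdivrMr// -ler_pdivrMl//; apply: le_trans NN.
  by rewrite mulrC lerDl.
have pointwise x : `|a x - a p| * fejer N (x - p) <= e * fejer N (x - p) + Cr / N * M x.
  have CM : 0 <= Cr / N * M x by rewrite !mulr_ge0 ?invr_ge0 ?M0// ltW.
  have eK : 0 <= e * fejer N (x - p) by rewrite mulr_ge0 ?fejer_ge0// ltW.
  have [xr|rx] := ltP `|p - x| r.
    apply: ler_wpDr => //; apply: ler_wpM2r; first exact: fejer_ge0.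
    by rewrite distrC; exact: Hr.
  apply: ler_wpDl => //.
  have y0 : x - p != 0.
    by rewrite -normr_gt0 distrC; apply: lt_le_trans rx.
  have yr : r ^+ 2 <= (x - p) ^+ 2.
    by rewrite -[leRHS]real_normK ?num_real// distrC lerXn2r ?nnegrE// ltW.
  have y2 : 0 < (x - p) ^+ 2 by rewrite exprn_even_gt0.
  have Kle : fejer N (x - p) <= Cr / N * k x.
    apply: le_trans (fejer_le N0 y0) _; rewrite invfM mulrC [Cr / N]mulrC -mulrA.
    rewrite [leLHS]mulrC ler_pM2l ?invr_gt0//.
    rewrite -[leLHS]mul1r ler_pdivrMr// /k mulrAC ler_pdivlMr; last by rewrite ltr_pwDl// ltW.
    rewrite mul1r /Cr mulrDl mul1r addrC lerD2l.
    by rewrite ler_pdivlMl ?mulr1// exprn_gt0.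
  apply: (@le_trans _ _ ((`|a x| + `|a p|) * (Cr / N * k x))).
    by apply: ler_pM => //; [exact: fejer_ge0|exact: ler_normB].
  rewrite mulrCA ler_pM2l; last by rewrite divr_gt0.
  rewrite /M mulrDl mulrDl mul1r addrA lerD2r.
  have kk : k x ^+ 2 <= k x by rewrite expr2 ler_piMr.
  have := sqr_ge0 (`|a x| - k x); rewrite sqrrB real_normK ?num_real//.
  have := sqr_ge0 (a x); have := sqr_ge0 (k x); lra.
have [IK Km] := intg_fejer p N0.
have IaK : intg [set: R] (fun x => a x * fejer N (x - p)).
  have mK := continuous_measurable_fun (fejer_shift_cont (p := p) N0).
  exact: (Rintegral_young mT (continuous_measurable_fun ca) mK e0 a2 (intg_fejer_sqr p N0)).1.
have IpK := intgZ (a p) mT IK.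
have IS : intg [set: R] (fun x => e * fejer N (x - p) + Cr / N * M x).
  by apply: (intgD mT); apply: (intgZ _ mT).
have IdK := intgB mT IaK IpK.
have -> : (\int[mu]_x (a x * fejer N (x - p)))%R - fejer_mass * a p =
    (\int[mu]_x (a x * fejer N (x - p) - a p * fejer N (x - p)))%R.
  by rewrite (RintegralB mT IaK IpK) (RintegralZl _ mT IK) Km mulrC.
apply: le_trans (le_normr_Rintegral mT IdK) _.
apply: (@le_trans _ _ (\int[mu]_x (e * fejer N (x - p) + Cr / N * M x))%R).
  apply: (le_Rintegral mT (intg_norm IdK) IS) => x _.
  by rewrite -mulrBl normrM [`|fejer _ _|]ger0_norm ?fejer_ge0.
rewrite (RintegralD mT (intgZ e mT IK) (intgZ (Cr / N) mT IM)).
rewrite (RintegralZl _ mT IK) (RintegralZl _ mT IM) Km EI [leRHS]mulrC mulrDr mulr1.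
by rewrite lerD2l.
Qed.

(** Both sides of [fejer_identity] are followed for large N: the kernel concentrates at p, and the
    triangle tends to 1 on the band with error at most B / N. *)
Lemma reconstruction B p a g1 g2 : 0 < B -> continuous a ->
  intg [set: R] (fun x => a x ^+ 2) ->
  measurable_fun [set: R] g1 -> measurable_fun [set: R] g2 ->
  intg [set: R] (fun w => g1 w ^+ 2) -> intg [set: R] (fun w => g2 w ^+ 2) ->
  (forall w, B < `|w| -> g1 w = 0 /\ g2 w = 0) -> ft_approx a g1 g2 ->
  fejer_mass * a p = trig B g1 (fun w => - g2 w) p.
Proof.
move=> B0 ca a2 m1 m2 q1 q2 gout app; have mT := @measurable_setR R.
have sq N : sqintg N g1 /\ sqintg N g2.
  have mD := measurable_itvcc (- N) N.
  split; split; by [apply: measurable_funS mT _ _ |apply: intgS mD mT _ _].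
have mD := measurable_itvcc (- B) B; set D := `[- B, B]%classic in mD *.
have [s1 s2] := sq B; have [i1 i2] := (sqintg_intg s1, sqintg_intg s2).
pose h w := g1 w * cos (tw p w) - g2 w * sin (tw p w).
have hle w : `|h w| <= `|g1 w| + `|g2 w|.
  have -> : h w = g1 w * cos (tw p w) + - g2 w * sin (tw p w) by rewrite /h mulNr.
  by apply: le_trans (trig_norm_le _ _ _) _; rewrite normrN.
have Ih : intg D h.
  apply: intgB => //; apply: sqintgM => //; [exact: cont_cosw|exact: cont_sinw].
have IG : intg D (fun w => `|g1 w| + `|g2 w|) by apply: intgD => //; exact: intg_norm.
set G := (\int[mu]_(w in D) (`|g1 w| + `|g2 w|))%R.
have G0 : 0 <= G by apply: Rintegral_ge0 => w _; rewrite addr_ge0.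
have -> : trig B g1 (fun w => - g2 w) p = (\int[mu]_(w in D) h w)%R.
  by apply: eq_Rintegral => w _; rewrite /h mulNr.
apply: (@eq_of_norm_le _ _ (fejer_mass + 2)) => e e0.
have [N0 N0p HN] := fejer_approx_identity p ca a2 e0.
(* N0 serves the approximate identity, B makes [-N, N] contain the band, and B G / e makes the
   replacement of the triangle by 1 cost at most e. *)
pose N := Num.max N0 (Num.max B (B * G / e)).
have NN0 : N0 <= N by rewrite /N le_max lexx.
have NB : B <= N by rewrite /N !le_max lexx orbT.
have NG : B * G / e <= N by rewrite /N !le_max lexx !orbT.
have Np : 0 < N by apply: lt_le_trans NN0.
have [t1 t2] := sq N.
have id := fejer_identity p Np (continuous_measurable_fun ca) a2 t1 t2 app.
have := HN N NN0; rewrite -id.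
have -> : (\int[mu]_(w in `[- N, N]) (triangle N w * (g1 w * cos (tw p w) - g2 w * sin (tw p w))))%R =
   (\int[mu]_(w in D) (triangle N w * h w))%R.
  rewrite [LHS]Rintegral_mkcond [RHS]Rintegral_mkcond; apply: eq_Rintegral => w _.
  rewrite !patchE; case: (boolP (w \in D)) => wD; case: ifPn => wN //.
    move: wN; rewrite notin_setE /= in_itv/= => wN; exfalso; apply: wN.
    by move: wD; rewrite inE /D /= in_itv/= => /andP[h1 h2]; apply/andP; split; lra.
  have [z1 z2] : g1 w = 0 /\ g2 w = 0.
    apply: gout; rewrite ltNge; apply/negP => wB; move: wD; rewrite notin_setE; apply.
    by rewrite /D /= in_itv/= -ler_norml.
  by rewrite z1 z2 !mul0r subrr mulr0.
have ITh : intg D (fun w => triangle N w * h w).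
  have c1 := contM (@cont_cosw _ p) (@cont_triangle _ N).
  have c2 := contM (@cont_sinw _ p) (@cont_triangle _ N).
  have := intgB mD (sqintgM s1 c1) (sqintgM s2 c2).
  by apply: (intg_eq mD) => w _; rewrite /h; ring.
have dif : `|(\int[mu]_(w in D) h w)%R - (\int[mu]_(w in D) (triangle N w * h w))%R| <= e.
  have Id : intg D (fun w => h w - triangle N w * h w) by exact: intgB.
  rewrite -RintegralB//; apply: le_trans (le_normr_Rintegral mD Id) _.
  apply: (@le_trans _ _ (\int[mu]_(w in D) (B / N * (`|g1 w| + `|g2 w|)))%R).
    apply: le_Rintegral => //; [exact: intg_norm|exact: intgZ|].
    move=> w; rewrite /D /= in_itv/= -ler_norml => wB.
    have -> : h w - triangle N w * h w = N^-1 * `|w| * h w by rewrite /triangle; ring.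
    rewrite normrM; apply: ler_pM => //.
    rewrite ger0_norm ?mulr_ge0 ?invr_ge0 ?(ltW Np)// mulrC.
    by rewrite ler_pM2r ?invr_gt0.
  by rewrite RintegralZl// -/G mulrAC ler_pdivrMr// -ler_pdivrMl// mulrC.
move: dif; set X := (\int[mu]_(w in D) h w)%R; set Y := (\int[mu]_(w in D) _)%R => dif H.
have -> : fejer_mass * a p - X = - (X - Y) - (Y - fejer_mass * a p) by ring.
apply: le_trans (ler_normB _ _) _; rewrite normrN.
by rewrite mulrDl; move: H; rewrite mulrDl; lra.
Qed.

End Reconstruction.

(** * From the Plancherel transform to towers *)

Section BernsteinTower.
Context {R : realType}.
Notation mu := (@lebesgue_measure R).
Implicit Types (f g : R -> R[i]) (w x p e B : R).

Lemma sqr_normc (z : R[i]) : normc z ^+ 2 = complex.Re z ^+ 2 + complex.Im z ^+ 2.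
Proof. by case: z => a b /=; rewrite sqr_sqrtr// addr_ge0 ?sqr_ge0. Qed.

Lemma normc_ge0 (z : R[i]) : 0 <= normc z.
Proof. by case: z => a b; exact: sqrtr_ge0. Qed.

Lemma re_normc (z : R[i]) : `|complex.Re z| <= normc z.
Proof.
rewrite -(@ler_pXn2r _ 2) ?nnegrE ?normc_ge0// sqr_normc real_normK ?num_real//.
by rewrite lerDl sqr_ge0.
Qed.

Lemma im_normc (z : R[i]) : `|complex.Im z| <= normc z.
Proof.
rewrite -(@ler_pXn2r _ 2) ?nnegrE ?normc_ge0// sqr_normc real_normK ?num_real//.
by rewrite lerDr sqr_ge0.
Qed.

(* The complement of the support is covered by the countably many intervals with
   rational end points on which [g] vanishes almost everywhere. *)
Lemma ess_supp_ae g (D : set R) : ess_supp g `<=` D ->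
  {ae mu, forall w, ~ D w -> g w = 0}.
Proof.
move=> gD.
pose I (r : rat * rat) : set R := `]ratr r.1, ratr r.2[%classic.
pose F (k : nat) : set R := if unpickle k is Some r then
  [set y | `[< {ae mu, forall y, I r y -> g y = 0} >] /\ ~ (I r y -> g y = 0)] else set0.
have nF k : mu.-negligible (F k).
  rewrite /F; case: (unpickle k) => [r|]; last exact: negligible_set0.
  case: asboolP => [h|h]; first by apply: negligibleS h => y /= [_].
  by apply: negligibleS (negligible_set0 mu) => y /= [].
apply: negligibleS (negligible_bigcup nF) => /=; move=> w' /=; pose w : R := w'; rewrite -[w']/w => /not_implyP[Dw gw].
have /existsNP[U] : ~ ess_supp g w by move=> /gD.
move=> /not_implyP[oU /not_implyP[Uw /contrapT aeU]].
have [r /= r0 rU] := open_nbhs_nbhs (conj oU Uw).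
have [p pI] := @rat_in_itvoo R (w - r) w ltac:(lra).
have [q qI] := @rat_in_itvoo R w (w + r) ltac:(lra).
move: pI qI; rewrite !in_itv/= => /andP[p1 p2] /andP[q1 q2].
exists (pickle (p, q)); first exact: Logic.I.
 rewrite /F pickleK; split.
  apply/asboolP; apply: negligibleS aeU => y /=; apply: contra_not => Uy.
  rewrite /I /= in_itv/= => /andP[y1 y2]; apply: Uy; apply: rU; rewrite /= ltr_norml; apply/andP; split; lra.
by rewrite /I /= in_itv/= p2 q1 => /(_ isT).
Qed.

Lemma re_fourier f w : re (fourier f) w = ft (re f) (im f) w.
Proof.
apply: eq_Rintegral => x _; rewrite /re /im /expi /tw.
by case: (f x) => a b /=; rewrite cosN sinN; ring.
Qed.

Lemma im_fourier f w : im (fourier f) w = ft (im f) (fun x => - re f x) w.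
Proof.
apply: eq_Rintegral => x _; rewrite /re /im /expi /tw.
by case: (f x) => a b /=; rewrite cosN sinN; ring.
Qed.

Lemma intg_ge0_le (h : R -> R) e : measurable_fun [set: R] h -> (forall x, 0 <= h x) ->
  (\int[mu]_x (h x)%:E <= e%:E)%E -> intg [set: R] h /\ (\int[mu]_x h x)%R <= e.
Proof.
move=> mh h0 he; have Ih : intg [set: R] h.
  apply/integrableP; split; first exact/measurable_EFinP.
  apply: le_lt_trans (ltry e); apply: le_trans he.
  by rewrite le_eqVlt; apply/orP; left; apply/eqP; apply: eq_integral => x _; rewrite /= ger0_norm.
split => //; rewrite -lee_fin /Rintegral fineK//.
exact: (integrable_fin_num (@measurable_setR R) Ih).
Qed.

Lemma inL1_intg f : inL1 f -> intg [set: R] (re f) /\ intg [set: R] (im f).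
Proof.
move=> [[mr mi] fi].
have mn : measurable_fun [set: R] (fun x => normc (f x)).
  have -> : (fun x => normc (f x)) = (fun x => Num.sqrt (re f x ^+ 2 + im f x ^+ 2)).
    by apply/funext => x; rewrite /re /im; case: (f x).
  apply: measurableT_comp; first exact: (continuous_measurable_fun (@sqrt_continuous R)).
  by apply: measurable_funD; exact: measurable_funX.
have Ih : intg [set: R] (fun x => normc (f x)).
  apply/integrableP; split; first exact/measurable_EFinP.
  apply: le_lt_trans fi.
  by rewrite le_eqVlt; apply/orP; left; apply/eqP; apply: eq_integral => x _; rewrite /= ger0_norm ?normc_ge0.
by split; apply: le_intg Ih => // x _; [exact: re_normc|exact: im_normc].
Qed.

Lemma inL2_intg f : inL2 f -> intg [set: R] (fun x => re f x ^+ 2) /\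
  intg [set: R] (fun x => im f x ^+ 2).
Proof.
move=> [[mr mi] fi].
have Ih : intg [set: R] (fun x => re f x ^+ 2 + im f x ^+ 2).
  apply/integrableP; split.
    by apply/measurable_EFinP; apply: measurable_funD; exact: measurable_funX.
  apply: le_lt_trans fi; rewrite le_eqVlt; apply/orP; left; apply/eqP.
  apply: eq_integral => x _ /=.
  by rewrite sqr_normc ger0_norm// addr_ge0 ?sqr_ge0.
split; apply: le_intg Ih => //; try exact: measurable_funX.
- by move=> x _; rewrite ger0_norm ?sqr_ge0// lerDl sqr_ge0.
- by move=> x _; rewrite ger0_norm ?sqr_ge0// lerDr sqr_ge0.
Qed.

(** Cutting g off with the indicator of the band changes it on a null set only and makes it vanish
    everywhere outside. The imaginary part of f is the real part of - i f, whose transform has real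
    part g2 and imaginary part - g1; the approximants bn, - an are chosen accordingly. *)
Lemma fourier_approx f g B : is_fourierL2 f g -> ess_supp g `<=` `[- B, B]%classic ->
  exists g1 g2 : R -> R,
  [/\ measurable_fun [set: R] g1 /\ measurable_fun [set: R] g2,
      intg [set: R] (fun w => g1 w ^+ 2) /\ intg [set: R] (fun w => g2 w ^+ 2),
      forall w, B < `|w| -> g1 w = 0 /\ g2 w = 0 &
      ft_approx (re f) g1 g2 /\ ft_approx (im f) g2 (fun w => - g1 w)].
Proof.
move=> [fL2 gL2 [fn [fnL fncvg gcvg]]] supp; have mT := @measurable_setR R.
have [[mrf mif] _] := fL2; have [[mrg mig] _] := gL2.
have [rg2 ig2] := inL2_intg gL2.
have mD := measurable_itvcc (- B) B; set D := `[- B, B]%classic in mD supp *.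
pose ch w : R := \1_D w.
have mch : measurable_fun [set: R] ch by exact: measurable_indic.
pose g1 w := ch w * re g w; pose g2 w := ch w * im g w.
have m1 : measurable_fun [set: R] g1 by exact: measurable_funM.
have m2 : measurable_fun [set: R] g2 by exact: measurable_funM.
have ch2 (y w : R) : `|(ch w * y) ^+ 2| <= y ^+ 2.
  rewrite ger0_norm ?sqr_ge0// exprMn ler_piMl ?sqr_ge0// /ch indicE.
  by case: (_ \in _); rewrite ?expr1n ?expr0n.
have approx e : 0 < e -> exists an bn,
    [/\ intg [set: R] an, intg [set: R] bn,
      intg [set: R] (fun x => (an x - re f x) ^+ 2 + (bn x - im f x) ^+ 2) /\
        (\int[mu]_x ((an x - re f x) ^+ 2 + (bn x - im f x) ^+ 2))%R <= e &
      intg [set: R] (fun w => (ft an bn w - g1 w) ^+ 2 +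
          (ft bn (fun x => - an x) w - g2 w) ^+ 2) /\
        (\int[mu]_w ((ft an bn w - g1 w) ^+ 2 +
          (ft bn (fun x => - an x) w - g2 w) ^+ 2))%R <= e].
  move=> e0.
  have ev (h : nat -> \bar R) : h n @[n --> \oo] --> 0%E -> \forall n \near \oo, (h n < e%:E)%E.
    move=> hc; have := hc (fun y => (y < e%:E)%E); apply; apply: open_ereal_lt'.
    by rewrite lte_fin.
  have [n /= [h1 h2]] := filter_ex (filterI (ev _ fncvg) (ev _ gcvg)).
  have [L1 [[mrn min] _]] := fnL n; have [Ian Ibn] := inL1_intg L1.
  have Inan : intg [set: R] (fun x => - re (fn n) x).
    by have := intgZ (-1) mT Ian; apply: (intg_eq mT) => x _; rewrite mulN1r.
  exists (re (fn n)), (im (fn n)); split => //.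
    apply: intg_ge0_le.
    - by apply: measurable_funD; apply: measurable_funX; exact: measurable_funB.
    - by move=> x; rewrite addr_ge0 ?sqr_ge0.
    apply: le_trans (ltW h1); rewrite le_eqVlt; apply/orP; left; apply/eqP; apply: eq_integral => x _.
    by rewrite sqr_normc /re /im; case: (fn n x) (f x) => [? ?] [].
  have mA := continuous_measurable_fun (ft_cont Ian Ibn).
  have mB := continuous_measurable_fun (ft_cont Ibn Inan).
  have mE (u v : R -> R) : measurable_fun [set: R] u -> measurable_fun [set: R] v ->
     measurable_fun [set: R] (fun w => (ft (re (fn n)) (im (fn n)) w - u w) ^+ 2 +
          (ft (im (fn n)) (fun x => - re (fn n) x) w - v w) ^+ 2).
    by move=> mu1 mv; apply: measurable_funD; apply: measurable_funX; exact: measurable_funB.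
  apply: intg_ge0_le; first exact: mE.
    by move=> x; rewrite addr_ge0 ?sqr_ge0.
  apply: le_trans (ltW h2); rewrite le_eqVlt; apply/orP; left; apply/eqP.
  have -> : L2normsq (fun w => fourier (fn n) w - g w) =
     (\int[mu]_w ((ft (re (fn n)) (im (fn n)) w - re g w) ^+ 2 +
          (ft (im (fn n)) (fun x => - re (fn n) x) w - im g w) ^+ 2)%:E)%E.
    apply: eq_integral => w _; rewrite sqr_normc -re_fourier -im_fourier /re /im.
    by case: (fourier (fn n) w) (g w) => [? ?] [].
  apply: ge0_ae_eq_integral => //.
  - by apply/measurable_EFinP; exact: mE.
  - by apply/measurable_EFinP; exact: mE.
  - by move=> x _; rewrite lee_fin addr_ge0 ?sqr_ge0.
  - by move=> x _; rewrite lee_fin addr_ge0 ?sqr_ge0.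
  apply: (@filterS _ _ (ae_filter_ringOfSetsType mu) _ _ _ (ess_supp_ae supp)) => w gw _; rewrite /g1 /g2 /ch indicE.
  case: (boolP (w \in D)) => [_|]; first by rewrite !mul1r.
  by rewrite notin_setE => /gw; rewrite /re /im => ->; rewrite !mul0r.
exists g1, g2; split => //.
- split.
    apply: le_intg rg2 => //; first exact: measurable_funX.
    by move=> w _; exact: ch2.
  apply: le_intg ig2 => //; first exact: measurable_funX.
  by move=> w _; exact: ch2.
- move=> w wB; rewrite /g1 /g2 /ch indicE; case: (boolP (w \in D)); last by rewrite !mul0r.
  by rewrite inE /D /= in_itv/= -ler_norml leNgt wB.
split=> e e0; have [an [bn [Ia Ib [I1 L1] [I2 L2]]]] := approx e e0.
- exists an, bn; split => //.
  have J : intg [set: R] (fun x => (an x - re f x) ^+ 2).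
    apply: le_intg I1 => //; last by move=> x _; rewrite ger0_norm ?sqr_ge0// lerDl sqr_ge0.
    by apply: measurable_funX; apply: measurable_funB => //; exact: intg_measurable.
  split => //; apply: le_trans L1; apply: (le_Rintegral mT J I1) => x _.
  by rewrite lerDl sqr_ge0.
- have Ina : intg [set: R] (fun x => - an x).
    by have := intgZ (-1) mT Ia; apply: (intg_eq mT) => x _; rewrite mulN1r.
  exists bn, (fun x => - an x); split => //.
    have J : intg [set: R] (fun x => (bn x - im f x) ^+ 2).
      apply: le_intg I1 => //; last by move=> x _; rewrite ger0_norm ?sqr_ge0// lerDr sqr_ge0.
      by apply: measurable_funX; apply: measurable_funB => //; exact: intg_measurable.
    split => //; apply: le_trans L1; apply: (le_Rintegral mT J I1) => x _.
    by rewrite lerDr sqr_ge0.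
  have e2 w : (ft bn (fun x => - an x) w - g2 w) ^+ 2 +
      (ft (fun x => - an x) (fun x => - bn x) w - - g1 w) ^+ 2 =
      (ft an bn w - g1 w) ^+ 2 + (ft bn (fun x => - an x) w - g2 w) ^+ 2.
    have -> : ft (fun x => - an x) (fun x => - bn x) w = - ft an bn w.
      have [I3 _] := intg_bounded_trig w Ia; have [_ I4] := intg_bounded_trig w Ib.
      rewrite -[RHS]mulN1r /ft -RintegralZl//; last exact: intgD.
      by apply: eq_Rintegral => x _; ring.
    ring.
  split; first by apply: (intg_eq mT) I2 => w _; rewrite e2.
  apply: le_trans L2; rewrite le_eqVlt; apply/orP; left; apply/eqP.
  by apply: eq_Rintegral => w _; exact: e2.
Qed.

Lemma band_limitedZ (c s : R) U : band_limited s U -> band_limited s (fun j x => c * U j x).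
Proof.
move=> [tU [C UC]]; split; first exact: towerZ.
exists (c ^+ 2 * C) => j a b ab.
have -> : (fun x => (c * U j x) ^+ 2) = (fun x => c ^+ 2 * (U j x) ^+ 2).
  by apply/funext => x; rewrite exprMn.
rewrite cintZ; last exact: (cont_sqr (tower_continuous j tU)).
by rewrite -mulrA ler_wpM2l ?sqr_ge0// UC.
Qed.

(** With B = sigma / (2 pi) the growth factor (2 pi B)^2 of the trigonometric towers is sigma^2. The
    equality with f holds at every point, so these towers supply all derivatives of f. *)
Lemma bernstein_towers sigma f : 0 < sigma -> bernstein sigma f ->
  exists U V, [/\ band_limited (sigma ^+ 2) U, band_limited (sigma ^+ 2) V,
                  re f = U 0%N & im f = V 0%N].
Proof.
move=> s0 [cr ci [g fg supp]]; have mT := @measurable_setR R.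
have pi2 : 0 < 2 * pi :> R by rewrite mulr_gt0// pi_gt0.
pose B := sigma / (2 * pi); have B0 : 0 < B by rewrite divr_gt0.
have sB : (2 * pi * B) ^+ 2 = sigma ^+ 2 by rewrite /B mulrC divfK// gt_eqF.
have [g1 [g2 [[m1 m2] [i1 i2] out [a1 a2]]]] := fourier_approx fg supp.
have [fL2 _ _] := fg; have [r2 j2] := inL2_intg fL2.
have m3 : measurable_fun [set: R] (fun w => - g1 w) by exact: measurableT_comp.
have i3 : intg [set: R] (fun w => (- g1 w) ^+ 2).
  by apply: (intg_eq mT) i1 => w _; rewrite sqrrN.
have out' w : B < `|w| -> g2 w = 0 /\ - g1 w = 0.
  by move=> /out[-> ->]; rewrite oppr0.
have mD := measurable_itvcc (- B) B.
have sq (h : R -> R) : measurable_fun [set: R] h -> intg [set: R] (fun w => h w ^+ 2) -> sqintg B h.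
  by move=> mh ih; split; [apply: measurable_funS mT _ mh|apply: intgS mD mT _ ih].
have s1 := sq _ m1 i1; have s2 := sq _ m2 i2; have s3 := sq _ m3 i3.
have c0 := @fejer_mass_gt0 R.
exists (fun j x => fejer_mass^-1 * trig_tower B g1 (fun w => - g2 w) j x),
  (fun j x => fejer_mass^-1 * trig_tower B g2 (fun w => - - g1 w) j x).
split.
- by apply: band_limitedZ; rewrite -sB; apply: trig_band_limited => //; exact: sqintgN.
- by apply: band_limitedZ; rewrite -sB; apply: trig_band_limited => //; exact: sqintgN.
- apply/funext => p; rewrite -[trig_tower _ _ _ _ _]/(trig B g1 (fun w => - g2 w) p).
  by rewrite -(reconstruction p B0 cr r2 m1 m2 i1 i2 out a1) mulKf// gt_eqF.
- apply/funext => p; rewrite -[trig_tower _ _ _ _ _]/(trig B g2 (fun w => - - g1 w) p).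
  by rewrite -(reconstruction p B0 ci j2 m2 m3 i2 i3 out' a2) mulKf// gt_eqF.
Qed.

End BernsteinTower.

(** * Sampling inequalities *)

Section IntegerSums.
Context {R : realType}.
Implicit Types (a : int -> R) (M : R).

Lemma esum_int_ge a (c : int) m : (forall i, 0 <= a i) ->
  ((\sum_(j < m) a (c + j%:Z))%:E <= \esum_(i in [set: int]) (a i)%:E)%E.
Proof.
move=> a0; apply: esum_ge; exists ((fun j : nat => c + j%:Z) @` `I_m).
  by split => //; exact: finite_image (finite_II m).
rewrite fsbig_image; last by move=> i j _ _ /addrI [].
by rewrite fsumEFin ?finite_II// (fsbig_ord _ _ (fun j => a (c + j%:Z))).
Qed.

(** A finite set of integers lies in a window of consecutive ones, and over such windows the
    integrals on sample intervals telescope. *)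
Lemma esum_int_le a M : (forall i, 0 <= a i) ->
  (forall c m, \sum_(j < m) a (c + j%:Z) <= M) ->
  (\esum_(i in [set: int]) (a i)%:E <= M%:E)%E.
Proof.
move=> a0 aM; apply: ge_ereal_sup => _ [X [finX _] <-].
have [s Xs] := (finite_seqP X).1 finX.
have [n sn] : exists n : nat, forall i, i \in s -> (`|i| < n)%N.
  elim: s {Xs} => [|i s [n sn]]; first by exists 0%N.
  exists (maxn n `|i|.+1) => j; rewrite inE => /orP[/eqP ->|/sn jn].
    by rewrite leq_max ltnSn orbT.
  by rewrite leq_max jn.
pose Y := (fun j : nat => - n%:Z + j%:Z) @` `I_(2 * n).
have finY : finite_set Y by exact: finite_image (finite_II _).
apply: (@le_trans _ _ (\sum_(i \in Y) (a i)%:E)%E).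
  apply: lee_fsum_nneg_subset => //; last by move=> t _; rewrite lee_fin.
  move=> i; rewrite !inE Xs /= => /sn iN; exists (absz (i + n%:Z)); rewrite /=; lia.
rewrite fsbig_image; last by move=> i j _ _ /addrI [].
by rewrite fsumEFin ?finite_II// -(fsbig_ord _ _ (fun j => a (- n%:Z + j%:Z))) lee_fin.
Qed.

Lemma zsum_ge0 a : (forall i, 0 <= a i) ->
  zsum a = \esum_(i in [set: int]) (a i)%:E.
Proof.
move=> a0; rewrite /zsum.
rewrite (_ : \esum_(i in [set: int]) (Num.max (- a i) 0)%:E = 0%E) ?sube0.
  by apply: eq_esum => i _; rewrite max_l.
by apply: esum1 => i _; rewrite max_r// oppr_le0.
Qed.

End IntegerSums.

Lemma mu_gt0 {R : realType} n : 0 < mu (2 * n.+1 - 1) :> R.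
Proof.
rewrite /mu divr_gt0// ltr0n muln_gt0 addn3 muln_gt0 addn2 muln_gt0 addn1 !andbT.
by rewrite mulnS.
Qed.

Lemma Cbin_gt0 {R : realType} n : 0 < Cbin n.+1 :> R.
Proof. by rewrite /Cbin exprn_gt0// big_ord_recl /= bin0 ltr_pwDl// sumr_ge0. Qed.

(** * Summation over the sample intervals *)

Section SamplingBounds.
Context {R : realType}.
Variables (x : int -> R) (gamma delta : R).
Hypothesis gamma0 : 0 < gamma.
Hypothesis gapP : forall i, gamma <= x (i + 1) - x i <= delta.
Implicit Types (U : nat -> R -> R) (q : R -> R) (c i : int).

Let gap i : R := x (i + 1) - x i.

Let gap_gt0 i : 0 < gap i.
Proof. by have /andP[h _] := gapP i; exact: lt_le_trans h. Qed.

Let delta0 : 0 < delta.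
Proof. by have /andP[_ h] := gapP 0; exact: lt_le_trans (gap_gt0 0) h. Qed.

Let xS i : x (i + 1) = x i + gap i.
Proof. by rewrite /gap [RHS]addrC subrK. Qed.

Lemma weight_gt0 i l : 0 < weight x i l.
Proof.
by rewrite /weight divr_gt0 ?exprn_gt0//; exact: gap_gt0.
Qed.

Lemma weight_le i l :
  weight x i l <= delta ^+ (2 * l) / (l`!)%:R ^+ 2 * gap i.
Proof.
have l0 : 0 < (l`!)%:R :> R by rewrite ltr0n fact_gt0.
have /andP[_ gd] := gapP i; have g0 := gap_gt0 i.
rewrite /weight -/(gap i) mulrAC ler_pM//.
- by rewrite exprn_ge0// ltW.
- by rewrite exprD expr1 ler_pM2r// lerXn2r// nnegrE ltW.
- have l2 : 0 < (l`!)%:R ^+ 2 :> R by rewrite exprn_gt0.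
  have p : (l`!)%:R ^+ 2 <= (2 * l + 1)%:R * (l`!)%:R ^+ 2 :> R.
    by apply: ler_peMl; [exact: ltW|rewrite ler1n addn1].
  by rewrite lef_pV2// posrE; apply: lt_le_trans p.
Qed.

Lemma cint_telescope q c m :
  \sum_(j < m) cint q (x (c + j%:Z)) (x (c + j%:Z + 1)) = cint q (x c) (x (c + m%:Z)).
Proof.
elim: m => [|m IH]; first by rewrite big_ord0 addr0 cintxx.
have -> : c + m.+1%:Z = c + m%:Z + 1 by lia.
by rewrite big_ord_recr /= IH cint_cat.
Qed.

Lemma x_growth c m : x c + gamma * m%:R <= x (c + m%:Z).
Proof.
elim: m => [|m IH]; first by rewrite mulr0 !addr0.
have := gapP (c + m%:Z); rewrite -addrA -PoszD addn1 => /andP[+ _].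
by rewrite -natr1 mulrDr mulr1; lra.
Qed.

Lemma x_cover a b : exists c m, x c <= a /\ b <= x (c + m%:Z).
Proof.
pose M := (Num.truncn (`|a - x 0| / gamma)).+1; pose M' := (Num.truncn (`|b - x 0| / gamma)).+1.
exists (- M%:Z), (M + M')%N.
have h1 := x_growth (- M%:Z) M; have h2 := x_growth 0 M'.
rewrite addNr in h1; rewrite add0r in h2; rewrite PoszD addKr.
have aM : `|a - x 0| <= gamma * M%:R.
  by rewrite mulrC -ler_pdivrMr// ltW// truncnS_gt.
have bM : `|b - x 0| <= gamma * M'%:R.
  by rewrite mulrC -ler_pdivrMr// ltW// truncnS_gt.
move: aM bM; rewrite !ler_norml => /andP[aM _] /andP[_ bM]; lra.
Qed.

Definition sample k U i : R :=
  \sum_(l < k) U l (x i) ^+ 2 * (weight x i l + weight x (i - 1) l).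

Lemma sample_ge0 k U i : 0 <= sample k U i.
Proof.
by apply: sumr_ge0 => l _; rewrite mulr_ge0 ?sqr_ge0// addr_ge0// ltW ?weight_gt0.
Qed.

(** With s = sigma in [sample_estimate], Bernstein's inequality makes the coefficient of N_l equal
    to (1 + delta sigma) + (delta / sigma) sigma^2 = 1 + 2 delta sigma, which is at most exp(delta^2
    + sigma^2). The factor 2 arises because every interval serves both of its end points. *)
Lemma sampling_upper k sigma U : 0 < sigma -> band_limited (sigma ^+ 2) U ->
  (\esum_(i in [set: int]) (sample k U i)%:E
    <= (upper_const k sigma delta)%:E * energy U 0)%E.
Proof.
move=> s0 bU; have [tU _] := bU.
have s2 : 0 < sigma ^+ 2 by rewrite exprn_gt0.
have c2 j := cont_sqr (tower_continuous j tU).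
pose N j := fine (energy U j).
have NE j : energy U j = (N j)%:E by rewrite fineK// (energy_fin _ bU).
have N0 j : 0 <= N j by rewrite fine_ge0// integral_ge0// => y _; rewrite lee_fin sqr_ge0.
have NS j : N j.+1 <= sigma ^+ 2 * N j.
  by rewrite -lee_fin EFinM -!NE; exact: energy_bernstein.
have Nl l : N l <= sigma ^+ (2 * l) * N 0%N.
  elim: l => [|l IH]; first by rewrite expr0 mul1r.
  apply: le_trans (NS l) _; rewrite mulnS exprD -mulrA.
  by apply: ler_wpM2l IH; rewrite ltW.
have cN l c m : cint (fun t => U l t ^+ 2) (x c) (x (c + m%:Z)) <= N l.
  rewrite -lee_fin -NE; apply: cint_le_integral => [//|t|]; first exact: sqr_ge0.
  by apply: le_trans (x_growth c m); rewrite lerDl mulr_ge0// ltW.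
pose T l i := (1 + delta * sigma) * cint (fun t => U l t ^+ 2) (x i) (x (i + 1)) +
  delta / sigma * cint (fun t => U l.+1 t ^+ 2) (x i) (x (i + 1)).
have step l i : gap i * U l (x i) ^+ 2 <= T l i /\ gap i * U l (x (i + 1)) ^+ 2 <= T l i.
  have := sample_estimate (x i) (tU l) (tower_continuous l.+1 tU) (gap_gt0 i) s0.
  rewrite -xS; have /andP[_ gd] := gapP i.
  set X := _ + _; have XT : X <= T l i.
    have -> : X = (1 + gap i * sigma) * cint (fun t => U l t ^+ 2) (x i) (x (i + 1)) +
        gap i / sigma * cint (fun t => U l.+1 t ^+ 2) (x i) (x (i + 1)) by rewrite /X; ring.
    have x1 : x i <= x (i + 1) by rewrite xS lerDl ltW.
    apply: lerD; apply: ler_wpM2r.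
    - by apply: cint_ge0 => // t _; exact: sqr_ge0.
    - by rewrite lerD2l ler_pM2r.
    - by apply: cint_ge0 => // t _; exact: sqr_ge0.
    - by rewrite ler_pM2r ?invr_gt0.
  by move=> [h1 h2]; split; [exact: le_trans h1 XT|exact: le_trans h2 XT].
have sumT l c m : \sum_(j < m) T l (c + j%:Z) <=
    (1 + 2 * delta * sigma) * (sigma ^+ (2 * l) * N 0%N).
  rewrite big_split /= -!mulr_sumr !cint_telescope.
  apply: (@le_trans _ _ ((1 + delta * sigma) * N l + delta / sigma * (sigma ^+ 2 * N l))).
    have h1 : 0 <= 1 + delta * sigma by rewrite addr_ge0// mulr_ge0 ?ltW.
    have h2 : 0 <= delta / sigma by rewrite divr_ge0 ?ltW.
    by apply: lerD; apply: ler_wpM2l => //; apply: le_trans (NS l).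
  have -> : (1 + delta * sigma) * N l + delta / sigma * (sigma ^+ 2 * N l) =
      (1 + 2 * delta * sigma) * N l by field; rewrite gt_eqF.
  by apply: ler_wpM2l => //; rewrite addr_ge0// !mulr_ge0// ltW.
pose D l : R := delta ^+ (2 * l) / (l`!)%:R ^+ 2.
have D0 l : 0 <= D l by rewrite divr_ge0 ?exprn_ge0// ltW.
rewrite NE -EFinM; apply: esum_int_le => [i|c m]; first exact: sample_ge0.
apply: (@le_trans _ _ (\sum_(j < m) \sum_(l < k) D l * (T l (c + j%:Z) + T l (c - 1 + j%:Z)))).
  apply: ler_sum => j _; apply: ler_sum => l _; set i := c + j%:Z.
  have -> : c - 1 + j%:Z = i - 1 by rewrite /i; lia.
  rewrite [leLHS]mulrDr [leRHS]mulrDr; apply: lerD.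
    apply: (@le_trans _ _ (D l * (gap i * U l (x i) ^+ 2))).
      rewrite mulrA [leLHS]mulrC; apply: ler_wpM2r; [exact: sqr_ge0|exact: weight_le].
    by apply: ler_wpM2l; [exact: D0|have [] := step l i].
  apply: (@le_trans _ _ (D l * (gap (i - 1) * U l (x i) ^+ 2))).
    rewrite mulrA [leLHS]mulrC; apply: ler_wpM2r; [exact: sqr_ge0|exact: weight_le].
  by apply: ler_wpM2l; [exact: D0|have [_] := step l (i - 1); rewrite subrK].
rewrite exchange_big /=.
apply: (@le_trans _ _ (\sum_(l < k) D l * (2 * ((1 + 2 * delta * sigma) * (sigma ^+ (2 * l) * N 0%N))))).
  apply: ler_sum => l _; rewrite -mulr_sumr; apply: ler_wpM2l; first exact: D0.
  by rewrite big_split /= mulr2n mulrDl mul1r; apply: lerD; exact: sumT.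
have e1 : 1 + 2 * delta * sigma <= expR (delta ^+ 2 + sigma ^+ 2).
  apply: le_trans (expR_ge1Dx _); rewrite lerD2l.
  by have := sqr_ge0 (delta - sigma); rewrite sqrrB; lra.
have -> : upper_const k sigma delta * N 0%N = 2 * expR (delta ^+ 2 + sigma ^+ 2) * N 0%N *
    \sum_(l < k) (delta * sigma) ^+ (2 * l) / (l`!)%:R ^+ 2 by rewrite /upper_const; ring.
rewrite mulr_sumr; apply: ler_sum => l _.
rewrite /D exprMn.
have -> : delta ^+ (2 * l) / (l`!)%:R ^+ 2 * (2 * ((1 + 2 * delta * sigma) * (sigma ^+ (2 * l) * N 0%N))) =
  (2 * N 0%N) * (delta ^+ (2 * l) * sigma ^+ (2 * l) / (l`!)%:R ^+ 2) * (1 + 2 * delta * sigma).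
  by ring.
have -> : 2 * expR (delta ^+ 2 + sigma ^+ 2) * N 0%N * (delta ^+ (2 * l) * sigma ^+ (2 * l) / (l`!)%:R ^+ 2) =
  (2 * N 0%N) * (delta ^+ (2 * l) * sigma ^+ (2 * l) / (l`!)%:R ^+ 2) * expR (delta ^+ 2 + sigma ^+ 2).
  by ring.
apply: ler_wpM2l => //.
by rewrite !mulr_ge0 ?invr_ge0 ?exprn_ge0// ltW.
Qed.

Lemma sampling_lower n sigma nu U : 0 < sigma -> is_wirtinger_cimmino n.+1 nu ->
  delta < nu / sigma -> band_limited (sigma ^+ 2) U ->
  ((lower_const n.+1 sigma gamma delta nu)%:E * energy U n
    <= \esum_(i in [set: int]) (sample n.+1 U i)%:E)%E.
Proof.
move=> s0 wnu dnu bU; have [tU _] := bU; have [nu0 _ _] := wnu.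
have s2 : 0 < sigma ^+ 2 by rewrite exprn_gt0.
have c2 j := cont_sqr (tower_continuous j tU).
pose N j := fine (energy U j).
have NE j : energy U j = (N j)%:E by rewrite fineK// (energy_fin _ bU).
have NS : N n.+1 <= sigma ^+ 2 * N n.
  by rewrite -lee_fin EFinM -!NE; exact: energy_bernstein.
(* With this choice (delta^2 / (th nu^2)) sigma^2 = th, so the derivative term becomes th times the
   left-hand side and is absorbed, leaving (1 - th)^2. *)
pose th := delta * sigma / nu.
have th0 : 0 < th by rewrite divr_gt0// mulr_gt0.
have th1 : th < 1 by rewrite ltr_pdivrMr// mul1r -ltr_pdivlMr.
have thI : 0 < th < 1 by rewrite th0.
have th1' : 0 < 1 - th by rewrite subr_gt0.
have ge0 : (0 <= \esum_(i in [set: int]) (sample n.+1 U i)%:E)%E.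
  by apply: esum_ge0 => i _; rewrite lee_fin sample_ge0.
(* If the sampling sum is infinite there is nothing to prove; otherwise everything becomes real
   arithmetic. *)
have [fin|] := boolP (\esum_(i in [set: int]) (sample n.+1 U i)%:E < +oo)%E; last first.
  by rewrite -leNgt leye_eq => /eqP ->; exact: leey.
rewrite -ge0_fin_numE// in fin; rewrite -(fineK fin) NE -EFinM lee_fin.
set S := fine _; have Sge c m : \sum_(j < m) sample n.+1 U (c + j%:Z) <= S.
  by rewrite -lee_fin /S fineK//; apply: esum_int_ge => i; exact: sample_ge0.
pose K : R := 2 * n.+1%:R * (Cbin n.+1 * (Defs.mu (2 * n.+1 - 1) ^+ n / gamma ^+ (2 * n))).
have mu0 := @mu_gt0 R n; have C0 := @Cbin_gt0 R n.
have K0 : 0 < K.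
  apply: mulr_gt0; first by rewrite mulr_gt0.
  by rewrite mulr_gt0// divr_gt0// exprn_gt0.
have step i : cint (fun t => U n t ^+ 2) (x i) (x (i + 1)) <=
    th / sigma ^+ 2 * cint (fun t => U n.+1 t ^+ 2) (x i) (x (i + 1)) +
    (1 - th)^-1 * (K * \sum_(l < n.+1) (U l (x i) ^+ 2 + U l (x (i + 1)) ^+ 2) * weight x i l).
  have /andP[gg gd] := gapP i; have g0 := gap_gt0 i.
  have := hermite_estimate (x i) wnu thI g0 tU; rewrite -xS => /le_trans; apply.
  apply: lerD.
    apply: ler_wpM2r.
      by apply: cint_ge0 => [//||t _]; [rewrite xS lerDl ltW|exact: sqr_ge0].
    apply: (@le_trans _ _ (delta ^+ 2 / (th * nu ^+ 2))).
      rewrite ler_pM2r; last by rewrite invr_gt0 mulr_gt0// exprn_gt0.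
      by rewrite lerXn2r// nnegrE ltW.
    rewrite le_eqVlt; apply/orP; left; apply/eqP; rewrite /th; field.
    by rewrite !gt_eqF.
  rewrite ler_pM2l ?invr_gt0//; apply: ler_wpM2r.
    apply: sumr_ge0 => l _; rewrite mulr_ge0 ?addr_ge0 ?sqr_ge0//.
    exact: ltW (weight_gt0 i l).
  rewrite /K ler_pM2l ?mulr_gt0// ler_pM2l// ler_pM2l ?exprn_gt0//.
  by rewrite lef_pV2 ?posrE ?exprn_gt0// lerXn2r// nnegrE ltW.
have samples c m : \sum_(j < m) \sum_(l < n.+1) (U l (x (c + j%:Z)) ^+ 2 + U l (x (c + j%:Z + 1)) ^+ 2) *
    weight x (c + j%:Z) l <= S.
  (* m intervals have m + 1 nodes; the outward weights at the two extreme nodes are nonnegative and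
     dropped. *)
  apply: le_trans (Sge c m.+1).
  pose P i := \sum_(l < n.+1) U l (x i) ^+ 2 * weight x i l.
  pose Q i := \sum_(l < n.+1) U l (x i) ^+ 2 * weight x (i - 1) l.
  have P0 i : 0 <= P i by apply: sumr_ge0 => l _; rewrite mulr_ge0 ?sqr_ge0// ltW ?weight_gt0.
  have Q0 i : 0 <= Q i by apply: sumr_ge0 => l _; rewrite mulr_ge0 ?sqr_ge0// ltW ?weight_gt0.
  have -> : \sum_(j < m) \sum_(l < n.+1) (U l (x (c + j%:Z)) ^+ 2 + U l (x (c + j%:Z + 1)) ^+ 2) *
      weight x (c + j%:Z) l = \sum_(j < m) P (c + j%:Z) + \sum_(j < m) Q (c + j%:Z + 1).
    rewrite -big_split; apply: eq_bigr => j _; rewrite /P /Q -big_split.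
    by apply: eq_bigr => l _; rewrite addrK mulrDl.
  have -> : \sum_(j < m.+1) sample n.+1 U (c + j%:Z) =
      \sum_(j < m.+1) P (c + j%:Z) + \sum_(j < m.+1) Q (c + j%:Z).
    rewrite -big_split; apply: eq_bigr => j _; rewrite /P /Q /sample -big_split.
    by apply: eq_bigr => l _; rewrite mulrDr.
  apply: lerD; first by rewrite big_ord_recr /= lerDl.
  rewrite [leRHS]big_ord_recl /= -[leLHS]add0r; apply: lerD => //.
  rewrite le_eqVlt; apply/orP; left; apply/eqP; apply: eq_bigr => j _.
  by rewrite /bump /= add1n -addrA -PoszD addn1.
have main : N n <= th * N n + (1 - th)^-1 * (K * S).
  rewrite -lee_fin -NE; apply: bounded_cint_integral => [//|t|a b ab]; first exact: sqr_ge0.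
  have [c [m [ca bm]]] := x_cover a b.
  have cm : x c <= x (c + m%:Z).
    by apply: le_trans (x_growth c m); rewrite lerDl mulr_ge0// ltW.
  apply: (@le_trans _ _ (cint (fun t => U n t ^+ 2) (x c) (x (c + m%:Z)))).
    have := cint_cat (fun t => U n t ^+ 2) (x c) a (x (c + m%:Z)).
    have := cint_cat (fun t => U n t ^+ 2) a b (x (c + m%:Z)).
    have := @cint_ge0 R (fun t => U n t ^+ 2) (x c) a (c2 n) ca (fun t _ => sqr_ge0 _).
    have := @cint_ge0 R (fun t => U n t ^+ 2) b (x (c + m%:Z)) (c2 n) bm (fun t _ => sqr_ge0 _).
    lra.
  rewrite -cint_telescope.
  apply: le_trans (ler_sum _ (fun j _ => step (c + (nat_of_ord j)%:Z))) _.
  rewrite big_split /= -!mulr_sumr cint_telescope; apply: lerD.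
    rewrite -mulrA ler_pM2l// ler_pdivrMl//; apply: le_trans NS.
    by rewrite -lee_fin -NE; apply: cint_le_integral => // t; exact: sqr_ge0.
  by rewrite ler_pM2l ?invr_gt0// ler_pM2l//; exact: samples.
have : (1 - th) ^+ 2 * N n <= K * S.
  have : (1 - th) * N n <= (1 - th)^-1 * (K * S) by lra.
  by rewrite ler_pdivlMl// mulrA -expr2.
have -> : lower_const n.+1 sigma gamma delta nu * N n = (1 - th) ^+ 2 * N n / K.
  rewrite /lower_const -/th subn1 /= /K; field.
  by rewrite nat1r; apply/and4P; split; apply: lt0r_neq0 => //; exact: exprn_gt0.
by rewrite ler_pdivrMr// [S * K]mulrC.
Qed.

End SamplingBounds.

(** * Complex-valued functions *)

Section Frame.
Context {R : realType}.
Implicit Types (U V : nat -> R -> R) (f : R -> R[i]).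

Lemma lower_const_gt0 n (sigma gamma delta nu : R) : 0 < nu -> 0 < gamma -> 0 < sigma ->
  delta < nu / sigma -> 0 < lower_const n.+1 sigma gamma delta nu.
Proof.
move=> nu0 gamma0 s0 dnu; rewrite /lower_const subn1 /=.
have th1 : delta * sigma / nu < 1 by rewrite ltr_pdivrMr// mul1r -ltr_pdivlMr.
apply: mulr_gt0; last by rewrite divr_gt0// exprn_gt0// mu_gt0.
by rewrite mulr_gt0 ?exprn_gt0 ?subr_gt0// divr_gt0// mulr_gt0 ?Cbin_gt0// mulr_gt0.
Qed.

Lemma upper_const_gt0 n (sigma delta : R) : 0 < sigma -> 0 < delta ->
  0 < upper_const n.+1 sigma delta.
Proof.
move=> s0 d0; rewrite /upper_const mulr_gt0 ?expR_gt0// mulr_gt0//.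
rewrite big_ord_recl ltr_pwDl//; first by rewrite divr_gt0// exprn_gt0// ltr0n fact_gt0.
by apply: sumr_ge0 => l _; rewrite divr_ge0 ?exprn_ge0// mulr_ge0// ltW.
Qed.

Lemma normc_cderiv U V f l t : tower U -> tower V -> re f = U 0%N -> im f = V 0%N ->
  normc (cderiv l f t) ^+ 2 = U l t ^+ 2 + V l t ^+ 2.
Proof.
move=> tU tV fU fV; rewrite sqr_normc /cderiv /= fU fV.
by rewrite (tower_derive1n l tU) (tower_derive1n l tV).
Qed.

Lemma L2normsq_cderiv U V f l : tower U -> tower V -> re f = U 0%N -> im f = V 0%N ->
  L2normsq (cderiv l f) = (energy U l + energy V l)%E.
Proof.
move=> tU tV fU fV; rewrite /L2normsq /energy.
have m (W : nat -> R -> R) : tower W ->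
    measurable_fun [set: R] (fun t => (W l t ^+ 2)%:E).
  move=> tW; apply/measurable_EFinP; apply: continuous_measurable_fun.
  exact: (cont_sqr (tower_continuous l tW)).
rewrite -(ge0_integralD lebesgue_measure (@measurable_setR R)).
- by apply: eq_integral => t _; rewrite (normc_cderiv l t tU tV fU fV) EFinD.
- by move=> t _; rewrite lee_fin sqr_ge0.
- exact: m.
- by move=> t _; rewrite lee_fin sqr_ge0.
- exact: m.
Qed.

(** Squared moduli are sums over real and imaginary parts, so the bounds for the two towers add up
    with the same constants. *)
Lemma frame_bounds n (sigma nu : R) (x : int -> R) (gamma delta : R) f :
  0 < sigma -> is_wirtinger_cimmino n.+1 nu -> 0 < gamma ->
  (forall i, gamma <= x (i + 1) - x i <= delta) -> delta < nu / sigma -> bernstein sigma f ->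
  ((lower_const n.+1 sigma gamma delta nu)%:E * L2normsq (cderiv n f)
     <= \esum_(i in [set: int])
          (\sum_(l < n.+1) normc (cderiv l f (x i)) ^+ 2
             * (weight x i l + weight x (i - 1) l))%:E)%E
  /\ (\esum_(i in [set: int])
          (\sum_(l < n.+1) normc (cderiv l f (x i)) ^+ 2
             * (weight x i l + weight x (i - 1) l))%:E
     <= (upper_const n.+1 sigma delta)%:E * L2normsq f)%E.
Proof.
move=> s0 wnu g0 gapP dnu bf.
have [U [V [bU bV fU fV]]] := bernstein_towers s0 bf.
have [tU _] := bU; have [tV _] := bV.
have -> : \esum_(i in [set: int]) (\sum_(l < n.+1) normc (cderiv l f (x i)) ^+ 2
             * (weight x i l + weight x (i - 1) l))%:E =
    (\esum_(i in [set: int]) (sample x n.+1 U i)%:E +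
     \esum_(i in [set: int]) (sample x n.+1 V i)%:E)%E.
  rewrite -esumD; [|by move=> i _; rewrite lee_fin (sample_ge0 g0 gapP)..].
  apply: eq_esum => i _; rewrite -EFinD /sample -big_split; congr EFin.
  by apply: eq_bigr => l _; rewrite (normc_cderiv l _ tU tV fU fV) mulrDl.
have -> : L2normsq f = L2normsq (cderiv 0 f).
  by apply: eq_integral => t _; rewrite !sqr_normc.
rewrite !(L2normsq_cderiv _ tU tV fU fV).
have e0 (W : nat -> R -> R) j : (0 <= energy W j)%E.
  by apply: integral_ge0 => t _; rewrite lee_fin sqr_ge0.
have mD (c : R) j : (c%:E * (energy U j + energy V j) = c%:E * energy U j + c%:E * energy V j)%E.
  by rewrite ge0_muleDr; [by []|exact: e0|exact: e0].
rewrite !mD; split; apply: leeD.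
- exact: sampling_lower.
- exact: sampling_lower.
- exact: (sampling_upper g0 gapP).
- exact: (sampling_upper g0 gapP).
Qed.

End Frame.

Theorem theorem4p2 (R : realType) (sigma : R) (k : nat) (nu : R)
    (x : int -> R) (gamma delta : R)
    (sigma_gt0 : 0 < sigma) (k_ge1 : (1 <= k)%N)
    (nuP : is_wirtinger_cimmino k nu)
    (x_incr : forall i : int, x i < x (i + 1))
    (gamma_gt0 : 0 < gamma)
    (x_sep : forall i j : int, i != j -> gamma <= `|x i - x j|)
    (deltaP : ereal_sup [set (x (i + 1) - x i)%:E | i in [set: int]] = delta%:E)
    (delta_lt : delta < nu / sigma) :
  (forall f : R -> R[i], bernstein sigma f ->
    ((lower_const k sigma gamma delta nu)%:E * L2normsq (cderiv (k - 1) f)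
     <= \esum_(i in [set: int])
          (\sum_(l < k) normc (cderiv l f (x i)) ^+ 2
             * (weight x i l + weight x (i - 1) l))%:E)%E
    /\
    (\esum_(i in [set: int])
          (\sum_(l < k) normc (cderiv l f (x i)) ^+ 2
             * (weight x i l + weight x (i - 1) l))%:E
     <= (upper_const k sigma delta)%:E * L2normsq f)%E)
  /\
  stable_sampling sigma (k - 1) k x
    (fun i l => weight x i l + weight x (i - 1) l).
Proof.
case: k k_ge1 nuP => // n _ nuP; rewrite subn1 /=.
have gapP i : gamma <= x (i + 1) - x i <= delta.
  apply/andP; split; last first.
    by rewrite -lee_fin -deltaP; apply: ereal_sup_ubound; exists i.
  rewrite -[leRHS]ger0_norm ?subr_ge0 ?(ltW (x_incr i))//; apply: x_sep.
  by rewrite -subr_eq0 addrAC subrr add0r.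
have delta_gt0 : 0 < delta.
  by have /andP[g d] := gapP 0; exact: lt_le_trans gamma_gt0 (le_trans g d).
have [nu_gt0 _ _] := nuP.
have frame f := @frame_bounds _ n _ _ x _ _ f sigma_gt0 nuP gamma_gt0 gapP delta_lt.
split => //; split.
  by move=> i l _; rewrite gt_eqF// addr_gt0// (weight_gt0 gamma_gt0 gapP).
exists (lower_const n.+1 sigma gamma delta nu), (upper_const n.+1 sigma delta).
split; [exact: lower_const_gt0|exact: upper_const_gt0|move=> f /frame].
have term_ge0 i : 0 <= sample_term n.+1 x
    (fun i l => weight x i l + weight x (i - 1) l) f i.
  apply: sumr_ge0 => l _; rewrite mulr_ge0 ?exprn_ge0 ?normc_ge0//.
  by rewrite addr_ge0// ltW// (weight_gt0 gamma_gt0 gapP).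
rewrite (zsum_ge0 term_ge0) (@eq_esum _ _ _ _ (fun i => (\sum_(l < n.+1)
  normc (cderiv l f (x i)) ^+ 2 * (weight x i l + weight x (i - 1) l))%:E))//.
by move=> i _; congr EFin; apply: eq_bigr => l _; rewrite mulrC.
Qed.
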